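(* Let $E$ be either $\mathbb{R}$ or $\mathbb{Z}$, with dual group $\hat E$ ($\hat E=\mathbb{R}$ if $E=\mathbb{R}$, $\hat E=\mathbb{T}$ if $E=\mathbb{Z}$), and let $E_-=E\cap(-\infty,0)$. Let $M$ be a weakly stationary random measure on $E^d$ with spectral measure $S$ on $\hat E^d$. Then $M$ is perfectly interpolable from the orthant $E_-^d$ if $$S\le S_1\times\cdots\times S_d,$$ where each $S_i$ is a symmetric non-negative measure on $\hat E$ satisfying $\int_{\hat E}\kappa(u)\,S_i(du)<\infty$ and whose density $s_i$ (the density of the absolutely continuous part of $S_i$) satisfies $\int_{\hat E}\ln(s_i(u))\,\kappa(u)\,du=-\infty$, with $\kappa(u)=(1+|u|)^{-2}$ if $\hat E=\mathbb{R}$ and $\kappa(u)=1$ if $\hat E=\mathbb{T}$.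
   Context: $\mathbb{T}=\{e^{is}:s\in[-\pi,\pi)\}$. For $B\subset E^d$, $\mathcal{C}_c^b(B)$ is the class of bounded measurable functions on $E^d$ with bounded support, supported in $B$. A weakly stationary random measure $M$ on $\mathbb{R}^d$ is a collection of complex square integrable random variables $M(f)$, $f\in\mathcal{C}_c^b(\mathbb{R}^d)$, on a probability space $(\Omega,\mathbf{P})$ such that (i) $M$ a.s. induces a complex-valued measure on each compact set, and (ii) $\mathrm{Var}(M(\tau_x f))=\mathrm{Var}(M(f))$ for every translation $\tau_x$, $x\in\mathbb{R}^d$. On $\mathbb{Z}^d$ it is a random field $(M_m)_{m\in\mathbb{Z}^d}$ of centred square integrable random variables with $M(f)=\sum_m M_m f(m)$ and $\mathrm{Var}(M(\tau_m f))=\mathrm{Var}(M(f))$ for $m\in\mathbb{Z}^d$ and $f$ with finite support. Fourier transform: $\hat f(u)=\int_{\mathbb{R}^d}e^{-iu\cdot x}f(x)\,dx$ on $\mathbb{R}^d$; $\hat f(u)=\sum_{k\in\mathbb{Z}^d}u^k f(k)$, $u\in\mathbb{T}^d$, with $u^k=u_1^{k_1}\cdots u_d^{k_d}$, on $\mathbb{Z}^d$. The spectral measure $S$ of $M$ is the non-negative symmetric measure on $\hat E^d$ such that $\mathrm{Var}(M(f))=(2\pi)^{-d}\int_{\hat E^d}|\hat f|^2\,dS$ for all $f\in\mathcal{C}_c^b(E^d)$. $M$ is perfectly interpolable from $A\subset E^d$ if for every $f\in\mathcal{C}_c^b(A^c)$ there are $h_n\in\mathcal{C}_c^b(A)$,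 $n\ge1$, such that $M(h_n)\to M(f)$ in $L^2(\mathbf{P})$.
   Formalization: On R^d weak stationarity is taken to include a translation-invariant mean, E M(τ_x f) = E M(f), besides the variance condition; otherwise the deterministic M = δ_x with x outside the orthant, S = S_i = 0, is a counterexample. *)

(* Defs.v *)
From HB Require Import structures.
From mathcomp Require Import all_boot all_order all_algebra.
From mathcomp Require Import complex.
From mathcomp Require Import all_classical all_reals all_analysis.

Set Implicit Arguments.
Unset Strict Implicit.
Unset Printing Implicit Defensive.

Import Order.TTheory GRing.Theory Num.Theory.
Import numFieldNormedType.Exports.

Local Open Scope classical_set_scope.
Local Open Scope ring_scope.
Local Open Scope complex_scope.

Section complex_valued_functions.
Context {R : realType}.

Definition abs2 (z : R[i]) : R := complex.Re z ^+ 2 + complex.Im z ^+ 2.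

Definition expi (t : R) : R[i] := cos t +i* sin t.

Context {dT : measure_display} {T : measurableType dT}.

Definition cmeasurable (f : T -> R[i]) : Prop :=
  measurable_fun [set: T] (fun x => complex.Re (f x)) /\
  measurable_fun [set: T] (fun x => complex.Im (f x)).

Definition cintegral (mu : {measure set T -> \bar R}) (f : T -> R[i]) : R[i] :=
  (\int[mu]_x complex.Re (f x)) +i* (\int[mu]_x complex.Im (f x)).

Definition charge_integral (nu : {charge set T -> \bar R}) (f : T -> R) : R :=
  let P := cid (Hahn_decomposition nu) in
  let N := cid (svalP P) in
  (\int[jordan_pos (svalP N)]_x f x) - (\int[jordan_neg (svalP N)]_x f x).

(* A complex measure is encoded by its real part [nu.1] and its imaginary part
   [nu.2], which are finite signed measures. *)
Definition complex_measure_integral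
    (nu : {charge set T -> \bar R} * {charge set T -> \bar R})
    (f : T -> R[i]) : R[i] :=
  let re x := complex.Re (f x) in let im x := complex.Im (f x) in
  (charge_integral nu.1 re - charge_integral nu.2 im)
    +i* (charge_integral nu.1 im + charge_integral nu.2 re).

End complex_valued_functions.

Section second_order.
Context {R : realType} {dO : measure_display} {Omega : measurableType dO}.
Variable P : probability Omega R.
Implicit Type X : Omega -> R[i].

Definition square_integrable X : Prop :=
  cmeasurable X /\ (\int[P]_w (abs2 (X w))%:E < +oo)%E.

Definition cexpectation X : R[i] := cintegral P X.

Definition cvariance X : \bar R :=
  (\int[P]_w (abs2 (X w - cexpectation X))%:E)%E.

Definition cvg_L2 (X_ : nat -> Omega -> R[i]) X : Prop :=
  (fun n => \int[P]_w (abs2 (X_ n w - X w))%:E)%E @ \oo --> 0%E.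

(* [test B f] stands for "f belongs to C_c^b(B)". *)
Definition perfectly_interpolable (V : Type) (test : set V -> (V -> R[i]) -> Prop)
    (M : (V -> R[i]) -> Omega -> R[i]) (A : set V) : Prop :=
  forall f, test (~` A) f ->
    exists h : nat -> V -> R[i],
      (forall n, test A (h n)) /\ cvg_L2 (fun n => M (h n)) (M f).

End second_order.

Definition translate {R : realType} {E : zmodType} {d : nat} (x : d.-tuple E)
    (f : d.-tuple E -> R[i]) : d.-tuple E -> R[i] :=
  fun y => f [tuple tnth y i - tnth x i | i < d].

Definition negative_orthant (E : numDomainType) (d : nat) : set (d.-tuple E) :=
  [set x | forall i, tnth x i < 0].

Section product_measure.
Context {R : realType} {dT : measure_display} {T : measurableType dT}.

Definition tuple_cons n (p : T * n.-tuple T) : n.+1.-tuple T :=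
  [the n.+1.-tuple T of p.1 :: p.2].

Lemma measurable_tuple_cons n :
  measurable_fun [set: T * n.-tuple T] (@tuple_cons n).
Proof. exact: measurable_cons. Qed.

Section cons_measure.
Local Open Scope ereal_scope.
Context {n : nat}.
Variables (m1 : {sigma_finite_measure set T -> \bar R})
  (m2 : {sigma_finite_measure set (n.-tuple T) -> \bar R}).

Definition cons_measure : set (n.+1.-tuple T) -> \bar R :=
  pushforward (m1 \x m2) (@tuple_cons n).

Let cons_measurable A : measurable A -> measurable (@tuple_cons n @^-1` A).
Proof. by move=> mA; rewrite -[X in measurable X]setTI; exact: measurable_tuple_cons. Qed.

Let cons0 : cons_measure set0 = 0.
Proof. by rewrite /cons_measure /pushforward preimage_set0 measure0. Qed.

Let cons_ge0 A : 0 <= cons_measure A.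
Proof. by rewrite /cons_measure /pushforward; exact: measure_ge0. Qed.

Let cons_sigma_additive : semi_sigma_additive cons_measure.
Proof.
have mc := @measurable_tuple_cons n.
exact: (@measure_semi_sigma_additive _ _ _ (pushforward (m1 \x m2) (@tuple_cons n))).
Qed.

HB.instance Definition _ := isMeasure.Build _ _ _ cons_measure
  cons0 cons_ge0 cons_sigma_additive.

Let uncons (x : n.+1.-tuple T) : T * n.-tuple T := (thead x, [tuple of behead x]).

Let cons_sigma_finite : sigma_finite setT cons_measure.
Proof.
have /sigma_finiteP[F [FT ndF Foo]] := sigma_finiteT m1.
have /sigma_finiteP[G [GT ndG Goo]] := sigma_finiteT m2.
have consK : cancel (@tuple_cons n) uncons.
  by move=> [x t]; rewrite /uncons /tuple_cons /= theadE; congr pair; exact: val_inj.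
have munc : measurable_fun [set: n.+1.-tuple T] uncons.
  apply: measurable_fun_pair => /=; first exact: measurable_tnth.
  exact: measurable_behead.
exists (fun k => uncons @^-1` (F k `*` G k)).
  apply/esym; rewrite -subTset => x _ /=.
  have [[k _ Fk] [l _ Gl]] : (\bigcup_k F k) (uncons x).1 /\ (\bigcup_k G k) (uncons x).2.
    by rewrite -FT -GT.
  exists (maxn k l) => //; split.
    by move: Fk; exact/subsetPset/ndF/leq_maxl.
  by move: Gl; exact/subsetPset/ndG/leq_maxr.
move=> k; have [mFk Fkoo] := Foo k; have [mGk Gkoo] := Goo k; split.
  by rewrite -[X in measurable X]setTI; apply: munc => //; exact: measurableX.
rewrite /cons_measure /pushforward -comp_preimage.
rewrite (_ : uncons \o _ = id) ?preimage_id; last first.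
  by apply/funext => p /=; rewrite consK.
by rewrite product_measure1E// lte_mul_pinfty// ge0_fin_numE.
Qed.

HB.instance Definition _ := Measure_isSigmaFinite.Build _ _ _ cons_measure
  cons_sigma_finite.

End cons_measure.

Fixpoint product_measure n :
    ('I_n -> {sigma_finite_measure set T -> \bar R}) ->
    {sigma_finite_measure set (n.-tuple T) -> \bar R} :=
  match n with
  | 0 => fun=> \d_([tuple] : 0.-tuple T)
  | n'.+1 => fun m =>
      cons_measure (m ord0) (product_measure (fun i => m (lift ord0 i)))
  end.

Lemma product_measureE n (m : 'I_n -> {sigma_finite_measure set T -> \bar R})
    (A : 'I_n -> set T) : (forall i, measurable (A i)) ->
  product_measure m [set x | forall i, A i (tnth x i)] = (\prod_(i < n) m i (A i))%E.
Proof.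
elim: n m A => [|n IHn] m A mA /=.
  rewrite big_ord0 diracE mem_set//= => i; by case: i.
rewrite big_ord_recl -IHn; last by move=> i; exact: mA.
rewrite -product_measure1E//; last first.
  rewrite (_ : [set x | _] = \bigcap_(i in [set: 'I_n]) ((@tnth n T ^~ i) @^-1` A (lift ord0 i))).
    apply: fin_bigcap_measurable => // i _.
    by rewrite -[X in measurable X]setTI; exact: measurable_tnth.
  by apply/seteqP; split => x /= xA i => [_|]; apply: xA.
rewrite /cons_measure /pushforward; congr (product_measure1 _ _ _).
apply/seteqP; split => [[x t] /= xA|[x t] /= [xA tA] i].
  split; first by have := xA ord0; rewrite tnth0.
  by move=> i; have := xA (lift ord0 i); rewrite /tuple_cons/= (tnth_nth x)/= -tnth_nth.
case: (unliftP ord0 i) => [j|] ->; last by rewrite tnth0.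
rewrite /tuple_cons/= (tnth_nth x)/= -tnth_nth; exact: tA.
Qed.

End product_measure.

Section spectral_factors.
Local Open Scope ereal_scope.
Context {R : realType} {dT : measure_display} {T : measurableType dT}.
Implicit Types mu lambda : {measure set T -> \bar R}.

Definition symmetric_measure (opp : T -> T) mu : Prop :=
  forall A, measurable A -> mu (opp @^-1` A) = mu A.

(* [s] is a version of the density of the absolutely continuous part of [mu] in
   its Lebesgue decomposition with respect to [lambda]; [nu] is the singular
   part. *)
Definition ac_density lambda mu (s : T -> R) : Prop :=
  [/\ measurable_fun [set: T] s, (forall x, (0 <= s x)%R) &
    exists nu : {measure set T -> \bar R},
      (exists N, [/\ measurable N, lambda N = 0 & nu (~` N) = 0]) /\
      forall A, measurable A -> mu A = \int[lambda]_(x in A) (s x)%:E + nu A].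

(* [lne], unlike [ln], is -oo at 0. *)
Definition log_integral lambda (kappa s : T -> R) : \bar R :=
  \int[lambda]_u (lne (s u)%:E * (kappa u)%:E).

End spectral_factors.

Section continuous_space.
Context {R : realType}.

Definition real_opp (u : measurableTypeR R) : measurableTypeR R := - u.

Definition real_weight (u : measurableTypeR R) : R := (1 + `|u|) ^- 2.

Context {d : nat}.
Local Notation Rd := (d.-tuple (measurableTypeR R)).

Definition test_function (B : set Rd) (f : Rd -> R[i]) : Prop :=
  [/\ cmeasurable f,
      exists C : R, forall x, abs2 (f x) <= C,
      exists r : R, forall x, f x != 0 -> forall i, `|tnth x i| <= r
    & forall x, f x != 0 -> B x].

(* Tuples carry no topology in the library; the usual one is that of row
   vectors. *)
Definition compact_tuples (K : set Rd) : Prop :=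
  compact [set (\row_(i < d) (tnth x i : R)) | x in K].

Definition dot (u x : Rd) : R := \sum_(i < d) (tnth u i : R) * tnth x i.

Definition fourier (f : Rd -> R[i]) (u : Rd) : R[i] :=
  cintegral (product_measure (fun=> lebesgue_measure))
    (fun x => expi (- dot u x) * f x).

Context {dO : measure_display} {Omega : measurableType dO}.
Variable P : probability Omega R.

(* Only the values of [M] on bounded measurable functions with bounded support
   are meaningful. Weak stationarity bears on the first moment as well as on
   the variance. *)
Record weakly_stationary_measure (M : (Rd -> R[i]) -> Omega -> R[i]) : Prop := {
  wsm_square_integrable : forall f, test_function setT f ->
    square_integrable P (M f);
  wsm_complex_measure : {ae P, forall w, forall K, compact_tuples K ->
    exists nu : {charge set Rd -> \bar R} * {charge set Rd -> \bar R},
      forall f, test_function K f -> M f w = complex_measure_integral nu f};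
  wsm_mean : forall (x : Rd) f, test_function setT f ->
    cexpectation P (M (translate x f)) = cexpectation P (M f);
  wsm_variance : forall (x : Rd) f, test_function setT f ->
    cvariance P (M (translate x f)) = cvariance P (M f)
}.

Definition is_spectral_measure (M : (Rd -> R[i]) -> Omega -> R[i])
    (S : {measure set Rd -> \bar R}) : Prop :=
  symmetric_measure (map_tuple real_opp) S /\
  forall f, test_function setT f ->
    cvariance P (M f) =
      (((2 * pi) ^- d)%:E * \int[S]_u (abs2 (fourier f u))%:E)%E.

End continuous_space.

Section circle.
Context {R : realType}.

Definition unit_complex : Type := {z : R[i] | `|z| == 1}.

Lemma norm_expi (t : R) : `|expi t| == 1.
Proof.
by rewrite normc_def /= cos2Dsin2 sqrtr1.
Qed.

HB.instance Definition _ := Choice.on unit_complex.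
HB.instance Definition _ :=
  isPointed.Build unit_complex (exist _ (expi 0) (norm_expi 0)).

Definition unit_complex_coords (u : unit_complex) :
    measurableTypeR R * measurableTypeR R :=
  (complex.Re (val u), complex.Im (val u)).

(* The Borel sigma-algebra of the circle is the trace of that of the plane. *)
Definition circle : Type := g_sigma_algebra_preimageType unit_complex_coords.
HB.instance Definition _ := Measurable.on circle.

Definition circle_val (u : circle) : R[i] := val (u : unit_complex).

Definition circle_expi (t : measurableTypeR R) : circle :=
  exist _ (expi t) (norm_expi t).

Lemma norm_circle_conj (u : circle) : `|(circle_val u)^*| == 1.
Proof.
by case: u => -[a b] /=; rewrite !normc_def /= sqrrN.
Qed.

Definition circle_conj (u : circle) : circle :=
  exist _ (circle_val u)^* (norm_circle_conj u).

Definition circle_weight (u : circle) : R := 1.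

Lemma measurable_circle_expi : measurable_fun [set: measurableTypeR R] circle_expi.
Proof.
move=> _ _ [B mB <-]; rewrite !setTI -comp_preimage.
rewrite -[X in measurable X]setTI.
apply: (measurable_fun_pair (f := cos : measurableTypeR R -> measurableTypeR R)
  (g := sin : measurableTypeR R -> measurableTypeR R)) => //.
  by apply: measurable_realfun.continuous_measurable_fun; exact: continuous_cos.
by apply: measurable_realfun.continuous_measurable_fun; exact: continuous_sin.
Qed.

Definition arc_length : set circle -> \bar R :=
  pushforward (mrestr (@lebesgue_measure R) (measurable_itv `[- pi, pi[)) circle_expi.

Let arc_length0 : arc_length set0 = 0%E.
Proof. by rewrite /arc_length /pushforward preimage_set0 measure0. Qed.

Let arc_length_ge0 A : (0 <= arc_length A)%E.
Proof. by rewrite /arc_length /pushforward; exact: measure_ge0. Qed.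

Let arc_length_sigma_additive : semi_sigma_additive arc_length.
Proof.
have mc := measurable_circle_expi.
exact: (@measure_semi_sigma_additive _ _ _
  (pushforward (mrestr (@lebesgue_measure R) (measurable_itv `[- pi, pi[)) circle_expi)).
Qed.

HB.instance Definition _ := isMeasure.Build _ _ _ arc_length
  arc_length0 arc_length_ge0 arc_length_sigma_additive.

End circle.
Arguments circle R : clear implicits.

Section discrete_space.
Context {R : realType} {d : nat}.
Local Notation Zd := (d.-tuple int).
Local Notation Td := (d.-tuple (circle R)).

(* On a lattice, a bounded function with bounded support is a function with
   finite support. *)
Definition lattice_test_function (B : set Zd) (f : Zd -> R[i]) : Prop :=
  finite_set [set k | f k != 0] /\ forall k, f k != 0 -> B k.

Definition lattice_fourier (f : Zd -> R[i]) (u : Td) : R[i] :=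
  \sum_(k \in [set k | f k != 0])
    (\prod_(i < d) circle_val (tnth u i) ^ tnth k i) * f k.

Context {dO : measure_display} {Omega : measurableType dO}.
Variable P : probability Omega R.

Definition field_integral (M : Zd -> Omega -> R[i]) (f : Zd -> R[i]) : Omega -> R[i] :=
  fun w => \sum_(k \in [set k | f k != 0]) M k w * f k.

Record weakly_stationary_field (M : Zd -> Omega -> R[i]) : Prop := {
  wsf_square_integrable : forall m, square_integrable P (M m);
  wsf_centred : forall m, cexpectation P (M m) = 0;
  wsf_variance : forall (m : Zd) f, lattice_test_function setT f ->
    cvariance P (field_integral M (translate m f)) =
    cvariance P (field_integral M f)
}.

Definition is_lattice_spectral_measure (M : Zd -> Omega -> R[i])
    (S : {measure set Td -> \bar R}) : Prop :=
  symmetric_measure (map_tuple circle_conj) S /\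
  forall f, lattice_test_function setT f ->
    cvariance P (field_integral M f) =
      (((2 * pi) ^- d)%:E * \int[S]_u (abs2 (lattice_fourier f u))%:E)%E.

End discrete_space.

(* Main.v *)
(* Var (M f - M h) is, up to a constant, the squared norm in L^2(S) of the difference of
   the Fourier transforms, so the transforms of test functions on the orthant must be
   dense in L^2(S). Let w be the conjugate coordinate on the circle or, on the line, the
   Cayley transform of the resolvent u |-> (1 - i u)^-1, and let e be the transform of a
   suitable function on the half-line (a Dirac mass at -1, or a truncated exponential).
   The L^2(S)-closure of these transforms contains the tensor power of e and is stable
   under multiplication by each w(u_i): by translations for the circle, and because the
   resolvent is a limit of combinations of translations for the line. Szego's theorem
   for S_i (a divergent log-integral puts 1 in the closure of the polynomials in w
   without constant term) makes it stable under multiplication by w(u_i)^-1 as well,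
   since S is dominated by the product of the S_i. The bounded functions that preserve
   the closure thus form an algebra generating the Borel sets, and the closure is all of
   L^2(S). *)
Require Import Defs.
From HB Require Import structures.
From mathcomp Require Import all_boot all_order all_algebra.
From mathcomp Require Import complex finmap.
From mathcomp Require Import all_classical all_reals all_analysis.
From mathcomp Require Import measurable_realfun.
From mathcomp Require Import ring lra.

Set Implicit Arguments.
Unset Strict Implicit.
Unset Printing Implicit Defensive.

Import Order.TTheory GRing.Theory Num.Theory.
Import numFieldNormedType.Exports.

Local Open Scope classical_set_scope.
Local Open Scope ring_scope.
Local Open Scope complex_scope.

(** * Approximation by elements of an algebra *)

(** On the line [S] may be infinite, so the constant 1 need not lie in L^2([S]). The tensor power E
    of a nowhere vanishing e replaces it: every F in L^2([S]) is E times F / E, and F / E can be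
    truncated.

    The domination by a product measure serves only to bound integrals of products of functions of
    one coordinate. This suffices because inverting w(u_i) concerns one coordinate: conj w + q(w) =
    conj w (1 + w q(w)), and the one-dimensional theorem makes the last factor small.

    The Cayley transform carries du / (1 + u^2) to half the arc length. This explains the weight (1
    + |u|)^-2 and lets one Szego theorem, for an abstract unimodular w whose positive powers have
    mean 0, serve both cases. That theorem is proved by real-variable means, from the density of
    real parts of polynomials in w.

    On the line the spectral measure controls variances, not second moments, and M f need not be
    centred. The mean is corrected separately, by test functions whose mean is large compared with
    their standard deviation, when such functions exist. *)

Lemma integral_small_of_dominated d (T : measurableType d) (R : realType)
    (mu : {measure set T -> \bar R}) (f_ : nat -> T -> R) (g : T -> R) :
  (forall n, measurable_fun [set: T] (f_ n)) -> measurable_fun [set: T] g ->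
  (forall n x, 0 <= f_ n x <= g x) -> (forall x, f_ ^~ x @ \oo --> (0 : R)) ->
  (\int[mu]_x (g x)%:E < +oo)%E ->
  forall e : R, 0 < e -> exists n, (\int[mu]_x (f_ n x)%:E < e%:E)%E.
Proof.
move=> mf mg fg f0 ig e e0.
have g0 x : 0 <= g x by have /andP[h /(le_trans h)] := fg 0%N x.
have [] := @dominated_convergence _ _ _ mu setT measurableT
  (fun n x => (f_ n x)%:E) (cst 0%E) (EFin \o g).
- by move=> n; apply/measurable_EFinP.
- exact: measurable_cst.
- by apply: aeW => x _; apply: cvg_EFin; [exact: nearW|exact: f0].
- apply/integrableP; split; first exact/measurable_EFinP.
  by under eq_integral do rewrite gee0_abs ?lee_fin//.
- by apply: aeW => x n _ /=; case/andP: (fg n x) => h1 h2; rewrite lee_fin ger0_norm.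
move=> _ _; rewrite integral0 => h.
have : \forall n \near \oo, (\int[mu]_x (f_ n x)%:E < e%:E)%E.
  apply: (h (fun x => (x < e%:E)%E)); apply: open_nbhs_nbhs; split; first exact: open_ereal_lt_ereal.
  by rewrite /= lte_fin.
by case=> n _ /(_ n (leqnn n)) hn; exists n.
Qed.

Lemma bernoulli_ge (R : realType) (x : R) n : 0 <= x -> 1 + n%:R * x <= (1 + x) ^+ n.
Proof.
move=> x0; elim: n => [|n IHn]; first by rewrite mul0r addr0 expr0.
rewrite exprS; have h2 : 0 <= n%:R * x * x by rewrite !mulr_ge0.
by rewrite -natr1; nra.
Qed.

(** With r = q^2, Bernoulli's inequality for 1 / q bounds n q^n, and the other factor q^n tends to
    0. *)
Lemma natmul_geometric_cvg0 (R : realType) (r : R) : 0 <= r < 1 ->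
  (fun n => n%:R * r ^+ n) @ \oo --> (0 : R).
Proof.
move=> /andP[r0 r1].
have [->|rn0] := eqVneq r 0.
  apply/cvgrPdist_le => e e0; near=> n; rewrite expr0n.
  by case: (n) => [|m]; rewrite ?mul0r ?mulr0 subr0 normr0 ltW.
have rp : 0 < r by rewrite lt_neqAle eq_sym rn0.
set q := Num.sqrt r.
have q0 : 0 < q by rewrite sqrtr_gt0.
have q1 : q < 1 by rewrite -sqrtr1 ltr_sqrt.
have qq : r = q * q by rewrite -expr2 sqr_sqrtr.
have hb n : n%:R * q ^+ n <= (q^-1 - 1)^-1.
  have c0 : 0 < q^-1 - 1 by rewrite subr_gt0 invf_gt1.
  have : 1 + n%:R * (q^-1 - 1) <= q ^- n.
    by have := bernoulli_ge n (ltW c0); rewrite [1 + (_ - _)]addrC subrK exprVn.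
  move=> h; rewrite -ler_pdivlMr ?exprn_gt0//.
  by rewrite mulrC ler_pdivlMr// (le_trans _ h)// lerDr.
apply: (@squeeze_cvgr _ _ _ _ (cst 0) (fun n => (q^-1 - 1)^-1 * q ^+ n)).
- near=> n; rewrite mulr_ge0 ?exprn_ge0//=; first by rewrite qq exprMn mulrA ler_wpM2r ?exprn_ge0// ltW.
- exact: cvg_cst.
- rewrite -[X in _ --> X](mulr0 (q^-1 - 1)^-1); apply: cvgM; first exact: cvg_cst.
  by apply: cvg_expr; rewrite ger0_norm// ltW.
Unshelve. all: by end_near. Qed.

Lemma bernoulli_le (R : realType) (x : R) n : 0 <= x <= 1 -> 1 - n%:R * x <= (1 - x) ^+ n.
Proof.
move=> /andP[x0 x1]; elim: n => [|n IHn]; first by rewrite mul0r subr0 expr0.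
rewrite exprS; have h2 : 0 <= n%:R * x * x by rewrite !mulr_ge0.
have h : 0 <= 1 - x by rewrite subr_ge0.
have := ler_wpM2l h IHn.
by rewrite -natr1; nra.
Qed.

(* The polynomials [(1 - y^n)^(n 2^n)], which separate [y < 1/2] from [y >= 1/2]
   while staying between 0 and 1. *)
Lemma step_polynomial_cvg (R : realType) (y : R) : 0 <= y <= 1 ->
  (fun n => (1 - y ^+ n.+1) ^+ (n.+1 * 2 ^ n.+1)) @ \oo --> ((y < 2^-1)%R%:R : R).
Proof.
move=> /andP[y0 y1].
have yn n : 0 <= y ^+ n <= 1 by rewrite exprn_ge0//= exprn_ile1.
rewrite (cvg_shiftS (fun n => (1 - y ^+ n) ^+ (n * 2 ^ n))).
have [yh|yh] := ltP y 2^-1.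
  (* Bernoulli's inequality with x = y^n and exponent n 2^n: the defect n 2^n y^n = n (2y)^n tends
     to 0. *)
  apply: (@squeeze_cvgr _ _ _ _ (fun n => 1 - n%:R * (2 * y) ^+ n) (cst 1)).
  - near=> n; apply/andP; split; last first.
      by rewrite exprn_ile1 ?gerBl ?subr_ge0//; have /andP[] := yn n.
    by rewrite (le_trans _ (bernoulli_le _ (yn n)))// natrM natrX exprMn mulrA.
  - rewrite -[X in _ --> X](subr0 1); apply: cvgB; first exact: cvg_cst.
    by apply: natmul_geometric_cvg0; rewrite mulr_ge0//= mulrC -ltr_pdivlMr// mul1r.
  - exact: cvg_cst.
apply: (@squeeze_cvgr _ _ _ _ (cst 0) (fun n => n.+1%:R^-1)).
- near=> n; apply/andP; split.
    by rewrite exprn_ge0// subr_ge0; have /andP[] := yn n.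
  set k := (n * 2 ^ n)%N; set z := y ^+ n; have /andP[z0 z1] := yn n.
  (* Thus (1 - z)^k is at most the inverse of (1 + z)^k, and (1 + z)^k >= 1 + k z >= n + 1 because
     2^n y^n >= 1. *)
  have h1 : (1 - z) ^+ k * (1 + z) ^+ k <= 1.
    by rewrite -exprMn exprn_ile1//; rewrite -/z in z0 z1; nra.
  have h2 : n.+1%:R <= (1 + z) ^+ k.
    rewrite (le_trans _ (bernoulli_ge k z0))//.
    rewrite -natr1 addrC lerD2l /k natrM natrX -mulrA -exprMn ler_peMr//.
    by rewrite exprn_ege1// mulrC -ler_pdivrMr// mul1r.
  rewrite -[leRHS]mul1r ler_pdivlMr//; apply: le_trans h1.
  by rewrite ler_wpM2l// exprn_ge0// subr_ge0.
- exact: cvg_cst.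
- exact: cvg_harmonic.
Unshelve. all: by end_near. Qed.

Section algebra_approximation.
Context d (T : measurableType d) (R : realType).
Variables (rho : {measure set T -> \bar R}) (om : T -> R).
Hypothesis om0 : forall x, 0 <= om x.
Hypothesis mom : measurable_fun [set: T] om.
Hypothesis iom : (\int[rho]_x (om x)%:E < +oo)%E.
Variable TT : (T -> R) -> Prop.
Hypothesis TTm : forall t, TT t -> measurable_fun [set: T] t.
Hypothesis TTb : forall t, TT t -> exists K : R, forall x, `|t x| <= K.
Hypothesis TTc : forall c : R, TT (cst c).
Hypothesis TTD : forall s t, TT s -> TT t -> TT (fun x => s x + t x).
Hypothesis TTM : forall s t, TT s -> TT t -> TT (fun x => s x * t x).
Hypothesis TTgen : forall G : set (set T), sigma_algebra setT G ->
  (forall t c, TT t -> G [set x | t x < c]) -> measurable `<=` G.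

(** The approximants must stay in [0, 1]: this is what makes approximable functions with values in
    [0, 1] stable under products, hence approximable sets stable under intersections. The integrable
    weight [om] allows [rho] to be infinite. *)
Definition approximable (g : T -> R) := forall e : R, 0 < e -> exists t,
  [/\ TT t, forall x, 0 <= t x <= 1 & (\int[rho]_x (`|t x - g x| * om x)%:E < e%:E)%E].

Let TTX t n : TT t -> TT (fun x => t x ^+ n).
Proof.
move=> Tt; elim: n => [|n IHn]; first exact: (TTc 1).
by rewrite (_ : (fun x => _) = (fun x => t x * t x ^+ n)); [exact: TTM|apply/funext => x; rewrite exprS].
Qed.

Let TT1B t : TT t -> TT (fun x => 1 - t x).
Proof.
move=> Tt; rewrite (_ : (fun x => _) = (fun x => cst 1 x + cst (-1) x * t x)).
  by apply: TTD => //; apply: TTM.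
by apply/funext => x /=; rewrite mulN1r.
Qed.

Let mdist (s t : T -> R) : measurable_fun [set: T] s -> measurable_fun [set: T] t ->
  measurable_fun [set: T] (fun x => `|s x - t x| * om x).
Proof.
move=> ms mt; apply: measurable_funM => //.
apply: measurableT_comp => //; exact: measurable_funB.
Qed.

Let triangle (t g h : T -> R) : measurable_fun [set: T] t -> measurable_fun [set: T] g ->
  measurable_fun [set: T] h ->
  (\int[rho]_x (`|t x - g x| * om x)%:E <= \int[rho]_x (`|t x - h x| * om x)%:E
    + \int[rho]_x (`|h x - g x| * om x)%:E)%E.
Proof.
move=> mt mg mh; rewrite -ge0_integralD//=; last first.
- by apply/measurable_EFinP; exact: mdist.
- by move=> x _; rewrite lee_fin mulr_ge0.
- by apply/measurable_EFinP; exact: mdist.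
- by move=> x _; rewrite lee_fin mulr_ge0.
apply: ge0_le_integral => //=.
- by move=> x _; rewrite lee_fin mulr_ge0.
- by apply/measurable_EFinP; exact: mdist.
- by apply: emeasurable_funD; apply/measurable_EFinP; exact: mdist.
by move=> x _; rewrite -EFinD lee_fin -mulrDl ler_wpM2r// ler_distD.
Qed.

Let approximable_close (g : T -> R) : measurable_fun [set: T] g ->
  (forall e : R, 0 < e -> exists h, [/\ measurable_fun [set: T] h, approximable h &
    (\int[rho]_x (`|h x - g x| * om x)%:E < e%:E)%E]) -> approximable g.
Proof.
move=> mg H e e0; have e20 : 0 < e / 2 by rewrite divr_gt0.
have [h [mh ah hg]] := H _ e20; have [t [Tt t01 th]] := ah _ e20.
exists t; split => //; have mt := TTm Tt.
by rewrite (le_lt_trans (triangle mt mg mh))// [e in (e%:E)%E]splitr EFinD lteD.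
Qed.

Let approximable_cvg (h_ : nat -> T -> R) (g : T -> R) :
  (forall n, measurable_fun [set: T] (h_ n)) -> (forall n, approximable (h_ n)) ->
  (forall n x, 0 <= h_ n x <= 1) -> (forall x, 0 <= g x <= 1) ->
  measurable_fun [set: T] g ->
  (forall x, h_ ^~ x @ \oo --> g x) -> approximable g.
Proof.
move=> mh ah h01 g01 mg hg; apply: approximable_close => // e e0.
have le n x : 0 <= `|h_ n x - g x| * om x <= om x.
  rewrite mulr_ge0//= ler_piMl//.
  have /andP[? ?] := h01 n x; have /andP[? ?] := g01 x.
  by rewrite ler_norml; apply/andP; split; lra.
have cv x : (fun n => `|h_ n x - g x| * om x) @ \oo --> (0 : R).
  rewrite -(mul0r (om x)); apply: cvgM; last exact: cvg_cst.
  by apply/norm_cvg0P; rewrite -(subrr (g x)); apply: cvgB => //; exact: cvg_cst.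
have [n hn] := integral_small_of_dominated (fun n => mdist (mh n) mg) mom le cv iom e0.
by exists (h_ n).
Qed.

Let approximable_TT t : TT t -> (forall x, 0 <= t x <= 1) -> approximable t.
Proof.
move=> Tt t01 e e0; exists t; split => //.
under eq_integral do rewrite subrr normr0 mul0r.
by rewrite integral0 lte_fin.
Qed.

Let approximable1B (g : T -> R) : approximable g -> approximable (fun x => 1 - g x).
Proof.
move=> ag e e0; have [t [Tt t01 tg]] := ag _ e0.
exists (fun x => 1 - t x); split; first exact: TT1B.
  by move=> x; have /andP[? ?] := t01 x; apply/andP; split; lra.
apply: le_lt_trans tg; rewrite le_eqVlt; apply/orP; left; apply/eqP.
apply: eq_integral => x _; congr (_ * _)%:E.
by rewrite distrC; congr `| _ |; ring.
Qed.

Let approximable_affine (a : R) (g h : T -> R) : 0 <= a <= 1 ->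
  measurable_fun [set: T] g -> measurable_fun [set: T] h ->
  approximable g -> approximable h -> approximable (fun x => a * g x + (1 - a) * h x).
Proof.
move=> /andP[a0 a1] mg mh ag ah e e0; have e20 : 0 < e / 2 by rewrite divr_gt0.
have [s [Ts s01 sg]] := ag _ e20; have [t [Tt t01 th]] := ah _ e20.
exists (fun x => a * s x + (1 - a) * t x); split.
- by apply: TTD; apply: (TTM (TTc _)).
- by move=> x; have /andP[? ?] := s01 x; have /andP[? ?] := t01 x; apply/andP; split; nra.
have := lteD sg th; rewrite -EFinD -splitr; apply: le_lt_trans.
have ms := TTm Ts; have mt := TTm Tt.
rewrite -ge0_integralD//=; last first.
- by apply/measurable_EFinP; exact: mdist.
- by move=> x _; rewrite lee_fin mulr_ge0.
- by apply/measurable_EFinP; exact: mdist.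
- by move=> x _; rewrite lee_fin mulr_ge0.
apply: ge0_le_integral => //=.
- by move=> x _; rewrite lee_fin mulr_ge0.
- by apply/measurable_EFinP; apply: mdist; apply: measurable_funD; apply: measurable_funM.
- by apply: emeasurable_funD; apply/measurable_EFinP; exact: mdist.
move=> x _; rewrite -EFinD lee_fin -mulrDl ler_wpM2r//.
rewrite (_ : _ - _ = a * (s x - g x) + (1 - a) * (t x - h x)); last by ring.
rewrite (le_trans (ler_normD _ _))// !normrM (ger0_norm a0) [ `|1 - a|]ger0_norm ?subr_ge0//.
by rewrite lerD// ler_piMl//; lra.
Qed.

Let approximableM (g h : T -> R) :
  measurable_fun [set: T] g -> measurable_fun [set: T] h ->
  (forall x, 0 <= g x <= 1) ->
  approximable g -> approximable h -> approximable (fun x => g x * h x).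
Proof.
move=> mg mh g01 ag ah e e0; have e20 : 0 < e / 2 by rewrite divr_gt0.
have [s [Ts s01 sg]] := ag _ e20; have [t [Tt t01 th]] := ah _ e20.
exists (fun x => s x * t x); split; first exact: TTM.
- by move=> x; have /andP[? ?] := s01 x; have /andP[? ?] := t01 x; apply/andP; split; nra.
have := lteD sg th; rewrite -EFinD -splitr; apply: le_lt_trans.
have ms := TTm Ts; have mt := TTm Tt.
rewrite -ge0_integralD//=; last first.
- by apply/measurable_EFinP; exact: mdist.
- by move=> x _; rewrite lee_fin mulr_ge0.
- by apply/measurable_EFinP; exact: mdist.
- by move=> x _; rewrite lee_fin mulr_ge0.
apply: ge0_le_integral => //=.
- by move=> x _; rewrite lee_fin mulr_ge0.
- by apply/measurable_EFinP; apply: mdist; apply: measurable_funM.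
- by apply: emeasurable_funD; apply/measurable_EFinP; exact: mdist.
move=> x _; rewrite -EFinD lee_fin -mulrDl ler_wpM2r//.
rewrite (_ : _ - _ = (s x - g x) * t x + g x * (t x - h x)); last by ring.
have /andP[? ?] := t01 x; have /andP[? ?] := g01 x.
rewrite (le_trans (ler_normD _ _))// !normrM lerD//.
  by rewrite ler_piMr// ger0_norm.
by rewrite ler_piMl// ger0_norm.
Qed.

Let good (A : set T) := measurable A /\ approximable (\1_A : T -> R).

Let indic01 (A : set T) x : 0 <= (\1_A x : R) <= 1.
Proof. by rewrite indicE; case: (_ \in _); rewrite ?ler01 ?lexx. Qed.

Let goodC A : good A -> good (~` A).
Proof.
move=> [mA aA]; split; first exact: measurableC.
rewrite (_ : \1_(~` A) = (fun x => 1 - \1_A x) :> (T -> R)); first exact: approximable1B.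
by apply/funext => x; rewrite !indicE in_setC; case: (_ \in _); rewrite ?subrr ?subr0.
Qed.

Let goodI A B : good A -> good B -> good (A `&` B).
Proof.
move=> [mA aA] [mB aB]; split; first exact: measurableI.
by rewrite indicI; exact: approximableM.
Qed.

Let good0 : good set0.
Proof.
split => //; rewrite indic0; apply: approximable_TT; first exact: TTc.
by move=> x; rewrite /= lexx ler01.
Qed.

(** Finite unions come from complements and products. A countable union is a pointwise limit of
    finite ones, and [om] dominates the differences. *)
Let good_sigma_algebra : sigma_algebra setT good.
Proof.
split => //; first by move=> A gA; rewrite setTD; exact: goodC.
move=> A gA.
have gU n : good (\big[setU/set0]_(i < n) A i).
  elim: n => [|n IHn]; first by rewrite big_ord0.
  by rewrite big_ord_recr/= -[X in good X]setCK setCU; apply/goodC/goodI; exact/goodC.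
split; first by apply: bigcupT_measurable => n; have [] := gA n.
apply: (@approximable_cvg (fun n => \1_(\big[setU/set0]_(i < n) A i))) => //.
- by move=> n; apply: measurable_indic; have [] := gU n.
- by move=> n; have [] := gU n.
- by apply: measurable_indic; apply: bigcupT_measurable => n; have [] := gA n.
move=> x; have [[k _ Akx]|nA] := pselect ((\bigcup_k A k) x).
  apply: (@cvg_near_cst _ _ _ _ _ _) => //; exists k.+1 => // n /= kn.
  rewrite !indicE !mem_set//; first by exists k.
  by rewrite -bigcup_mkord; exists k.
apply: (@cvg_near_cst _ _ _ _ _ _) => //; apply: nearW => n.
rewrite !indicE !memNset// -bigcup_mkord => -[k /= _ Akx]; apply: nA; by exists k.
Qed.

Let good_sublevel t c : TT t -> good [set x | t x < c].
Proof.
move=> Tt; have mt := TTm Tt.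
have [K hK] := TTb Tt; set L := `|K| + `|c| + 1.
have L0 : 0 < L by rewrite ltr_wpDl// addr_ge0.
(* An affine rescaling that sends the level c to 1/2, the threshold of the step polynomials, and the
   range of [t] into [0, 1], since |t - c| <= L. *)
pose s := fun x => 2^-1 + (t x - c) / (2 * L).
have Ts : TT s.
  rewrite (_ : s = (fun x => cst (2^-1 - c / (2 * L)) x + t x * cst (2 * L)^-1 x)).
    by apply: TTD => //; exact: TTM.
  by apply/funext => x; rewrite /s/=; lra.
have s01 x : 0 <= s x <= 1.
  have h : `|(t x - c) / (2 * L)| <= 2^-1.
    rewrite normrM normfV (ger0_norm (mulr_ge0 _ (ltW L0)))// ler_pdivrMr ?mulr_gt0//.
    rewrite mulrA mulVf ?mul1r ?pnatr_eq0// (le_trans (ler_normB _ _))//.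
    by rewrite /L -addrA lerD ?(le_trans (hK x)) ?ler_norm// lerDl.
  by move: h; rewrite ler_norml /s; set z := _ / _; move=> /andP[? ?]; apply/andP; split; lra.
have sE : [set x | t x < c] = [set x | s x < 2^-1].
  apply/seteqP; split => x /=.
    by move=> h; rewrite /s gtrDl pmulr_llt0 ?subr_lt0// invr_gt0 mulr_gt0.
  by rewrite /s gtrDl pmulr_llt0 ?subr_lt0// invr_gt0 mulr_gt0.
have ms := TTm Ts.
have mA : measurable [set x | s x < 2^-1].
  rewrite (_ : [set _ | _] = s @^-1` [set x | x < 2^-1])//.
  by rewrite -[X in measurable X]setTI; apply: ms => //; rewrite -set_itvNyo.
rewrite sE; split => //.
have p01 n x : 0 <= (1 - s x ^+ n.+1) ^+ (n.+1 * 2 ^ n.+1) <= 1.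
  have /andP[? ?] := s01 x.
  have a : 0 <= s x ^+ n.+1 by rewrite exprn_ge0.
  have b : s x ^+ n.+1 <= 1 by rewrite exprn_ile1.
  by rewrite exprn_ge0 ?subr_ge0//= exprn_ile1 ?subr_ge0// gerBl.
have Tp n : TT (fun x => (1 - s x ^+ n.+1) ^+ (n.+1 * 2 ^ n.+1)).
  by apply: TTX; apply: TT1B; apply: TTX.
apply: (@approximable_cvg (fun n x => (1 - s x ^+ n.+1) ^+ (n.+1 * 2 ^ n.+1))) => //.
- by move=> n; apply: TTm.
- by move=> n; apply: approximable_TT.
move=> x; rewrite indicE.
have -> : x \in [set x | s x < 2^-1] = (s x < 2^-1).
  by apply/idP/idP => [|h]; rewrite ?inE.
exact: step_polynomial_cvg.
Qed.

Let good_measurable (A : set T) : measurable A -> good A.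
Proof. by apply: TTgen => // t c; exact: good_sublevel. Qed.

(* [TT] is an algebra, so that [step_polynomial_cvg] brings the sublevel sets of its
   elements, hence the sigma-algebra they generate, into its closure. *)
Lemma measurable_approximable (g : T -> R) : measurable_fun [set: T] g ->
  (forall x, 0 <= g x <= 1) -> approximable g.
Proof.
move=> mg g01.
pose A n (k : nat) := [set x | (k.+1%:R / n.+1%:R : R) <= g x].
have mA n k : measurable (A n k).
  rewrite (_ : A n k = g @^-1` [set y | (k.+1%:R / n.+1%:R : R) <= y])//.
  by rewrite -[X in measurable X]setTI; apply: mg => //; rewrite -set_itvcy.
(* The layers of [g] are averaged: with m = n + 1 the average is the integer part of (n + 1) g
   divided by n + 1, within 1 / (n + 1) of [g]. Each average is a convex combination of the previous
   one and an indicator, so the values never leave [0, 1]. *)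
pose avg n (m : nat) x : R := m%:R^-1 * \sum_(k < m) \1_(A n k) x.
have mavg n m : measurable_fun [set: T] (avg n m).
  apply: measurable_funM => //; apply: measurable_sum => k; exact: measurable_indic.
have aavg n m : approximable (avg n m).
  elim: m => [|m IHm].
    apply: approximable_TT; rewrite /avg.
      rewrite (_ : (fun _ => _) = cst 0)//.
      by apply/funext => x; rewrite big_ord0 mulr0.
    by move=> x; rewrite big_ord0 mulr0 lexx ler01.
  rewrite (_ : avg n m.+1 = (fun x => m.+1%:R^-1 * \1_(A n m) x + (1 - m.+1%:R^-1) * avg n m x)).
    apply: approximable_affine => //.
    - by rewrite invr_ge0 ler0n/= invf_le1// ler1n.
    - by have [] := good_measurable (mA n m).
  apply/funext => x; rewrite /avg big_ord_recr/= mulrDr addrC; congr (_ + _).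
  case: m {IHm} => [|m]; first by rewrite big_ord0 !mulr0.
  rewrite mulrA; congr (_ * _).
  have h1 : m.+1%:R != 0 :> R by rewrite pnatr_eq0.
  have h2 : m.+2%:R != 0 :> R by rewrite pnatr_eq0.
  have -> : 1 - m.+2%:R^-1 = m.+1%:R / m.+2%:R :> R.
    by rewrite -[X in X - _](mulfV h2) -[X in _ - X]mul1r -mulrBl -natr1 addrK.
  by rewrite mulrAC mulfV// mul1r.
have count n x : \sum_(k < n.+1) \1_(A n k) x = (Num.truncn (g x * n.+1%:R))%:R :> R.
  have /andP[gx0 gx1] := g01 x.
  have y0 : 0 <= g x * n.+1%:R by rewrite mulr_ge0.
  under eq_bigr => k _.
    rewrite indicE (_ : (x \in A n k) = (k < Num.truncn (g x * n.+1%:R))%N); last first.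
      rewrite truncn_gt_nat -ler_pdivrMr//.
      by apply/idP/idP => [|h]; rewrite ?inE.
    over.
  have le : (Num.truncn (g x * n.+1%:R) <= n.+1)%N.
    by rewrite -(ler_nat R) (@le_trans _ _ (g x * n.+1%:R))// ?truncn_le// ler_piMl.
  rewrite -natr_sum; congr (_%:R); rewrite -[RHS]card_ord -sum1_card.
  rewrite (big_ord_widen _ (fun=> 1%N) le) [RHS]big_mkcond/=.
  by apply: eq_bigr => k _; case: ifP.
have avgE n x : avg n n.+1 x = n.+1%:R^-1 * (Num.truncn (g x * n.+1%:R))%:R.
  by rewrite /avg count.
have bnd n x : avg n n.+1 x <= g x <= avg n n.+1 x + n.+1%:R^-1.
  have /andP[gx0 gx1] := g01 x.
  have y0 : 0 <= g x * n.+1%:R by rewrite mulr_ge0.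
  have /andP[h1 h2] := truncn_itv y0.
  rewrite avgE mulrC ler_pdivrMr// h1/= -[X in _ + X]mul1r -mulrDl ler_pdivlMr//.
  by rewrite natr1 ltW.
apply: (@approximable_cvg (fun n => avg n n.+1)) => //.
  move=> n x; have /andP[h1 h2] := bnd n x; have /andP[h3 h4] := g01 x.
  by rewrite (le_trans h1 h4) andbT avgE mulr_ge0.
move=> x; apply/cvgrPdist_le => e e0.
have := @cvg_harmonic R; move=> /cvgrPdist_le /(_ e e0); apply: filterS => n /=.
rewrite sub0r normrN ger0_norm// => h; apply: le_trans h.
have /andP[h1 h2] := bnd n x.
by rewrite ger0_norm ?subr_ge0// lerBlDl.
Qed.

End algebra_approximation.

(** * Complex-valued functions *)

Section abs2_theory.
Context {R : realType}.
Implicit Types z w : R[i].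

Lemma cReD z w : complex.Re (z + w) = complex.Re z + complex.Re w.
Proof. by case: z w => [a b] [c e]. Qed.

Lemma cImD z w : complex.Im (z + w) = complex.Im z + complex.Im w.
Proof. by case: z w => [a b] [c e]. Qed.

Lemma cReN z : complex.Re (- z) = - complex.Re z. Proof. by case: z. Qed.

Lemma cImN z : complex.Im (- z) = - complex.Im z. Proof. by case: z. Qed.

Lemma cReM z w : complex.Re (z * w) =
  complex.Re z * complex.Re w - complex.Im z * complex.Im w.
Proof. by case: z w => [a b] [c e]. Qed.

Lemma cImM z w : complex.Im (z * w) =
  complex.Re z * complex.Im w + complex.Im z * complex.Re w.
Proof. by case: z w => [a b] [c e]. Qed.

Lemma abs2M z w : abs2 (z * w) = abs2 z * abs2 w.
Proof. by rewrite /abs2 cReM cImM; ring. Qed.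

Lemma abs2_ge0 z : 0 <= abs2 z.
Proof. by rewrite addr_ge0// sqr_ge0. Qed.

Lemma abs2N z : abs2 (- z) = abs2 z.
Proof. by rewrite /abs2 cReN cImN !sqrrN. Qed.

Lemma abs2D z w : abs2 (z + w) <= 2 * abs2 z + 2 * abs2 w.
Proof.
rewrite /abs2 cReD cImD; set a := complex.Re z; set b := complex.Im z.
set c := complex.Re w; set e := complex.Im w.
have := sqr_ge0 (a - c); have := sqr_ge0 (b - e); nra.
Qed.

Lemma abs2B z w : abs2 (z - w) <= 2 * abs2 z + 2 * abs2 w.
Proof. by rewrite -(abs2N w) abs2D. Qed.

Lemma abs2BC z w : abs2 (z - w) = abs2 (w - z).
Proof. by rewrite -abs2N opprB. Qed.

Lemma abs2_real (x : R) : abs2 x%:C = x ^+ 2.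
Proof. by rewrite /abs2 /= expr0n addr0. Qed.

Lemma abs2_0 : abs2 (0 : R[i]) = 0.
Proof. by rewrite /abs2 /= expr0n addr0. Qed.

Lemma abs2_1 : abs2 (1 : R[i]) = 1.
Proof. by rewrite /abs2 /= expr0n addr0 expr1n. Qed.

Lemma abs2_eq0 z : (abs2 z == 0) = (z == 0).
Proof.
by rewrite paddr_eq0 ?sqr_ge0// !sqrf_eq0 eq_complex.
Qed.

Lemma abs2_gt0 z : (0 < abs2 z) = (z != 0).
Proof. by rewrite lt_neqAle abs2_ge0 andbT eq_sym abs2_eq0. Qed.

Lemma abs2X z n : abs2 (z ^+ n) = abs2 z ^+ n.
Proof. by elim: n => [|n IHn]; rewrite ?expr0 ?abs2_1// !exprS abs2M IHn. Qed.

Lemma abs2_prod (I : Type) (r : seq I) (F : I -> R[i]) :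
  abs2 (\prod_(i <- r) F i) = \prod_(i <- r) abs2 (F i).
Proof. by apply: (big_morph _ abs2M abs2_1). Qed.

Lemma abs2V z : abs2 z^-1 = (abs2 z)^-1.
Proof.
have [->|z0] := eqVneq z 0; first by rewrite invr0 abs2_0 invr0.
have := abs2M z z^-1; rewrite mulfV// abs2_1 => h.
by apply: (mulfI (x := abs2 z)); rewrite ?abs2_eq0// -h mulfV// abs2_eq0.
Qed.

Lemma abs2_conj z : abs2 z^*%C = abs2 z.
Proof. by case: z => a b; rewrite /abs2 /= sqrrN. Qed.

Lemma abs2_expi (t : R) : abs2 (expi t) = 1.
Proof. by rewrite /abs2 /= cos2Dsin2. Qed.

Lemma mul_conj_unimodular z : abs2 z = 1 -> z * z^*%C = 1.
Proof.
case: z => a b; rewrite /abs2/= => h; apply/eqP; rewrite eq_complex /=.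
by apply/andP; split; apply/eqP; [rewrite -h|]; ring.
Qed.

Lemma unimodular_neq0 z : abs2 z = 1 -> z != 0.
Proof. by move=> h; rewrite -abs2_eq0 h oner_eq0. Qed.

Lemma expiD (s t : R) : expi (s + t) = expi s * expi t.
Proof.
apply/eqP; rewrite eq_complex cReM cImM /= cosD sinD.
by apply/andP; split; apply/eqP => //; ring.
Qed.

Lemma expi0 : expi 0 = 1 :> R[i].
Proof. by rewrite /expi cos0 sin0. Qed.

(** Crude, but free of square roots: it turns bounds and integrability of [abs2] into those of the
    real part. *)
Lemma Re_le_abs2 z : `|complex.Re z| <= 1 + abs2 z.
Proof.
rewrite /abs2; have := sqr_ge0 (complex.Im z); have := sqr_ge0 (complex.Re z - 1).
by have := sqr_ge0 (complex.Re z + 1); rewrite ler_norml => ? ? ?; apply/andP; split; nra.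
Qed.

Lemma Im_le_abs2 z : `|complex.Im z| <= 1 + abs2 z.
Proof.
rewrite /abs2; have := sqr_ge0 (complex.Re z); have := sqr_ge0 (complex.Im z - 1).
by have := sqr_ge0 (complex.Im z + 1); rewrite ler_norml => ? ? ?; apply/andP; split; nra.
Qed.

End abs2_theory.

Section cmeasurable_theory.
Context {R : realType} {d : measure_display} {T : measurableType d}.
Implicit Types f g : T -> R[i].

Lemma cmeasurable_cst (c : R[i]) : cmeasurable (fun _ : T => c).
Proof. by split; exact: measurable_cst. Qed.

Lemma cmeasurableD f g : cmeasurable f -> cmeasurable g ->
  cmeasurable (fun x => f x + g x).
Proof.
move=> [rf if_] [rg ig]; split.
  by under eq_fun do rewrite cReD; exact: measurable_funD.
by under eq_fun do rewrite cImD; exact: measurable_funD.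
Qed.

Lemma cmeasurableN f : cmeasurable f -> cmeasurable (fun x => - f x).
Proof.
move=> [rf if_]; split.
  by under eq_fun do rewrite cReN; exact: measurableT_comp.
by under eq_fun do rewrite cImN; exact: measurableT_comp.
Qed.

Lemma cmeasurableB f g : cmeasurable f -> cmeasurable g ->
  cmeasurable (fun x => f x - g x).
Proof. by move=> mf mg; apply: cmeasurableD => //; exact: cmeasurableN. Qed.

Lemma cmeasurableM f g : cmeasurable f -> cmeasurable g ->
  cmeasurable (fun x => f x * g x).
Proof.
move=> [rf if_] [rg ig]; split.
  under eq_fun do rewrite cReM.
  by apply: measurable_funB; exact: measurable_funM.
under eq_fun do rewrite cImM.
by apply: measurable_funD; exact: measurable_funM.
Qed.

Lemma cmeasurable_conj f : cmeasurable f -> cmeasurable (fun x => (f x)^*%C).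
Proof.
move=> [rf if_]; split.
  by rewrite (_ : (fun x => _) = (fun x => complex.Re (f x)))//; apply/funext => x; case: (f x).
rewrite (_ : (fun x => _) = (fun x => - complex.Im (f x))).
  exact: measurableT_comp.
by apply/funext => x; case: (f x).
Qed.

Lemma cmeasurable_real (f : T -> R) : measurable_fun setT f -> cmeasurable (fun x => (f x)%:C).
Proof. by move=> mf; split => //=; exact: measurable_cst. Qed.

Lemma cmeasurableX f n : cmeasurable f -> cmeasurable (fun x => f x ^+ n).
Proof.
move=> mf; elim: n => [|n IHn]; first exact: cmeasurable_cst.
by under eq_fun do rewrite exprS; exact: cmeasurableM.
Qed.

Lemma cmeasurable_sum (I : Type) (r : seq I) (F : I -> T -> R[i]) :
  (forall i, cmeasurable (F i)) -> cmeasurable (fun x => \sum_(i <- r) F i x).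
Proof.
move=> mF; elim: r => [|i r IHr].
  by under eq_fun do rewrite big_nil; exact: cmeasurable_cst.
by under eq_fun do rewrite big_cons; exact: cmeasurableD.
Qed.

Lemma cmeasurable_prod (I : Type) (r : seq I) (F : I -> T -> R[i]) :
  (forall i, cmeasurable (F i)) -> cmeasurable (fun x => \prod_(i <- r) F i x).
Proof.
move=> mF; elim: r => [|i r IHr].
  by under eq_fun do rewrite big_nil; exact: cmeasurable_cst.
by under eq_fun do rewrite big_cons; exact: cmeasurableM.
Qed.

Lemma cmeasurable_horner (p : {poly R[i]}) f : cmeasurable f ->
  cmeasurable (fun x => p.[f x]).
Proof.
move=> mf; elim/poly_ind: p => [|p c IHp].
  by under eq_fun do rewrite horner0; exact: cmeasurable_cst.
under eq_fun do rewrite hornerMXaddC.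
by apply: cmeasurableD; [exact: cmeasurableM|exact: cmeasurable_cst].
Qed.

Lemma cmeasurable_expi (f : T -> R) : measurable_fun setT f -> cmeasurable (fun u => expi (f u)).
Proof.
move=> mf; split => /=.
  apply: (measurableT_comp (f := cos : R -> R)) => //.
  by apply: measurable_realfun.continuous_measurable_fun; exact: continuous_cos.
apply: (measurableT_comp (f := sin : R -> R)) => //.
by apply: measurable_realfun.continuous_measurable_fun; exact: continuous_sin.
Qed.

Lemma cmeasurable_comp d' (T' : measurableType d') f (g : T' -> T) : cmeasurable f ->
  measurable_fun setT g -> cmeasurable (f \o g).
Proof. by move=> [rf if_] mg; split; [exact: (measurableT_comp rf mg)|exact: (measurableT_comp if_ mg)]. Qed.

Lemma measurable_abs2 f : cmeasurable f -> measurable_fun setT (fun x => abs2 (f x)).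
Proof.
move=> [rf if_]; apply: measurable_funD; exact: measurable_funX.
Qed.

Lemma cmeasurableV f : cmeasurable f -> cmeasurable (fun x => (f x)^-1).
Proof.
move=> mf; have ma : measurable_fun setT (fun x => (abs2 (f x))^-1).
  (* Where [abs2 (f x)] vanishes both sides are 0, the inverse of 0 being 0 by convention. *)
  rewrite (_ : (fun x => _) = fun x => if 0 < abs2 (f x) then expR (- ln (abs2 (f x))) else 0).
    apply: measurable_fun_ifT => //.
      by apply: measurable_fun_ltr => //; exact: measurable_abs2.
    apply: measurableT_comp => //; apply: measurableT_comp => //.
    by apply: measurableT_comp => //; exact: measurable_abs2.
  apply/funext => x; case: ltP => h; first by rewrite expRN lnK.
  by have -> : abs2 (f x) = 0 by [apply/le_anti; rewrite h abs2_ge0]; rewrite invr0.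
rewrite (_ : (fun x => _) = (fun x => (f x)^*%C * ((abs2 (f x))^-1)%:C)).
  by apply: cmeasurableM; [exact: cmeasurable_conj|exact: cmeasurable_real].
apply/funext => x; have [->|f0] := eqVneq (f x) 0; first by rewrite invr0 conjc0 mul0r.
apply: (mulfI f0); rewrite mulfV// mulrA; move: f0; rewrite -abs2_eq0.
case: (f x) => a b; rewrite /abs2 /= => f0; apply/esym/eqP; rewrite eq_complex cReM cImM /=.
apply/andP; split; apply/eqP; last by ring.
by rewrite mulr0 subr0 mulrN opprK -!expr2 mulfV.
Qed.

End cmeasurable_theory.

Section sq_norm.
Context {R : realType} {d : measure_display} {T : measurableType d}.
Implicit Types mu : {measure set T -> \bar R}.
Implicit Types f g : T -> R[i].

Definition sq_norm mu f : \bar R := \int[mu]_x (abs2 (f x))%:E.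

Lemma measurable_abs2E f : cmeasurable f ->
  measurable_fun setT (fun x => (abs2 (f x))%:E).
Proof. by move=> mf; apply/measurable_EFinP; exact: measurable_abs2. Qed.

Lemma sq_norm_ge0 mu f : (0 <= sq_norm mu f)%E.
Proof. by apply: integral_ge0 => x _; rewrite lee_fin abs2_ge0. Qed.

Lemma eq_sq_norm mu f g : f =1 g -> sq_norm mu f = sq_norm mu g.
Proof. by move=> fg; apply: eq_integral => x _; rewrite fg. Qed.

Lemma le_sq_norm mu f g (C : R) : 0 <= C -> cmeasurable f -> cmeasurable g ->
  (forall x, abs2 (f x) <= C * abs2 (g x)) -> (sq_norm mu f <= C%:E * sq_norm mu g)%E.
Proof.
move=> C0 mf mg fg; rewrite /sq_norm -ge0_integralZl//=.
- apply: ge0_le_integral => //=.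
  + by move=> x _; rewrite lee_fin abs2_ge0.
  + exact: measurable_abs2E.
  + apply/measurable_EFinP; apply: measurable_funM => //; exact: measurable_abs2.
  + by move=> x _; rewrite lee_fin.
- exact: measurable_abs2E.
- by move=> x _; rewrite lee_fin abs2_ge0.
Qed.

Lemma sq_normD mu f g : cmeasurable f -> cmeasurable g ->
  (sq_norm mu (fun x => f x + g x)%R <= 2%:E * sq_norm mu f + 2%:E * sq_norm mu g)%E.
Proof.
move=> mf mg; rewrite /sq_norm -!ge0_integralZl//=.
- rewrite -ge0_integralD//=.
  + apply: ge0_le_integral => //=.
    * by move=> x _; rewrite lee_fin abs2_ge0.
    * by apply: measurable_abs2E; exact: cmeasurableD.
    * apply/measurable_EFinP; apply: measurable_funD; apply: measurable_funM => //; exact: measurable_abs2.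
    * by move=> x _; rewrite lee_fin abs2D.
  + by move=> x _; rewrite lee_fin mulr_ge0// abs2_ge0.
  + apply/measurable_EFinP; apply: measurable_funM => //; exact: measurable_abs2.
  + by move=> x _; rewrite lee_fin mulr_ge0// abs2_ge0.
  + apply/measurable_EFinP; apply: measurable_funM => //; exact: measurable_abs2.
- exact: measurable_abs2E.
- by move=> x _; rewrite lee_fin abs2_ge0.
- exact: measurable_abs2E.
- by move=> x _; rewrite lee_fin abs2_ge0.
Qed.

Lemma sq_normZ mu f (c : R[i]) : cmeasurable f ->
  sq_norm mu (fun x => c * f x) = ((abs2 c)%:E * sq_norm mu f)%E.
Proof.
move=> mf; rewrite /sq_norm -ge0_integralZl//=.
- by apply: eq_integral => x _; rewrite abs2M.
- exact: measurable_abs2E.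
- by move=> x _; rewrite lee_fin abs2_ge0.
- by rewrite lee_fin abs2_ge0.
Qed.

Lemma le_sq_norm_measure mu1 mu2 f : cmeasurable f ->
  (forall A, measurable A -> (mu1 A <= mu2 A)%E) -> (sq_norm mu1 f <= sq_norm mu2 f)%E.
Proof.
move=> mf mu12; apply: ge0_le_measure_integral => //.
- by move=> x; rewrite lee_fin abs2_ge0.
- exact: measurable_abs2E.
Qed.

(** For squared norms the triangle inequality costs a factor 2 on each term, hence the quarters. *)
Lemma sq_norm_triangle mu f g h (e : R) : cmeasurable f -> cmeasurable g -> cmeasurable h ->
  (sq_norm mu (fun x => f x - g x)%R < (e / 4)%:E)%E ->
  (sq_norm mu (fun x => g x - h x)%R < (e / 4)%:E)%E ->
  (sq_norm mu (fun x => f x - h x)%R < e%:E)%E.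
Proof.
move=> mf mg mh fg gh.
rewrite (eq_sq_norm mu (g := fun x => (f x - g x) + (g x - h x))); last first.
  by move=> x; rewrite addrA subrK.
apply: le_lt_trans (sq_normD _ _ _) _; [exact: cmeasurableB|exact: cmeasurableB|].
have -> : e%:E = (2%:E * (e / 4)%:E + 2%:E * (e / 4)%:E)%E.
  by rewrite -!EFinM -EFinD; congr EFin; lra.
by rewrite lteD// lte_pmul2l// lte_fin.
Qed.

Lemma sq_norm_dominated mu (f_ : nat -> T -> R[i]) g :
  (forall n, cmeasurable (f_ n)) -> cmeasurable g ->
  (forall n x, abs2 (f_ n x) <= abs2 (g x)) ->
  (forall x, (fun n => abs2 (f_ n x)) @ \oo --> (0 : R)) ->
  (sq_norm mu g < +oo)%E ->
  forall e : R, 0 < e -> exists n, (sq_norm mu (f_ n) < e%:E)%E.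
Proof.
move=> mf mg fg f0 ig e e0.
apply: (integral_small_of_dominated (f_ := fun n x => abs2 (f_ n x)) _ _ _ f0 ig e0) => //.
- by move=> n; exact: measurable_abs2.
- exact: measurable_abs2.
- by move=> n x; rewrite abs2_ge0/=.
Qed.

End sq_norm.

(** * Szego's theorem *)

Section integral_decomposition.
Import HBNNSimple.

(** True of simple functions by [muE] on level sets, then of all non-negative functions by monotone
    convergence in each of the three integrals. *)
Lemma ge0_integral_decomposition d (T : measurableType d) (R : realType)
    (la mu nu : {measure set T -> \bar R}) (s : T -> R) :
  measurable_fun setT s -> (forall x, 0 <= s x) ->
  (forall A, measurable A -> mu A = (\int[la]_(x in A) (s x)%:E + nu A)%E) ->
  forall f : T -> \bar R, (forall x, 0 <= f x)%E -> measurable_fun setT f ->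
  (\int[mu]_x f x = \int[la]_x (f x * (s x)%:E) + \int[nu]_x f x)%E.
Proof.
move=> ms s0 muE f f0 mf.
have ms' : measurable_fun setT (EFin \o s) by exact/measurable_EFinP.
pose h := nnsfun_approx measurableT mf.
have hf x : (EFin \o h n) x @[n --> \oo] --> f x.
  by apply: cvg_nnsfun_approx => //; rewrite inE.
have key n : (\int[mu]_x (h n x)%:E =
    \int[la]_x ((h n x)%:E * (s x)%:E) + \int[nu]_x (h n x)%:E)%E.
  rewrite !integralT_nnsfun !sintegralE.
  have -> : (\int[la]_x ((h n x)%:E * (s x)%:E) =
      \sum_(r \in range (h n)) (r%:E * \int[la]_(x in h n @^-1` [set r]) (s x)%:E))%E.
    transitivity (\int[la]_x (\sum_(y \in range (h n))
        (y * \1_(h n @^-1` [set y]) x)%:E * (s x)%:E))%E.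
      under [RHS]eq_integral => x xE.
        rewrite -ge0_mule_fsuml => [|y]; last exact: nnfun_muleindic_ge0.
        rewrite fsumEFin // -(fimfunE _ x); over.
      by [].
    rewrite ge0_integral_fsum//; last 2 first.
    - move=> y; apply: emeasurable_funM => //; apply/measurable_EFinP.
      by apply: measurable_funM => //; exact: measurable_indic.
    - move=> y x _; rewrite mule_ge0 ?lee_fin//.
      by rewrite -lee_fin EFinM; exact: nnfun_muleindic_ge0.
    apply: eq_fsbigr => r rhn.
    under eq_integral do rewrite EFinM -muleA.
    rewrite ge0_integralZl//.
    - under eq_integral do rewrite muleC.
      rewrite (eq_integral ((EFin \o s) \_ (h n @^-1` [set r]))); last first.
        by move=> x xE; rewrite epatch_indic.
      by rewrite -integral_mkcondr setTI.
    - apply: emeasurable_funM => //; apply/measurable_EFinP; exact: measurable_indic.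
    - by move=> t Et; rewrite mule_ge0 ?lee_fin.
    - by move: rhn; rewrite inE => -[t _ <-]; rewrite lee_fin.
  rewrite -fsbig_split//=; apply: eq_fsbigr => r; rewrite inE => -[t _ rE].
  have r0 : 0 <= r by rewrite -rE.
  have i0 : (0 <= \int[la]_(x in h n @^-1` [set r]) (s x)%:E)%E.
    by apply: integral_ge0 => x _; rewrite lee_fin.
  by rewrite muE// ge0_muleDr.
have c (m : {measure set T -> \bar R}) :
    (\int[m]_x (h n x)%:E)%E @[n --> \oo] --> (\int[m]_x f x)%E.
  rewrite (eq_integral (fun x => limn (fun n => (h n x)%:E))); last first.
    by move=> x _; apply/esym/cvg_lim => //; exact: hf.
  apply: cvg_monotone_convergence => //.
  - by move=> n; apply/measurable_EFinP.
  - by move=> n x _; rewrite lee_fin.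
  - by move=> x _ a b ab; rewrite lee_fin; exact/lefP/nd_nnsfun_approx.
have cs : (\int[la]_x ((h n x)%:E * (s x)%:E))%E @[n --> \oo] --> (\int[la]_x (f x * (s x)%:E))%E.
  rewrite (eq_integral (fun x => limn (fun n => (h n x)%:E * (s x)%:E)))%E; last first.
    by move=> x _; apply/esym/cvg_lim => //; apply: cvgeZr => //; exact: hf.
  apply: cvg_monotone_convergence => //.
  - by move=> n; apply: emeasurable_funM => //; apply/measurable_EFinP.
  - by move=> n x _; rewrite mule_ge0 ?lee_fin.
  - move=> x _ a b ab; rewrite lee_wpmul2r ?lee_fin//.
    exact/lefP/nd_nnsfun_approx.
have c1 := c mu; rewrite (funext key) in c1.
apply: (cvg_unique _ c1) => //=; apply: cvgeD cs (c nu).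
rewrite ge0_adde_def// inE.
- by apply: integral_ge0 => x _; rewrite mule_ge0 ?lee_fin.
- exact: integral_ge0.
Qed.

End integral_decomposition.

(** * Truncation of the logarithmic integral *)

Section log_integral_truncation.
Context d (T : measurableType d) (R : realType).
Variables (la : {measure set T -> \bar R}) (ka om s : T -> R).
Hypothesis ka_gt0 : forall x, 0 < ka x.
Hypothesis ka_om : forall x, ka x <= om x.
Hypothesis mka : measurable_fun [set: T] ka.
Hypothesis mom : measurable_fun [set: T] om.
Hypothesis ms : measurable_fun [set: T] s.
Hypothesis s0 : forall x, 0 <= s x.

(** The upper clamp at 1 keeps only the part of ln s that drives the integral to -oo. The lower
    clamp at [de] makes it bounded, hence within reach of the approximation by polynomials. *)
Definition neg_log_clamp (de : R) (x : T) : R := - ln (Num.max de (Num.min 1 (s x))).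

Lemma measurable_neg_log_clamp de : measurable_fun [set: T] (neg_log_clamp de).
Proof.
apply: measurableT_comp => //; apply: measurableT_comp => //.
by apply: measurable_maxr => //; apply: measurable_minr.
Qed.

Lemma neg_log_clamp_bounds de x : 0 < de < 1 -> 0 <= neg_log_clamp de x <= - ln de.
Proof.
move=> /andP[de0 de1]; rewrite /neg_log_clamp.
have h0 : 0 < Num.max de (Num.min 1 (s x)) by rewrite lt_max de0.
rewrite oppr_ge0 lerN2 ler_ln ?posrE// le_max lexx/= andbT.
by rewrite ln_le0// ge_max (ltW de1) ge_min lexx.
Qed.

(** Monotone convergence as [de] decreases to 0. The passage from [ka] to a larger weight [om] is
    built in because the line case has its hypothesis for one weight and its computations for
    another. *)
Lemma log_integral_neg_log_clamp : log_integral la ka s = -oo%E ->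
  forall K : R, exists de, 0 < de < 1 /\
    (K%:E < \int[la]_x (neg_log_clamp de x * om x)%:E)%E.
Proof.
move=> hlog K.
pose f x : \bar R := (lne (s x)%:E * (ka x)%:E)%E.
(* A finite negative part would keep the difference above -oo. The case of an infinite positive part
   is covered too, since +oo - oo is -oo here. *)
have fneg : (\int[la]_x (f^\- x) = +oo)%E.
  move: hlog; rewrite /log_integral integralE -/f.
  have hp : (0 <= \int[la]_x (f^\+ x))%E by exact: integral_ge0.
  have hn : (0 <= \int[la]_x (f^\- x))%E by exact: integral_ge0.
  by case: (\int[la]_x (f^\- x))%E hn => [r| |] //; case: (\int[la]_x (f^\+ x))%E hp.
(* The offset 2 keeps [de n] strictly below 1. *)
pose de n : R := n.+2%:R^-1.
have de01 n : 0 < de n < 1 by rewrite invr_gt0 ltr0n/= invf_lt1 ?ltr0n// ltr1n.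
pose g n x := (neg_log_clamp (de n) x * ka x)%:E.
have g0 n x : (0 <= g n x)%E.
  rewrite lee_fin mulr_ge0 ?(ltW (ka_gt0 x))//.
  by have /andP[] := neg_log_clamp_bounds x (de01 n).
have mg n : measurable_fun setT (g n).
  apply/measurable_EFinP; apply: measurable_funM => //; exact: measurable_neg_log_clamp.
have ndg x : {homo g ^~ x : a b / (a <= b)%N >-> (a <= b)%E}.
  move=> a b ab; rewrite lee_fin ler_pM2r// lerN2.
  have pa k : 0 < Num.max (de k) (Num.min 1 (s x)) by rewrite lt_max; case/andP: (de01 k) => ->.
  rewrite ler_ln ?posrE// ge_max !le_max lexx orbT andbT.
  by rewrite lef_pV2 ?posrE ?ltr0n// ler_nat !ltnS ab.
(* Where s vanishes the truncations are ln (n + 2) times the weight and diverge; where s > 0 they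
   are eventually constant. *)
have gf x : g ^~ x @ \oo --> (f^\- x)%E.
  have [sx0|sx0] := eqVneq (s x) 0.
    have -> : (f^\- x = +oo)%E.
      by rewrite funenegE /f sx0 le0_lneNy// gt0_mulNye ?lte_fin//= maxEge leey.
    apply/cvgeyPge => A.
    have gE n : g n x = (ln n.+2%:R * ka x)%:E.
      rewrite /g /neg_log_clamp sx0.
      have -> : Num.min 1 0 = 0 :> R by rewrite /Num.min ltNge ler01.
      have -> : Num.max (de n) 0 = de n.
        by rewrite /Num.max ltNge ltW//; case/andP: (de01 n).
      by rewrite /de lnV ?opprK// posrE.
    exists (Num.truncn (expR (A / ka x))).+1 => // n /= hn.
    rewrite gE lee_fin -ler_pdivrMr// -[leLHS]expRK ler_ln ?posrE ?expR_gt0//.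
    rewrite ltW// (lt_trans (truncnS_gt _))// ltr_nat ltnS.
    by rewrite (leq_trans hn)// leqW.
  have sp : 0 < s x by rewrite lt_neqAle eq_sym sx0 s0.
  apply: cvg_near_cst.
  exists (Num.truncn (s x)^-1) => // n /= hn.
  have des : de n <= s x.
    rewrite -[leRHS]invrK lef_pV2 ?posrE ?ltr0n ?invr_gt0//.
    rewrite ltW// (lt_trans (truncnS_gt _))// ltr_nat ltnS.
    by rewrite (leq_ltn_trans hn).
  rewrite /g funenegE /f lne_EFin//.
  rewrite -EFinM -EFinN -EFin_max; congr EFin.
  rewrite /neg_log_clamp.
  have [s1|s1] := leP (s x) 1.
    have -> : Num.max (de n) (s x) = s x by apply/max_idPr.
    rewrite mulNr; apply/esym/max_idPl; rewrite oppr_ge0 mulr_le0_ge0 ?(ltW (ka_gt0 x))//.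
    exact: ln_le0.
  have -> : Num.max (de n) 1 = 1 by apply/max_idPr; case/andP: (de01 n) => _ /ltW.
  rewrite ln1 oppr0 mul0r; apply/esym/max_idPr.
  by rewrite oppr_le0 mulr_ge0 ?(ltW (ka_gt0 x))// ln_ge0// ltW.
have cg : (\int[la]_x g n x)%E @[n --> \oo] --> +oo%E.
  rewrite -fneg (eq_integral (fun x => limn (g ^~ x))); last first.
    by move=> x _; apply/esym/cvg_lim => //; exact: gf.
  by apply: cvg_monotone_convergence => // x _; exact: ndg.
move/cvgeyPge : cg => /(_ (K + 1)) [n _ /(_ n (leqnn n)) hn].
exists (de n); split => //.
apply: (@lt_le_trans _ _ (K + 1)%:E); first by rewrite lte_fin ltrDl.
apply: (le_trans hn); apply: ge0_le_integral => //.
- apply/measurable_EFinP; apply: measurable_funM => //; exact: measurable_neg_log_clamp.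
- move=> x _; rewrite lee_fin ler_wpM2l//.
  by have /andP[] := neg_log_clamp_bounds x (de01 n).
Qed.

End log_integral_truncation.

(** * Polynomials on the unit circle *)

Section unimodular_polynomials.
Context {R : realType}.
Implicit Types (p q : {poly R[i]}) (z : R[i]).

Lemma horner_unimodular_bounded q : exists K : R, 0 <= K /\
  forall z, abs2 z = 1 -> abs2 q.[z] <= K.
Proof.
elim/poly_ind: q => [|q c [K [K0 hK]]].
  by exists 0; split => // z _; rewrite horner0 abs2_0.
exists (2 * K + 2 * abs2 c); split; first by rewrite addr_ge0// mulr_ge0// abs2_ge0.
move=> z z1; rewrite hornerMXaddC (le_trans (abs2D _ _))// abs2M z1 mulr1.
by rewrite lerD2r ler_pM2l// hK.
Qed.

(** On the circle z conj z = 1, so (z p + a) conj (z q + b) equals p conj q + conj b z p + a conj (z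
    q) + a conj b. The term a conj (z q) has the real part of conj a z q, and induction handles p
    conj q. *)
Lemma Re_horner_conj p q : exists r, forall z, abs2 z = 1 ->
  complex.Re (p.[z] * (q.[z])^*%C) = complex.Re r.[z].
Proof.
elim/poly_ind: p q => [|p a IHp] q.
  by exists 0 => z _; rewrite !horner0 mul0r.
elim/poly_ind: q => [|q b _].
  by exists 0 => z _; rewrite !horner0 conjc0 mulr0.
have [r hr] := IHp q.
exists (r + (a^*%C *: q + b^*%C *: p) * 'X + (a * b^*%C)%:P) => z z1.
have {hr} := hr _ z1; rewrite hornerMXaddC !hornerE; move: z1.
case: (r.[z]) => r1 r2; case: (p.[z]) => p1 p2; case: (q.[z]) => q1 q2.
case: z => x y; case: a => a1 a2; case: b => b1 b2; rewrite /abs2 /= => z1 <-.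
rewrite -[p1 * q1 - p2 * - q2]mul1r -z1; ring.
Qed.

(** Re P Re Q = Re (P Q + P conj Q) / 2. Real parts of polynomials therefore form an algebra on the
    circle, as [measurable_approximable] requires. *)
Lemma Re_hornerM p q : exists r, forall z, abs2 z = 1 ->
  complex.Re p.[z] * complex.Re q.[z] = complex.Re r.[z].
Proof.
have [r hr] := Re_horner_conj p q.
exists ((2^-1)%:C *: (p * q + r)) => z z1; rewrite !hornerE.
have {hr} := hr _ z1.
case: (r.[z]) => r1 r2; case: (p.[z]) => p1 p2; case: (q.[z]) => q1 q2.
by rewrite /abs2 /= => <-; field.
Qed.

(* [(1 + z/n)^n] plays the role of [exp z]; only this upper bound on its modulus
   is needed. *)
Lemma abs2_exp_approx z n : abs2 (1 + z / n.+1%:R) ^+ n.+1 <=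
  expR (2 * complex.Re z + abs2 z / n.+1%:R).
Proof.
have n0 : n.+1%:R != 0 :> R by rewrite pnatr_eq0.
have -> : 2 * complex.Re z + abs2 z / n.+1%:R =
    (2 * complex.Re z / n.+1%:R + abs2 z / n.+1%:R ^+ 2) * n.+1%:R.
  by field.
rewrite expRM_natr lerXn2r ?nnegrE ?abs2_ge0 ?expR_ge0//.
apply: le_trans (expR_ge1Dx _).
have -> : (n.+1%:R : R[i])^-1 = (n.+1%:R^-1 : R)%:C.
  by rewrite fmorphV/= rmorph_nat.
rewrite /abs2 cReD cImD cReM cImM /=.
set y := n.+1%:R^-1; rewrite -exprVn -/y le_eqVlt; apply/orP; left; apply/eqP; ring.
Qed.

End unimodular_polynomials.

Section szego.
Context d (X : measurableType d) (R : realType).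
Variables (w : X -> R[i]) (la mu : {measure set X -> \bar R}) (om s : X -> R).
Hypothesis mw : cmeasurable w.
Hypothesis w1 : forall x, abs2 (w x) = 1.
Hypothesis om0 : forall x, 0 <= om x.
Hypothesis mom : measurable_fun [set: X] om.
Hypothesis iola : (\int[la]_x (om x)%:E < +oo)%E.
Hypothesis iomu : (\int[mu]_x (om x)%:E < +oo)%E.
Hypothesis momw : forall k, \int[la]_x (complex.Re (w x ^+ k.+1) * om x) = 0 /\
  \int[la]_x (complex.Im (w x ^+ k.+1) * om x) = 0.
Hypothesis dens : ac_density la mu s.
Hypothesis logs : forall K : R, exists de, 0 < de < 1 /\
    (K%:E < \int[la]_x (neg_log_clamp s de x * om x)%:E)%E.
Hypothesis genw : forall G : set (set X), sigma_algebra setT G ->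
  (forall a b c : R, G [set x | a * complex.Re (w x) + b * complex.Im (w x) < c]) ->
  measurable `<=` G.

Let bounded_integrable (g : X -> R) (K : R) : measurable_fun setT g ->
  (forall x, `|g x| <= K) -> la.-integrable setT (fun x => (g x * om x)%:E).
Proof.
move=> mg gK; apply/integrableP; split.
  by apply/measurable_EFinP; exact: measurable_funM.
apply: (@le_lt_trans _ _ (\int[la]_x (K%:E * (om x)%:E))%E).
  apply: ge0_le_integral => //=.
  - by apply/measurable_EFinP; apply: measurableT_comp => //; exact: measurable_funM.
  - by apply/measurable_EFinP; exact: measurable_funM.
  - by move=> x _; rewrite lee_fin normrM (ger0_norm (om0 x)) ler_wpM2r.
(* A negative bound is possible only on an empty space, where the integral is 0. *)
have [K0|K0] := leP 0 K; last first.
  rewrite (@eq_integral _ _ _ _ _ (cst 0%E)) ?integral0// => x _.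
  by have := lt_le_trans K0 (le_trans (normr_ge0 _) (gK x)); rewrite ltxx.
rewrite ge0_integralZl//=; first by rewrite lte_mul_pinfty// lee_fin.
  exact/measurable_EFinP.
by move=> x _; rewrite lee_fin.
Qed.

Let mhorner (q : {poly R[i]}) : measurable_fun setT (fun x => complex.Re q.[w x]).
Proof. by have [] := cmeasurable_horner q mw. Qed.

Let Re_bounded (q : {poly R[i]}) : exists K : R, forall x, `|complex.Re q.[w x]| <= K.
Proof.
have [K [_ hK]] := horner_unimodular_bounded q; exists (1 + K) => x.
by rewrite (le_trans (Re_le_abs2 _))// lerD2l hK.
Qed.

Let integrable_Re (q : {poly R[i]}) :
  la.-integrable setT (fun x => (complex.Re q.[w x] * om x)%:E).
Proof. by have [K hK] := Re_bounded q; exact: (bounded_integrable _ hK). Qed.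

Let mean_Re0 (q : {poly R[i]}) k : \int[la]_x (complex.Re (q * 'X^(k.+1)).[w x] * om x) = 0.
Proof.
elim/poly_ind: q k => [|q c IHq] k.
  rewrite (@eq_Rintegral _ _ _ _ _ (cst 0)); last first.
    by move=> x _; rewrite mul0r horner0 mul0r.
  by rewrite Rintegral_cst// mul0r.
rewrite (@eq_Rintegral _ _ _ _ _ (fun x => complex.Re (q * 'X^(k.+2)).[w x] * om x +
    complex.Re (c%:P * 'X^(k.+1)).[w x] * om x)); last first.
  by move=> x _; rewrite -mulrDl -cReD -hornerD mulrDl -mulrA -exprS.
rewrite RintegralD//; [|exact: integrable_Re|exact: integrable_Re].
rewrite IHq add0r.
have [h1 h2] := momw k.
have iR : la.-integrable setT (fun x => (complex.Re (w x ^+ k.+1) * om x)%:E).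
  by have := integrable_Re 'X^(k.+1); under eq_fun do rewrite hornerXn.
have iI : la.-integrable setT (fun x => (complex.Im (w x ^+ k.+1) * om x)%:E).
  apply: (@bounded_integrable _ 2); first by have [] := cmeasurableX k.+1 mw.
  by move=> x; rewrite (le_trans (Im_le_abs2 _))// abs2X w1 expr1n.
rewrite (@eq_Rintegral _ _ _ _ _ (fun x => complex.Re c * (complex.Re (w x ^+ k.+1) * om x) -
    complex.Im c * (complex.Im (w x ^+ k.+1) * om x))); last first.
  by move=> x _; rewrite hornerM hornerC hornerXn cReM; ring.
rewrite RintegralB// ?RintegralZl// ?h1 ?h2 ?mulr0 ?subr0//.
- by have := integrableZl measurableT (complex.Re c) iR.
- by have := integrableZl measurableT (complex.Im c) iI.
Qed.

(** The mean value property at 0, which follows from the vanishing of the moments [momw]. *)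
Let mean_Re (q : {poly R[i]}) :
  \int[la]_x (complex.Re q.[w x] * om x) = complex.Re q.[0] * \int[la]_x om x.
Proof.
elim/poly_ind: q => [|q c _].
  rewrite horner0 mul0r (@eq_Rintegral _ _ _ _ _ (cst 0)); last first.
    by move=> x _; rewrite horner0 mul0r.
  by rewrite Rintegral_cst// mul0r.
rewrite hornerMXaddC mulr0 add0r.
rewrite (@eq_Rintegral _ _ _ _ _ (fun x => complex.Re (q * 'X^1).[w x] * om x +
    complex.Re c * om x)); last first.
  by move=> x _; rewrite -mulrDl -cReD hornerMXaddC hornerM hornerXn expr1.
have iom : la.-integrable setT (fun x => (om x)%:E).
  have := @bounded_integrable (cst 1) 1 (measurable_cst _).
  under [X in integrable _ _ X]eq_fun do rewrite mul1r.
  by apply => x; rewrite normr1.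
rewrite RintegralD//; [|exact: integrable_Re|].
  by rewrite mean_Re0 add0r RintegralZl.
by have := integrableZl measurableT (complex.Re c) iom.
Qed.

Let TT (t : X -> R) := exists q : {poly R[i]}, t = fun x => complex.Re q.[w x].

(** One polynomial must serve two purposes: closeness for [la] determines its constant term,
    closeness for [mu] bounds the integral of the exponential. Hence the approximation for the sum
    of the measures. *)
Let TT_approximation (g : X -> R) : measurable_fun [set: X] g ->
  (forall x, 0 <= g x <= 1) -> forall e : R, 0 < e -> exists q : {poly R[i]},
  [/\ forall x, 0 <= complex.Re q.[w x] <= 1,
   (\int[la]_x (`|complex.Re q.[w x] - g x| * om x)%:E < e%:E)%E &
   (\int[mu]_x (`|complex.Re q.[w x] - g x| * om x)%:E < e%:E)%E].
Proof.
move=> mg g01 e e0.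
have [] := @measurable_approximable _ _ _ (measure_add la mu) om om0 mom _ TT _ _ _ _ _ _ g mg g01 e e0.
- rewrite ge0_integral_measure_add//; last exact/measurable_EFinP.
    by rewrite lte_add_pinfty.
  by move=> x _; rewrite lee_fin.
- by move=> _ [q ->].
- by move=> _ [q ->]; exact: Re_bounded.
- move=> c; exists (c%:C%:P); apply/funext => x; by rewrite hornerC.
- by move=> _ _ [p ->] [q ->]; exists (p + q); apply/funext => x; rewrite hornerD cReD.
- move=> _ _ [p ->] [q ->]; have [r hr] := Re_hornerM p q.
  by exists r; apply/funext => x; rewrite hr.
- move=> G sG hG; apply: genw => // a b c.
  rewrite (_ : [set _ | _] = [set x | complex.Re ((a -i* b)%:P * 'X).[w x] < c]).
    by apply: hG; eexists; reflexivity.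
  apply/seteqP; split => x /=; rewrite hornerM hornerC hornerX cReM /=.
    by rewrite mulNr opprK.
  by rewrite mulNr opprK.
move=> t [[q ->] t01]; rewrite ge0_integral_measure_add//; last first.
  apply/measurable_EFinP; apply: measurable_funM => //.
    by apply: measurableT_comp => //; exact: measurable_funB.
  by move=> x _; rewrite lee_fin mulr_ge0.
move=> h; exists q; split => //; apply: le_lt_trans h.
  by rewrite leeDl// integral_ge0// => x _; rewrite lee_fin mulr_ge0.
by rewrite leeDr// integral_ge0// => x _; rewrite lee_fin mulr_ge0.
Qed.

(* With [t = Re q(w)] close to [- ln s / B], truncated, the polynomial
   [(1 + B (q - q(0)) / 2n)^n] has constant term 1 and squared modulus at most
   [exp(1 + B t - B Re q(0))] on the circle; [exp(B t)] is of the order of [1 / s], and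
   [Re q(0)], the mean of [t], makes the other factor arbitrarily small. *)
Lemma szego e : 0 < e -> exists q : {poly R[i]},
  (\int[mu]_x (abs2 (1 + w x * q.[w x]) * om x)%:E < e%:E)%E.
Proof.
move=> e0.
have [ms s0 [nu [[N [mN laN nuN]] muE]]] := dens.
have iola' : (\int[la]_x (om x)%:E)%E = (\int[la]_x om x)%:E.
  rewrite fineK// ge0_fin_numE//.
  by apply: integral_ge0 => x _; rewrite lee_fin.
set m := \int[la]_x om x.
have m0 : 0 <= m by apply: Rintegral_ge0.
pose m' := fine (\int[mu]_x (om x)%:E)%E.
have iomu' : (\int[mu]_x (om x)%:E)%E = m'%:E.
  rewrite fineK// ge0_fin_numE//.
  by apply: integral_ge0 => x _; rewrite lee_fin.
have m'0 : 0 <= m' by apply: fine_ge0; apply: integral_ge0 => x _; rewrite lee_fin.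
set C := m + m'.
have C0 : 0 <= C by rewrite addr_ge0.
have C10 : 0 < C + 1 by rewrite ltr_wpDl.
(* The final bound is exp(1 - B c0) (C + 1), with c0 = Re q(0). It is below e as soon as B c0 > L +
   1. The truncation level [de] is chosen so that m B c0 exceeds m (|L| + 2), with a margin that
   absorbs the approximation error. *)
pose L := ln ((C + 1) / e).
have [de [de01 hde]] := logs (m * (`|L| + 2) + 2).
have /andP[de0 de1] := de01.
pose B := - ln de.
have B0 : 0 < B by rewrite oppr_gt0 ln_lt0// de0 de1.
(* The singular part lives on [N], where 1 / s says nothing about it. Setting the function to 0
   there makes exp(g0) = 1 for [nu] and changes nothing for [la], for which [N] is null. *)
pose g0 x : R := if x \in N then 0 else neg_log_clamp s de x.
have mg0 : measurable_fun setT g0.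
  apply: measurable_fun_ifT => //; last exact: measurable_neg_log_clamp.
  apply: (@measurable_fun_bool _ _ _ _ true) => //.
  rewrite setTI (_ : _ @^-1` _ = N)//.
  by apply/seteqP; split => x /=; [move/set_mem|move/mem_set].
have g0B x : 0 <= g0 x <= B.
  rewrite /g0; case: ifP => _; first by rewrite lexx ltW.
  exact: neg_log_clamp_bounds.
pose g x := g0 x / B.
have mg : measurable_fun setT g by apply: measurable_funM.
have g01 x : 0 <= g x <= 1.
  by have /andP[h1 h2] := g0B x; rewrite divr_ge0 ?(ltW B0)//= ler_pdivrMr// mul1r.
have Bg x : B * g x = g0 x by rewrite /g mulrC divfK// gt_eqF.
have BeB0 : 0 < B * expR B by rewrite mulr_gt0// expR_gt0.
(* B exp(B) is a Lipschitz constant of exp(B y) for y in [0, 1]: with this precision, replacing g by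
   t adds at most 1 to the integral of the exponential. The error on the mean of B g is also at most
   1. *)
have [q [q01 qla qmu]] : exists q : {poly R[i]},
  [/\ forall x, 0 <= complex.Re q.[w x] <= 1,
   (\int[la]_x (`|complex.Re q.[w x] - g x| * om x)%:E < ((B * expR B)^-1)%:E)%E &
   (\int[mu]_x (`|complex.Re q.[w x] - g x| * om x)%:E < ((B * expR B)^-1)%:E)%E].
  by apply: TT_approximation => //; rewrite invr_gt0.
pose t x := complex.Re q.[w x].
have mt : measurable_fun setT t by exact: mhorner.
have mdist : measurable_fun setT (fun x => `|t x - g x| * om x).
  apply: measurable_funM => //; apply: measurableT_comp => //; exact: measurable_funB.
pose c0 := complex.Re q.[0].
have tla : (\int[la]_x (t x * om x)%:E)%E = (c0 * m)%:E.
  rewrite -mean_Re fineK// ge0_fin_numE; last first.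
    by apply: integral_ge0 => x _; rewrite lee_fin mulr_ge0//; case/andP: (q01 x).
  have /integrableP[_] := integrable_Re q; apply: le_lt_trans.
  apply: ge0_le_integral => //.
  - by move=> x _; rewrite lee_fin mulr_ge0//; case/andP: (q01 x).
  - by apply/measurable_EFinP; exact: measurable_funM.
  - apply/measurable_EFinP; apply: measurableT_comp => //; exact: measurable_funM.
  - by move=> x _; rewrite lee_fin ler_norm.
have Bc0m : m * (`|L| + 2) + 1 < B * (c0 * m).
  have h : (\int[la]_x (neg_log_clamp s de x * om x)%:E <= B%:E * ((c0 * m)%:E +
      \int[la]_x (`|t x - g x| * om x)%:E))%E.
    rewrite -tla -ge0_integralD//=; last first.
    - exact/measurable_EFinP.
    - by move=> x _; rewrite lee_fin mulr_ge0.
    - by apply/measurable_EFinP; exact: measurable_funM.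
    - by move=> x _; rewrite lee_fin mulr_ge0//; case/andP: (q01 x).
    rewrite -ge0_integralZl//=; last first.
    - by rewrite lee_fin ltW.
    - by move=> x _; rewrite lee_fin addr_ge0// mulr_ge0//; case/andP: (q01 x).
    - by apply/measurable_EFinP; apply: measurable_funD => //; exact: measurable_funM.
    rewrite (@ge0_ae_eq_integral _ _ _ _ _ (fun x => (neg_log_clamp s de x * om x)%:E)
      (fun x => (g0 x * om x)%:E))//; last 5 first.
    - by apply/measurable_EFinP; apply: measurable_funM => //; exact: measurable_neg_log_clamp.
    - by apply/measurable_EFinP; exact: measurable_funM.
    - move=> x _; rewrite lee_fin mulr_ge0//.
      by have /andP[] := neg_log_clamp_bounds s x de01.
    - by move=> x _; rewrite lee_fin mulr_ge0//; case/andP: (g0B x).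
    - exists N; split => // x /= hx; apply: contrapT => nx; apply: hx => _.
      by rewrite /g0 memNset.
    apply: ge0_le_integral => //.
    - by move=> x _; rewrite lee_fin mulr_ge0//; case/andP: (g0B x).
    - by apply/measurable_EFinP; exact: measurable_funM.
    - apply/measurable_EFinP; apply: measurable_funM => //; apply: measurable_funD => //.
      exact: measurable_funM.
    - move=> x _; rewrite lee_fin -mulrDl mulrA ler_wpM2r// -Bg ler_pM2l//.
      by rewrite addrC -lerBlDr (le_trans (ler_norm _))// distrC.
  have := lt_le_trans hde h.
  have hB : (B%:E * (\int[la]_x (`|t x - g x| * om x)%:E) <= 1%:E)%E.
    apply: (@le_trans _ _ (B%:E * ((B * expR B)^-1)%:E)%E).
      by rewrite lee_wpmul2l ?lee_fin ?(ltW B0)// ltW.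
    rewrite -EFinM lee_fin invfM mulrA mulfV ?gt_eqF// mul1r invf_le1 ?expR_gt0//.
    by rewrite -expR0 ler_expR ltW.
  rewrite ge0_muleDr ?lee_fin//.
  - move=> /lt_le_trans /(_ (leeD2l _ hB)); rewrite -EFinM -EFinD lte_fin; lra.
  - have := tla; move=> h2; rewrite -lee_fin -h2.
    by apply: integral_ge0 => x _; rewrite lee_fin mulr_ge0//; case/andP: (q01 x).
  - by apply: integral_ge0 => x _; rewrite lee_fin mulr_ge0.
have Bc0 : `|L| + 2 < B * c0.
  have := Bc0m; have := normr_ge0 L; move: m0; set l := `|L|; set b := B * c0.
  rewrite mulrA -/b => m0 l0 h; rewrite ltNge; apply/negP => hb.
  have : m * b <= m * (l + 2) by rewrite ler_wpM2l.
  by rewrite mulrC; lra.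
have expt : (\int[mu]_x (expR (B * t x) * om x)%:E <= (C + 1)%:E)%E.
  (* Off [N], exp(g0) is the inverse of max(de, min(1, s)), so exp(g0) s <= 1 + s. On the singular
     part exp(g0) = 1. The total is at most the sum of the masses of [om] for [la] and [mu], that is
     C. *)
  have hd : (\int[mu]_x (expR (g0 x) * om x)%:E <= C%:E)%E.
    rewrite (ge0_integral_decomposition ms s0 muE); last 2 first.
    - by move=> x; rewrite lee_fin mulr_ge0 ?expR_ge0.
    - by apply/measurable_EFinP; apply: measurable_funM => //; exact: measurableT_comp.
    rewrite EFinD -iola' -iomu' (ge0_integral_decomposition ms s0 muE (f := EFin \o om)); last 2 first.
    - by move=> x; rewrite lee_fin.
    - exact/measurable_EFinP.
    rewrite addeA -ge0_integralD//=; last first.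
    - by apply/measurable_EFinP; exact: measurable_funM.
    - by move=> x _; rewrite lee_fin mulr_ge0.
    - exact/measurable_EFinP.
    - by move=> x _; rewrite lee_fin.
    apply: leeD.
      apply: ge0_le_integral => //.
      - by move=> x _; rewrite lee_fin !mulr_ge0 ?expR_ge0.
      - apply/measurable_EFinP; apply: measurable_funM => //; apply: measurable_funM => //.
        exact: measurableT_comp.
      - by apply/measurable_EFinP; apply: measurable_funD => //; exact: measurable_funM.
      move=> x _; rewrite lee_fin.
      rewrite (_ : _ * om x * s x = expR (g0 x) * s x * om x); last by ring.
      rewrite (_ : om x + _ = (1 + s x) * om x); last by ring.
      rewrite ler_wpM2r// /g0; case: ifP => _; first by rewrite expR0 mul1r lerDr.
      rewrite /neg_log_clamp expRN; set c := Num.max _ _.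
      have c_gt0 : 0 < c by rewrite lt_max de0.
      rewrite lnK ?posrE// mulrC ler_pdivrMr//.
      have sx0 := s0 x.
      have : Num.min 1 (s x) <= c by rewrite le_max lexx orbT.
      rewrite ge_min => /orP[h|h]; nra.
    rewrite (@ge0_ae_eq_integral _ _ _ _ _ (fun x => (expR (g0 x) * om x)%:E) (EFin \o om))//=.
    - by apply/measurable_EFinP; apply: measurable_funM => //; exact: measurableT_comp.
    - exact/measurable_EFinP.
    - by move=> x _; rewrite lee_fin mulr_ge0 ?expR_ge0.
    - by move=> x _; rewrite lee_fin.
    - exists (~` N); split => //; first exact: measurableC.
      by move=> x /= hx Nx; apply: hx => _; rewrite /g0 mem_set// expR0 mul1r.
  have : (\int[mu]_x (expR (B * t x) * om x)%:E <= \int[mu]_x (expR (g0 x) * om x)%:E +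
      (B * expR B)%:E * \int[mu]_x (`|t x - g x| * om x)%:E)%E.
    rewrite -ge0_integralZl//=; last first.
    - by rewrite lee_fin ltW.
    - by move=> x _; rewrite lee_fin mulr_ge0.
    - exact/measurable_EFinP.
    rewrite -ge0_integralD//=; last first.
    - by apply/measurable_EFinP; apply: measurable_funM.
    - by move=> x _; rewrite lee_fin mulr_ge0 ?(ltW BeB0)// mulr_ge0.
    - by apply/measurable_EFinP; apply: measurable_funM => //; exact: measurableT_comp.
    - by move=> x _; rewrite lee_fin mulr_ge0 ?expR_ge0.
    apply: ge0_le_integral => //.
    - by move=> x _; rewrite lee_fin mulr_ge0 ?expR_ge0.
    - apply/measurable_EFinP; apply: measurable_funM => //; apply: measurableT_comp => //.
      exact: measurable_funM.
    - apply/measurable_EFinP; apply: measurable_funD; apply: measurable_funM => //.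
      exact: measurableT_comp.
    move=> x _; rewrite lee_fin mulrA -mulrDl ler_wpM2r//.
    have /andP[t0 t1] := q01 x; rewrite -/(t x) in t0 t1.
    set y := B * t x; rewrite -Bg; set z := B * g x.
    have -> : B * expR B * `|t x - g x| = expR B * `|y - z|.
      by rewrite /y /z -mulrBr normrM (ger0_norm (ltW B0)); ring.
    have [yz|zy] := leP y z.
      by rewrite (@le_trans _ _ (expR z)) ?ler_expR// lerDl mulr_ge0 ?expR_ge0.
    rewrite ger0_norm ?subr_ge0 ?(ltW zy)//.
    have yB : y <= B by rewrite /y ler_piMr// ltW.
    (* The exponential lies above its tangent at y, so exp y - exp z <= exp y (y - z). *)
    have h1 : expR z = expR y * expR (z - y) by rewrite -expRD; congr expR; ring.
    have h2 := expR_ge1Dx (z - y).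
    have h3 : expR y * (1 + (z - y)) <= expR z by rewrite h1 ler_wpM2l ?expR_ge0.
    have h4 : expR y * (y - z) <= expR B * (y - z).
      by rewrite ler_wpM2r ?ler_expR// subr_ge0 ltW.
    lra.
  move/le_trans; apply; rewrite EFinD; apply: leeD => //.
  apply: (@le_trans _ _ ((B * expR B)%:E * ((B * expR B)^-1)%:E)%E).
    by rewrite lee_wpmul2l ?lee_fin ?(ltW BeB0)// ltW.
  by rewrite -EFinM lee_fin mulfV// gt_eqF.
(* The factor 1/2 compensates the squared modulus: |exp h|^2 = exp(2 Re h). Subtracting q(0)
   normalizes the constant term. Below, n is taken so large that |h|^2 / (n + 1) <= 1, which is the
   1 in exp(1 - B c0). *)
pose h : {poly R[i]} := ((B / 2)%:C *: (q - (q.[0])%:P)).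
have [K [K0 hK]] := horner_unimodular_bounded h.
pose n := Num.truncn K.
pose p : {poly R[i]} := (1 + (n.+1%:R)^-1 *: h) ^+ n.+1.
have hw x : complex.Re h.[w x] = B / 2 * (t x - c0).
  by rewrite /h !hornerE cReM /= cReD cReN; ring.
have ph x : abs2 p.[w x] <= expR (1 - B * c0) * expR (B * t x).
  rewrite /p horner_exp hornerD hornerC hornerZ abs2X mulrC.
  apply: (le_trans (abs2_exp_approx _ _)); rewrite -expRD ler_expR hw.
  have : abs2 h.[w x] / n.+1%:R <= 1.
    by rewrite ler_pdivrMr// mul1r (le_trans (hK _ (w1 x)))// ltW// truncnS_gt.
  have -> : 2 * (B / 2 * (t x - c0)) = B * t x - B * c0 by field.
  by set y := _ / _; lra.
(* Since p(0) = 1, the polynomial p has the form 1 + X q' required by the statement. *)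
have p0 : root (p - 1) 0.
  rewrite /root hornerD hornerN /p horner_exp !hornerE.
  by rewrite subrr /= mulr0 addr0 expr1n subrr.
have [q' hq'] := factor_theorem _ _ p0.
exists q'.
have pE x : 1 + w x * q'.[w x] = p.[w x].
  have := congr1 (fun r : {poly R[i]} => r.[w x]) hq'.
  rewrite /= hornerD hornerN hornerC hornerM hornerXsubC subr0 => /eqP.
  by rewrite subr_eq => /eqP ->; rewrite addrC mulrC.
under eq_integral do rewrite pE.
apply: (@le_lt_trans _ _ ((expR (1 - B * c0))%:E * (C + 1)%:E)%E).
  apply: le_trans (lee_wpmul2l _ expt); last by rewrite lee_fin expR_ge0.
  rewrite -ge0_integralZl//=.
  - apply: ge0_le_integral => //.
    + by move=> x _; rewrite lee_fin mulr_ge0// abs2_ge0.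
    + apply/measurable_EFinP; apply: measurable_funM => //; apply: measurable_abs2.
      exact: cmeasurable_horner.
    + apply/measurable_EFinP; apply: measurable_funM => //; apply: measurable_funM => //.
      by apply: measurableT_comp => //; exact: measurable_funM.
    + by move=> x _; rewrite lee_fin mulrA ler_wpM2r.
  - apply/measurable_EFinP; apply: measurable_funM => //.
    by apply: measurableT_comp => //; exact: measurable_funM.
  - by move=> x _; rewrite lee_fin mulr_ge0 ?expR_ge0.
rewrite -EFinM lte_fin -ltr_pdivlMr//.
have -> : e / (C + 1) = expR (- L).
  by rewrite expRN lnK ?posrE ?divr_gt0// invf_div.
rewrite ltr_expR; have := ler_norm L; lra.
Qed.

End szego.

(** * Density in the product space *)

Section product_measure_integral.
Context {R : realType} {dT : measure_display} {T : measurableType dT}.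

Lemma ge0_integral_product_measure_cons n
    (m : 'I_n.+1 -> {sigma_finite_measure set T -> \bar R})
    (f : n.+1.-tuple T -> \bar R) : measurable_fun setT f -> (forall x, 0 <= f x)%E ->
  (\int[product_measure m]_x f x =
   \int[m ord0]_a \int[product_measure (fun i => m (lift ord0 i))]_t f (tuple_cons (a, t)))%E.
Proof.
move=> mf f0.
have mc := @measurable_tuple_cons _ T n.
set m2 := product_measure (fun i => m (lift ord0 i)).
rewrite (@eq_measure_integral _ _ _ _ (pushforward (m ord0 \x m2)%E (@tuple_cons _ T n)))//.
rewrite ge0_integral_pushforward// preimage_setT fubini_tonelli1//.
  exact: measurableT_comp.
by move=> x /=.
Qed.

Lemma ge0_integral_product_measure n (m : 'I_n -> {sigma_finite_measure set T -> \bar R})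
    (f : 'I_n -> T -> R) : (forall i, measurable_fun setT (f i)) ->
  (forall i x, 0 <= f i x) ->
  (\int[product_measure m]_x (\prod_(i < n) f i (tnth x i))%R%:E =
   \prod_(i < n) \int[m i]_x (f i x)%:E)%E.
Proof.
elim: n m f => [|n IHn] m f mf f0.
  rewrite big_ord0 /=; under eq_integral do rewrite big_ord0.
  by rewrite integral_dirac//= diracT mul1e.
have mprod k (g : 'I_k -> T -> R) : (forall i, measurable_fun setT (g i)) ->
    measurable_fun setT (fun x : k.-tuple T => (\prod_(i < k) g i (tnth x i))%:E).
  move=> mg; apply/measurable_EFinP; apply: measurable_prod => i _.
  by apply: measurableT_comp => //; exact: measurable_tnth.
rewrite ge0_integral_product_measure_cons; last 2 first.
- exact: mprod.
- by move=> x; rewrite lee_fin prodr_ge0.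
rewrite big_ord_recl -IHn//.
set I := (\int[_]_x (\prod_(i < n) _)%:E)%E.
rewrite -ge0_integralZr//; last 3 first.
- exact/measurable_EFinP.
- by move=> x _; rewrite lee_fin.
- by apply: integral_ge0 => x _; rewrite lee_fin prodr_ge0.
apply: eq_integral => a _.
rewrite /I -ge0_integralZl//; last 3 first.
- exact: (mprod _ (fun i => f (lift ord0 i))).
- by move=> x _; rewrite lee_fin prodr_ge0.
- by rewrite lee_fin.
apply: eq_integral => t _.
rewrite big_ord_recl -EFinM; congr (_ * _)%:E.
by apply: eq_bigr => i _; rewrite /tuple_cons/= (tnth_nth a)/= -tnth_nth.
Qed.

End product_measure_integral.

Section product_approximation.
Context {R : realType} {dX : measure_display} {X : measurableType dX} {n : nat}.
Local Notation Y := (n.-tuple X).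
Variables (w e : X -> R[i]).
Hypothesis mw : cmeasurable w.
Hypothesis w1 : forall x, abs2 (w x) = 1.
Hypothesis me : cmeasurable e.
Hypothesis e_neq0 : forall x, e x != 0.
Hypothesis genw : forall G : set (set X), sigma_algebra setT G ->
  (forall a b c : R, G [set x | a * complex.Re (w x) + b * complex.Im (w x) < c]) ->
  measurable `<=` G.
Variable S_ : 'I_n -> {sigma_finite_measure set X -> \bar R}.
Hypothesis ie : forall i, (sq_norm (S_ i) e < +oo)%E.
Hypothesis szegoS : forall i (h : R), 0 < h -> exists q : {poly R[i]},
  (\int[S_ i]_x (abs2 (1 + w x * q.[w x]) * abs2 (e x))%:E < h%:E)%E.
Variable S : {measure set Y -> \bar R}.
Hypothesis leS : forall A, measurable A -> (S A <= product_measure S_ A)%E.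

Definition tensor_power (u : Y) : R[i] := \prod_(i < n) e (tnth u i).
Local Notation E := tensor_power.

(** [DD] stands for the transforms of the test functions carried by the orthant. Stability under
    w(u_i) is asked up to an arbitrarily small error, to accommodate both the lattice, where it is
    exact, and the line. *)
Variable DD : (Y -> R[i]) -> Prop.
Hypothesis DDm : forall D, DD D -> cmeasurable D.
Hypothesis DD_linear : forall c D1 D2, DD D1 -> DD D2 -> DD (fun u => c * D1 u + D2 u).
Hypothesis DDE : DD E.
Hypothesis DDw : forall D i (h : R), DD D -> 0 < h -> exists D', DD D' /\
  (sq_norm S (fun u => w (tnth u i) * D u - D' u)%R < h%:E)%E.

Let mtnth i : measurable_fun [set: Y] (fun u : Y => tnth u i).
Proof. exact: measurable_tnth. Qed.

Let mE : cmeasurable E.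
Proof. by apply: cmeasurable_prod => i; exact: (cmeasurable_comp me (mtnth i)). Qed.

Let E_neq0 u : E u != 0.
Proof. by apply/prodf_neq0 => i _. Qed.

Let mwi i : cmeasurable (fun u : Y => w (tnth u i)).
Proof. exact: (cmeasurable_comp mw (mtnth i)). Qed.

Definition in_L2_closure (F : Y -> R[i]) := forall h : R, 0 < h ->
  exists D, DD D /\ (sq_norm S (fun u => F u - D u)%R < h%:E)%E.
Local Notation cl := in_L2_closure.

Let cl_cl F : cmeasurable F -> (forall h : R, 0 < h -> exists G,
  [/\ cmeasurable G, cl G & (sq_norm S (fun u => F u - G u)%R < h%:E)%E]) -> cl F.
Proof.
move=> mF H h h0; have h40 : 0 < h / 4 by rewrite divr_gt0.
have [G [mG clG FG]] := H _ h40; have [D [DD_ GD]] := clG _ h40.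
exists D; split => //; apply: (sq_norm_triangle mF mG) => //; exact: DDm.
Qed.

Let cl_linear c F G : cmeasurable F -> cmeasurable G -> cl F -> cl G ->
  cl (fun u => c * F u + G u).
Proof.
move=> mF mG clF clG h h0; have h40 : 0 < h / 4 by rewrite divr_gt0.
have c0 : 0 < abs2 c + 1 by rewrite ltr_wpDl// abs2_ge0.
have [D [DD_ FD]] := clF (h / 4 / (abs2 c + 1)) (divr_gt0 h40 c0).
have [D' [DD' GD']] := clG _ h40.
exists (fun u => c * D u + D' u); split; first exact: DD_linear.
rewrite (eq_sq_norm _ (g := fun u => c * (F u - D u) + (G u - D' u))); last first.
  by move=> u; ring.
have mFD : cmeasurable (fun u => F u - D u) by apply: cmeasurableB => //; exact: DDm.
have mGD : cmeasurable (fun u => G u - D' u) by apply: cmeasurableB => //; exact: DDm.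
have mcFD : cmeasurable (fun u => c * (F u - D u)).
  by apply: cmeasurableM => //; exact: cmeasurable_cst.
apply: (le_lt_trans (sq_normD _ mcFD mGD)).
rewrite sq_normZ//.
have -> : h%:E = (2%:E * (h / 4)%:E + 2%:E * (h / 4)%:E)%E.
  by rewrite -!EFinM -EFinD; congr EFin; lra.
rewrite lteD// lte_pmul2l ?lte_fin//.
apply: (@le_lt_trans _ _ ((abs2 c + 1)%:E * sq_norm S (fun u => F u - D u)%R)%E).
  by rewrite lee_wpmul2r ?sq_norm_ge0// lee_fin lerDl.
have -> : h / 4 = (abs2 c + 1) * (h / 4 / (abs2 c + 1)) by rewrite [RHS]mulrC divfK ?gt_eqF.
by rewrite EFinM lte_pmul2l ?lte_fin.
Qed.

Let cl0 : cl (fun=> 0).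
Proof.
move=> h h0; exists (fun u => -1 * E u + E u); split; first exact: DD_linear.
rewrite (eq_sq_norm _ (g := fun=> 0)); last by move=> u; ring.
by rewrite /sq_norm; under eq_integral do rewrite abs2_0; rewrite integral0 lte_fin.
Qed.

Let clw F i : cmeasurable F -> cl F -> cl (fun u => w (tnth u i) * F u).
Proof.
move=> mF clF h h0; have h40 : 0 < h / 4 by rewrite divr_gt0.
have [D [DD_ FD]] := clF _ h40; have mD := DDm DD_.
have [D' [DD' DD'w]] := DDw i DD_ h40.
exists D'; split => //.
apply: (sq_norm_triangle (g := fun u => w (tnth u i) * D u)) => //.
- exact: cmeasurableM.
- exact: cmeasurableM.
- exact: DDm.
rewrite /sq_norm; under eq_integral do rewrite -mulrBr abs2M w1 mul1r.
exact: FD.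
Qed.

(** The bounded multipliers of E. Boundedness lets an error on E, small in L^2([S]), remain small
    after multiplication by G. *)
Let HH (G : Y -> R[i]) := [/\ cmeasurable G, exists K, forall u, abs2 (G u) <= K &
  cl (fun u => E u * G u)].

Let HH_linear c F G : HH F -> HH G -> HH (fun u => c * F u + G u).
Proof.
move=> [mF [K hK] clF] [mG [L hL] clG]; split.
- by apply: cmeasurableD => //; apply: cmeasurableM => //; exact: cmeasurable_cst.
- exists (2 * (abs2 c * K) + 2 * L) => u; rewrite (le_trans (abs2D _ _))// abs2M.
  by rewrite lerD// ler_pM2l// ler_wpM2l// abs2_ge0.
- rewrite (_ : (fun u => _) = (fun u => c * (E u * F u) + E u * G u)).
    by apply: cl_linear => //; exact: cmeasurableM.
  by apply/funext => u; ring.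
Qed.

Let HH1 : HH (fun=> 1).
Proof.
split; first exact: cmeasurable_cst.
  by exists 1 => u; rewrite abs2_1.
move=> h h0; exists E; split => //.
rewrite (eq_sq_norm _ (g := fun=> 0)); last by move=> u; rewrite mulr1 subrr.
by rewrite /sq_norm; under eq_integral do rewrite abs2_0; rewrite integral0 lte_fin.
Qed.

Let HH0 : HH (fun=> 0).
Proof.
split; first exact: cmeasurable_cst.
  by exists 0 => u; rewrite abs2_0.
by rewrite (_ : (fun u => _) = fun=> 0)//; apply/funext => u; rewrite mulr0.
Qed.

Let HHw G i : HH G -> HH (fun u => w (tnth u i) * G u).
Proof.
move=> [mG [K hK] clG]; split.
- exact: cmeasurableM.
- by exists K => u; rewrite abs2M w1 mul1r.
- rewrite (_ : (fun u => _) = (fun u => w (tnth u i) * (E u * G u))).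
    by apply: clw => //; exact: cmeasurableM.
  by apply/funext => u; ring.
Qed.

Let HHq G i (q : {poly R[i]}) : HH G -> HH (fun u => q.[w (tnth u i)] * G u).
Proof.
move=> hG; elim/poly_ind: q => [|q c IHq].
  by under eq_fun do rewrite horner0 mul0r.
rewrite (_ : (fun u => _) = (fun u => c * G u + w (tnth u i) * (q.[w (tnth u i)] * G u))).
  by apply: HH_linear => //; exact: HHw.
by apply/funext => u; rewrite hornerMXaddC; ring.
Qed.

(** The domination of [S] and Tonelli's theorem reduce the integral to coordinate i, the other
    coordinates contributing the squared norms of e. The added 1 keeps the constant positive, so
    that one may divide by it. *)
Let integral_weighted i : exists Q : R, 0 < Q /\ forall f : X -> R,
  measurable_fun setT f -> (forall x, 0 <= f x) ->
  (\int[S]_u (f (tnth u i) * abs2 (E u))%:E <=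
    Q%:E * \int[S_ i]_x (f x * abs2 (e x))%:E)%E.
Proof.
have fine_e j : (\int[S_ j]_x (abs2 (e x))%:E)%E = (fine (sq_norm (S_ j) e))%:E.
  by rewrite fineK// ge0_fin_numE ?sq_norm_ge0.
exists (\prod_(j < n | j != i) fine (sq_norm (S_ j) e) + 1); split.
  by rewrite ltr_wpDl// prodr_ge0// => j _; rewrite fine_ge0// sq_norm_ge0.
move=> f mf f0.
pose F j x := (if j == i then f x * abs2 (e x) else abs2 (e x)).
have mF j : measurable_fun setT (F j).
  rewrite /F; case: eqP => _; last exact: measurable_abs2.
  by apply: measurable_funM => //; exact: measurable_abs2.
have F0 j x : 0 <= F j x by rewrite /F; case: eqP => _; rewrite ?mulr_ge0 ?abs2_ge0.
have fE u : f (tnth u i) * abs2 (E u) = \prod_(j < n) F j (tnth u j).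
  rewrite /tensor_power abs2_prod (bigD1 i)//= [RHS](bigD1 i)//= /F eqxx mulrA.
  by congr (_ * _); apply: eq_bigr => j /negbTE ->.
under eq_integral do rewrite fE.
apply: (@le_trans _ _ (\int[product_measure S_]_u (\prod_(j < n) F j (tnth u j))%:E)%E).
  apply: ge0_le_measure_integral => //.
    by move=> u; rewrite lee_fin prodr_ge0.
  apply/measurable_EFinP; apply: measurable_prod => j _.
  exact: (measurableT_comp (mF j) (mtnth j)).
rewrite ge0_integral_product_measure// (bigD1 i)//= muleC.
rewrite (_ : (\int[S_ i]_x (F i x)%:E)%E = (\int[S_ i]_x (f x * abs2 (e x))%:E)%E); last first.
  by rewrite /F eqxx.
apply: lee_wpmul2r.
  by apply: integral_ge0 => x _; rewrite lee_fin mulr_ge0// abs2_ge0.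
rewrite (eq_bigr (fun j => (fine (sq_norm (S_ j) e))%:E)); last first.
  by move=> j /negbTE ji; rewrite /F ji fine_e.
by rewrite prodEFin lee_fin lerDl.
Qed.

(* Up to an error controlled by the hypothesis [szegoS], conj w = - q(w). *)
Let HHwV G i : HH G -> HH (fun u => (w (tnth u i))^*%C * G u).
Proof.
move=> hG; have [mG [K hK] clG] := hG.
have mwc : cmeasurable (fun u : Y => (w (tnth u i))^*%C) by exact: cmeasurable_conj.
split; first exact: cmeasurableM.
  by exists K => u; rewrite abs2M abs2_conj w1 mul1r.
apply: cl_cl; first by apply: cmeasurableM => //; exact: cmeasurableM.
move=> h h0.
have [Q [Q0 hQ]] := integral_weighted i.
have K0 : 0 < `|K| + 1 by rewrite ltr_wpDl.
have [q hq] := szegoS i (divr_gt0 (divr_gt0 h0 K0) Q0).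
have mq : cmeasurable (fun u : Y => q.[w (tnth u i)]) by exact: cmeasurable_horner.
have m1q : cmeasurable (fun u : Y => 1 + w (tnth u i) * q.[w (tnth u i)]).
  by apply: cmeasurableD; [exact: cmeasurable_cst|exact: cmeasurableM].
exists (fun u => E u * (-1 * (q.[w (tnth u i)] * G u) + 0)); split.
- apply: cmeasurableM => //; apply: cmeasurableD; last exact: cmeasurable_cst.
  by apply: cmeasurableM; [exact: cmeasurable_cst|exact: cmeasurableM].
- by have [] := HH_linear (-1) (HHq i q hG) HH0.
(* Since w conj w = 1, conj w + q(w) = conj w (1 + w q(w)). *)
rewrite (eq_sq_norm _ (g := fun u => (w (tnth u i))^*%C * G u *
    ((1 + w (tnth u i) * q.[w (tnth u i)]) * E u))); last first.
  move=> u; have := mul_conj_unimodular (w1 (tnth u i)).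
  set z := w _; set zc := z^*%C => zz.
  rewrite (_ : zc * G u * _ = zc * (E u * G u) + (z * zc) * (q.[z] * E u * G u)); last by ring.
  by rewrite zz; ring.
apply: (@le_lt_trans _ _ ((`|K| + 1)%:E * sq_norm S
    (fun u => (1 + w (tnth u i) * q.[w (tnth u i)]) * E u)%R)%E).
  apply: le_sq_norm; first exact: ltW.
  - by apply: cmeasurableM; exact: cmeasurableM.
  - exact: cmeasurableM.
  move=> u; rewrite abs2M; apply: ler_wpM2r; first exact: abs2_ge0.
  rewrite abs2M abs2_conj w1 mul1r (le_trans (hK u))// (le_trans (ler_norm K))//.
  by rewrite lerDl.
rewrite /sq_norm; under eq_integral do rewrite abs2M.
have m1q' : cmeasurable (fun x => 1 + w x * q.[w x]).
  apply: cmeasurableD; first exact: cmeasurable_cst.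
  by apply: cmeasurableM => //; exact: cmeasurable_horner.
have := hQ _ (measurable_abs2 m1q') (fun x => abs2_ge0 _).
have : (Q%:E * (\int[S_ i]_x (abs2 (1 + w x * q.[w x]) * abs2 (e x))%:E) <
    (h / (`|K| + 1))%:E)%E.
  apply: (@lt_le_trans _ _ (Q%:E * (h / (`|K| + 1) / Q)%:E)%E).
    by rewrite lte_pmul2l ?lte_fin.
  by rewrite -EFinM lee_fin mulrC divfK ?gt_eqF.
move=> h1 /le_lt_trans /(_ h1) h2.
apply: (@lt_le_trans _ _ ((`|K| + 1)%:E * (h / (`|K| + 1))%:E)%E).
  by rewrite lte_pmul2l ?lte_fin.
by rewrite -EFinM lee_fin mulrC divfK ?gt_eqF.
Qed.

(** Asking that [t] preserve [HH], rather than belong to it, makes stability under products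
    immediate. *)
Let TT (t : Y -> R) := [/\ measurable_fun setT t, exists K : R, forall u, `|t u| <= K &
  forall G, HH G -> HH (fun u => (t u)%:C * G u)].

Let TT_cst c : TT (cst c).
Proof.
split; [exact: measurable_cst|by exists `|c| |move=> G hG].
rewrite (_ : (fun u => _) = (fun u => c%:C * G u + 0)); first exact: HH_linear.
by apply/funext => u; rewrite addr0.
Qed.

(** The real and imaginary parts involve both w and its conjugate; the latter is available through
    [HHwV], that is, through Szego's theorem. *)
Let TT_re_im i a b : TT (fun u => a * complex.Re (w (tnth u i)) + b * complex.Im (w (tnth u i))).
Proof.
have [mr mi] := mwi i; split.
- by apply: measurable_funD; exact: measurable_funM.
- exists (`|a| * 2 + `|b| * 2) => u; rewrite (le_trans (ler_normD _ _))// !normrM.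
  rewrite lerD// ler_wpM2l//.
    by rewrite (le_trans (Re_le_abs2 _))// w1.
  by rewrite (le_trans (Im_le_abs2 _))// w1.
move=> G hG.
rewrite (_ : (fun u => _) = (fun u => (a / 2 -i* (b / 2)) * (w (tnth u i) * G u) +
    ((a / 2 +i* (b / 2)) * ((w (tnth u i))^*%C * G u) + 0))).
  by apply: HH_linear; [exact: HHw|apply: HH_linear => //; exact: HHwV].
apply/funext => u; rewrite addr0 !mulrA -mulrDl; congr (_ * _).
case: (w (tnth u i)) => x y; apply/eqP; rewrite eq_complex !cReD !cImD !cReM !cImM /=.
by apply/andP; split; apply/eqP; field.
Qed.

Let TT_D s t : TT s -> TT t -> TT (fun u => s u + t u).
Proof.
move=> [ms [K hK] sH] [mt [L hL] tH]; split; first exact: measurable_funD.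
  by exists (K + L) => u; rewrite (le_trans (ler_normD _ _))// lerD.
move=> G hG.
rewrite (_ : (fun u => _) = (fun u => 1 * ((s u)%:C * G u) + (t u)%:C * G u)).
  by apply: HH_linear; [exact: sH|exact: tH].
by apply/funext => u; rewrite rmorphD/= mulrDl mul1r.
Qed.

Let TT_M s t : TT s -> TT t -> TT (fun u => s u * t u).
Proof.
move=> [ms [K hK] sH] [mt [L hL] tH]; split; first exact: measurable_funM.
  by exists (K * L) => u; rewrite normrM ler_pM.
move=> G hG.
rewrite (_ : (fun u => _) = (fun u => (s u)%:C * ((t u)%:C * G u))).
  by apply: sH; exact: tH.
by apply/funext => u; rewrite rmorphM/= mulrA.
Qed.

Let TT_gen (G : set (set Y)) : sigma_algebra setT G ->
  (forall t c, TT t -> G [set x | t x < c]) -> measurable `<=` G.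
Proof.
move=> sG hG A mA; apply: (smallest_sub _ _ mA) => //.
apply: (big_ind (fun B => B `<=` G)) => // [B B' BG BG' C [|]//|i _]; [exact: BG|exact: BG'|].
move=> _ [C mC <-]; rewrite setTI.
have [G0 GC GU] := sG.
suff : measurable `<=` [set D | G ((@tnth n X ^~ i) @^-1` D)] by apply.
apply: genw.
  split => /=.
  - by rewrite preimage_set0.
  - by move=> D GD; rewrite setTD preimage_setC -setTD; exact: GC.
  - by move=> D GD; rewrite preimage_bigcup; exact: GU.
by move=> a b c /=; apply: hG; exact: TT_re_im.
Qed.

Let iE : (sq_norm S E < +oo)%E.
Proof.
apply: (@le_lt_trans _ _ (sq_norm (product_measure S_) E)).
  exact: le_sq_norm_measure.
rewrite /sq_norm; under eq_integral do rewrite abs2_prod.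
rewrite (ge0_integral_product_measure _ (f := fun i x => abs2 (e x))); last 2 first.
- by move=> i; exact: measurable_abs2.
- by move=> i x; exact: abs2_ge0.
rewrite (eq_bigr (fun j => (fine (sq_norm (S_ j) e))%:E)); last first.
  by move=> j _; rewrite fineK// ge0_fin_numE ?sq_norm_ge0.
by rewrite prodEFin ltry.
Qed.

(** After rescaling to [0, 1], the approximation in weighted L^1 gives one in L^2: the difference of
    two functions with values in [0, 1] is at most 1, so its square is no larger than itself. *)
Let cl_real (g : Y -> R) (K : R) : measurable_fun setT g -> (forall u, `|g u| <= K) ->
  cl (fun u => E u * (g u)%:C).
Proof.
move=> mg gK; set L := `|K| + 1.
have L0 : 0 < L by rewrite ltr_wpDl.
have gL u : `|g u| <= L by rewrite (le_trans (gK u))// (le_trans (ler_norm K))// lerDl.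
have mgC : cmeasurable (fun u => E u * (g u)%:C).
  by apply: cmeasurableM => //; exact: cmeasurable_real.
apply: cl_cl => // h h0.
pose g1 u := (g u + L) / (2 * L).
have L20 : 0 < 2 * L by rewrite mulr_gt0.
have mg1 : measurable_fun setT g1 by apply: measurable_funM => //; exact: measurable_funD.
have g101 u : 0 <= g1 u <= 1.
  have := gL u; rewrite ler_norml => /andP[h1 h2].
  rewrite /g1 divr_ge0 ?(ltW L20)//=; last by lra.
  by rewrite ler_pdivrMr// mul1r; lra.
have c0 : 0 < (2 * L) ^+ 2 by rewrite exprn_gt0.
have [t [Tt t01 ht]] := measurable_approximable (fun u => abs2_ge0 (E u))
  (measurable_abs2 mE) iE (fun t (Tt : TT t) => let: And3 a _ _ := Tt in a)
  (fun t (Tt : TT t) => let: And3 _ b _ := Tt in b) TT_cst TT_D TT_M TT_gen mg1 g101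
  (divr_gt0 h0 c0).
pose t1 u := 2 * L * t u - L.
have Tt1 : TT t1.
  rewrite (_ : t1 = (fun u => cst (2 * L) u * t u + cst (- L) u))//.
  exact: (TT_D (TT_M (TT_cst (2 * L)) Tt) (TT_cst (- L))).
have [mt1 _ /(_ _ HH1) [_ _ clt1]] := Tt1.
have clt1' : cl (fun u => E u * (t1 u)%:C).
  by move: clt1; under eq_fun do rewrite mulr1.
exists (fun u => E u * (t1 u)%:C); split => //.
  by apply: cmeasurableM => //; exact: cmeasurable_real.
have mt : measurable_fun setT t by case: Tt.
have : (((2 * L) ^+ 2)%:E * (\int[S]_x (`|t x - g1 x| * abs2 (E x))%:E) < h%:E)%E.
  apply: (@lt_le_trans _ _ (((2 * L) ^+ 2)%:E * (h / (2 * L) ^+ 2)%:E)%E).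
    by rewrite lte_pmul2l ?lte_fin.
  by rewrite -EFinM lee_fin mulrC divfK ?gt_eqF.
apply: le_lt_trans.
have md : measurable_fun setT (fun x => `|t x - g1 x| * abs2 (E x)).
  apply: measurable_funM; last exact: measurable_abs2.
  by apply: measurableT_comp => //; exact: measurable_funB.
rewrite -ge0_integralZl//=; last first.
- by rewrite lee_fin ltW.
- by move=> x _; rewrite lee_fin mulr_ge0// abs2_ge0.
- exact/measurable_EFinP.
apply: ge0_le_integral => //.
- by move=> x _; rewrite lee_fin abs2_ge0.
- apply: measurable_abs2E; apply: cmeasurableB => //.
  by apply: cmeasurableM => //; exact: cmeasurable_real.
- by apply/measurable_EFinP; apply: measurable_funM.
move=> u _; rewrite lee_fin -mulrBr abs2M -rmorphB/= abs2_real.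
rewrite [leRHS]mulrA [leLHS]mulrC ler_wpM2r ?abs2_ge0//.
have -> : g u - t1 u = (2 * L) * (g1 u - t u).
  by rewrite /g1 /t1; field; rewrite gt_eqF.
rewrite exprMn ler_pM2l// distrC -real_normK ?num_real// expr2 ler_piMr//.
have /andP[? ?] := t01 u; have /andP[? ?] := g101 u.
by rewrite ler_norml; apply/andP; split; lra.
Qed.

(** E vanishes nowhere, so F = E (F / E). Truncating F / E on its sublevel sets gives bounded
    multipliers, and the truncations of F converge by domination. *)
Lemma L2_closure_full F : cmeasurable F -> (sq_norm S F < +oo)%E -> in_L2_closure F.
Proof.
move=> mF iF.
pose A k := [set u | abs2 (F u / E u) <= k%:R].
have mFE : cmeasurable (fun u => F u / E u) by apply: cmeasurableM => //; exact: cmeasurableV.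
have mA k : measurable (A k).
  rewrite (_ : A k = (fun u => abs2 (F u / E u)) @^-1` [set y | y <= k%:R])//.
  rewrite -[X in measurable X]setTI; apply: (measurable_abs2 mFE) => //.
  by rewrite -set_itvNyc.
pose G k u := (F u / E u) * (\1_(A k) u)%:C.
have mG k : cmeasurable (G k).
  by apply: cmeasurableM => //; apply: cmeasurable_real; exact: measurable_indic.
have Gk k u : abs2 (G k u) <= k%:R.
  rewrite /G abs2M abs2_real indicE; have [Au|nAu] := boolP (u \in A k).
    by rewrite expr1n mulr1; move: Au; rewrite inE.
  by rewrite expr0n mulr0.
have EG k u : E u * G k u = F u * (\1_(A k) u)%:C.
  by rewrite /G mulrA [_ * (F u / _)]mulrC divfK.
have clG k : cl (fun u => E u * G k u).
  have b1 u : `|complex.Re (G k u)| <= 1 + k%:R.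
    by rewrite (le_trans (Re_le_abs2 _))// lerD2l.
  have b2 u : `|complex.Im (G k u)| <= 1 + k%:R.
    by rewrite (le_trans (Im_le_abs2 _))// lerD2l.
  have [mr mi] := mG k.
  rewrite (_ : (fun u => _) = (fun u => 'i%C * (E u * (complex.Im (G k u))%:C) +
      E u * (complex.Re (G k u))%:C)).
    apply: cl_linear; [| |exact: (cl_real mi b2)|exact: (cl_real mr b1)].
      by apply: cmeasurableM => //; exact: cmeasurable_real.
    by apply: cmeasurableM => //; exact: cmeasurable_real.
  by apply/funext => u; rewrite {1}(complexE (G k u)); ring.
apply: cl_cl => // h h0.
have le k u : abs2 (F u - E u * G k u) <= abs2 (F u).
  rewrite EG indicE; case: (_ \in _); first by rewrite mulr1 subrr abs2_0 abs2_ge0.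
  by rewrite mulr0 subr0.
have cv u : (fun k => abs2 (F u - E u * G k u)) @ \oo --> (0 : R).
  apply: cvg_near_cst.
  exists (Num.truncn (abs2 (F u / E u))).+1 => // k /= hk.
  rewrite EG indicE mem_set ?mulr1 ?subrr ?abs2_0//.
  rewrite /A /= ltW// (lt_le_trans (truncnS_gt _))// ler_nat.
  exact: hk.
have [k hk] := sq_norm_dominated (fun k => cmeasurableB mF (cmeasurableM mE (mG k)))
  mF le cv iF h0.
by exists (fun u => E u * G k u); split => //; exact: cmeasurableM.
Qed.

End product_approximation.

(** * The circle *)

Lemma integral_antiderivative (R : realType) (f F : R -> R) (a b : R) : a < b ->
  continuous f -> (forall x : R, is_derive x 1 F (f x)) ->
  (\int[@lebesgue_measure R]_(t in `[a, b]) (f t)%:E = (F b - F a)%:E)%E.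
Proof.
move=> ab cf dF.
have cF : continuous F by move=> x; exact/differentiable_continuous/derivable1_diffP.
apply: continuous_FTC2 => //.
- exact: continuous_subspaceT.
- split => [x _| |].
  + by have [] := dF x.
  + by apply: cvg_at_right_filter; exact: cF.
  + by apply: cvg_at_left_filter; exact: cF.
- by move=> x _; rewrite derive1E; have [_ ->] := dF x.
Qed.

(** Adding 1 makes the integrand non-negative, so that a moment can be computed through integrals of
    non-negative functions. *)
Lemma weighted_mean_eq0 d (T : measurableType d) (R : realType) (mu : {measure set T -> \bar R})
    (om f : T -> R) (c : R) : measurable_fun setT om -> (forall x, 0 <= om x) ->
  (\int[mu]_x (om x)%:E = c%:E)%E -> measurable_fun setT f -> (forall x, `|f x| <= 1) ->
  (\int[mu]_x ((1 + f x) * om x)%:E = c%:E)%E -> \int[mu]_x (f x * om x) = 0.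
Proof.
move=> mom om0 omE mf f1.
have iom : mu.-integrable setT (fun x => (om x)%:E).
  apply/integrableP; split => //=; first exact/measurable_EFinP.
  by under eq_integral do rewrite ger0_norm//; rewrite omE ltry.
have iF : mu.-integrable setT (EFin \o (fun x => f x * om x)).
  apply: le_integrable iom => //; first by apply/measurable_EFinP; exact: measurable_funM.
  by move=> x _ /=; rewrite lee_fin normrM ler_piMl.
under eq_integral do rewrite mulrDl mul1r.
rewrite integralD_EFin// omE /Rintegral.
have : (\int[mu]_x (f x * om x)%:E)%E \is a fin_num by exact: integrable_fin_num.
by case: (\int[mu]_x (f x * om x)%:E)%E => //= r _ [] rE; apply: (@addrI _ c); rewrite addr0.
Qed.

Section borel_generation.
Context {R : realType}.

Lemma measurable_sub_rays (G : set (set (measurableTypeR R))) : sigma_algebra setT G ->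
  (forall c : R, G [set x | (x : R) < c]) -> measurable `<=` G.
Proof.
move=> sG hG A mA.
have : <<s @RGenInftyO.G R >> A by have := mA; rewrite RGenInftyO.measurableE.
apply: smallest_sub => // _ [x ->].
by rewrite set_itvNyo; exact: hG.
Qed.

End borel_generation.

Section circle_facts.
Context {R : realType}.
Local Notation T := (circle R).

Lemma cmeasurable_circle_val : cmeasurable (@circle_val R).
Proof.
have mc : measurable_fun [set: T] (@unit_complex_coords R : T -> _).
  by move=> _ A mA; rewrite setTI; exists A => //; rewrite setTI.
split.
- exact: (measurableT_comp (f := fst) measurable_fst mc).
- exact: (measurableT_comp (f := snd) measurable_snd mc).
Qed.

Lemma abs2_circle_val (u : T) : abs2 (circle_val u) = 1.
Proof.
case: u => z z1; rewrite /circle_val /=; move/eqP: z1.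
rewrite normc_def /abs2 => /(congr1 (@complex.Re R)) /= h.
rewrite -[LHS]sqr_sqrtr ?addr_ge0 ?sqr_ge0// h expr1n //.
Qed.

Lemma circle_generated (G : set (set T)) : sigma_algebra setT G ->
  (forall a b c : R, G [set u | a * complex.Re (circle_val u)^*%C +
    b * complex.Im (circle_val u)^*%C < c]) -> measurable `<=` G.
Proof.
move=> [G0 GC GU] hG A [B mB <-]; rewrite setTI.
have pre (rT : Type) (f : T -> rT) : sigma_algebra setT [set D | G (f @^-1` D)].
  split => /=; first by rewrite preimage_set0.
  - by move=> D GD; rewrite setTD preimage_setC -setTD; exact: GC.
  - by move=> D GD; rewrite preimage_bigcup; exact: GU.
apply: (smallest_sub (pre _ (@unit_complex_coords R)) _ mB) => C [] [D mD <-] /=; rewrite setTI.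
- suff : measurable `<=` [set D | G ((fun u : T => complex.Re (circle_val u)) @^-1` D)].
    by move=> /(_ D mD).
  apply: measurable_sub_rays; first exact: pre.
  move=> c /=; rewrite (_ : _ @^-1` _ = [set u : T | 1 * complex.Re (circle_val u)^*%C +
    0 * complex.Im (circle_val u)^*%C < c])//.
  by apply/seteqP; split => u /=; rewrite mul1r mul0r addr0; case: (circle_val u).
- suff : measurable `<=` [set D | G ((fun u : T => complex.Im (circle_val u)) @^-1` D)].
    by move=> /(_ D mD).
  apply: measurable_sub_rays; first exact: pre.
  move=> c /=; rewrite (_ : _ @^-1` _ = [set u : T | 0 * complex.Re (circle_val u)^*%C +
    -1 * complex.Im (circle_val u)^*%C < c])//.
  by apply/seteqP; split => u /=; rewrite mul0r add0r mulN1r; case: (circle_val u) => x y /=; rewrite opprK.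
Qed.

Lemma ge0_integral_arc_length (f : T -> R) : measurable_fun setT f -> (forall u, 0 <= f u) ->
  (\int[@arc_length R]_u (f u)%:E =
   \int[@lebesgue_measure R]_(t in `[(- pi)%R, pi%R]) (f (circle_expi t))%:E)%E.
Proof.
move=> mf f0.
have mc := @measurable_circle_expi R.
have mI := @measurable_itv R `[- pi, pi[.
rewrite (@eq_measure_integral _ _ _ _
  (pushforward (mrestr (@lebesgue_measure R) mI) (@circle_expi R)))//.
rewrite ge0_integral_pushforward//; last 2 first.
- exact/measurable_EFinP.
- by move=> u _; rewrite lee_fin.
rewrite preimage_setT.
have mfc : measurable_fun [set: measurableTypeR R] (fun t => (f (circle_expi t))%:E).
  by apply/measurable_EFinP; exact: (measurableT_comp mf mc).
(* The restricted Lebesgue measure is treated as a measure with an indicator as density and no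
   singular part. The missing endpoint [pi] is negligible. *)
rewrite (@ge0_integral_decomposition _ _ _ (@lebesgue_measure R) (mrestr (@lebesgue_measure R) mI) mzero
  (\1_(`[- pi, pi[%classic) : measurableTypeR R -> R)).
- rewrite integral_measure_zero adde0.
  rewrite -(@integral_itv_bndo_bndc R); last exact: (measurable_funS measurableT).
  rewrite [RHS]integral_mkcond; apply: eq_integral => t _ /=.
  by rewrite epatch_indic.
- exact: measurable_indic.
- by move=> x; rewrite indicE.
- by move=> A mA; rewrite /mzero /= adde0 /mrestr integral_indic// setIC.
- by move=> x; rewrite lee_fin.
- exact: mfc.
Qed.

Lemma expiX (t : R) k : expi t ^+ k = expi (k%:R * t).
Proof.
elim: k => [|k IHk]; first by rewrite expr0 mul0r expi0.
by rewrite exprS IHk -expiD -natr1 mulrDl mul1r addrC.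
Qed.

Lemma conj_expi (t : R) : (expi t)^*%C = expi (- t).
Proof. by rewrite /expi cosN sinN. Qed.

Lemma sin_natmul_pi k : sin (k%:R * pi) = 0 :> R.
Proof.
elim: k => [|k IHk]; first by rewrite mul0r sin0.
by rewrite -natr1 mulrDl mul1r sinD IHk sinpi mul0r mulr0 addr0.
Qed.

(** The minus sign in front of the sine comes from w being the conjugate coordinate. *)
Lemma integral_pi_trig k :
  (\int[@lebesgue_measure R]_(t in `[(- pi)%R, pi%R]) (1 + cos (k.+1%:R * t))%:E =
    (2 * pi : R)%:E)%E /\
  (\int[@lebesgue_measure R]_(t in `[(- pi)%R, pi%R]) (1 - sin (k.+1%:R * t))%:E =
    (2 * pi : R)%:E)%E.
Proof.
have k0 : k.+1%:R != 0 :> R by rewrite pnatr_eq0.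
have cM : continuous (fun t : R => k.+1%:R * t) by move=> t; apply: cvgM; first exact: cvg_cst.
have pi_lt : - pi < pi :> R by have := pi_gt0 R; lra.
have dM (t : R) : is_derive t 1 (fun t : R => k.+1%:R * t) k.+1%:R.
  rewrite -[X in is_derive _ _ _ X]mulr1.
  exact: (@is_deriveZ _ _ _ id k.+1%:R t 1 1 (is_derive_id _ _)).
split.
- have cf : continuous (fun t : R => 1 + cos (k.+1%:R * t)).
    move=> t; apply: cvgD; first exact: cvg_cst.
    apply: (@continuous_comp _ _ _ (fun t : R => k.+1%:R * t) cos); first exact: cM.
    exact: continuous_cos.
  have dF (t : R) : is_derive t 1 (fun t => t + (k.+1%:R)^-1 * sin (k.+1%:R * t))
      (1 + cos (k.+1%:R * t)).
    have -> : 1 + cos (k.+1%:R * t) = 1 + (k.+1%:R)^-1 * (cos (k.+1%:R * t) * k.+1%:R).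
      by field.
    apply: is_deriveD; apply: is_deriveZ.
  rewrite (integral_antiderivative pi_lt cf dF); congr EFin;
  rewrite mulrN sinN sin_natmul_pi; ring.
- have cf : continuous (fun t : R => 1 - sin (k.+1%:R * t)).
    move=> t; apply: cvgB; first exact: cvg_cst.
    apply: (@continuous_comp _ _ _ (fun t : R => k.+1%:R * t) sin); first exact: cM.
    exact: continuous_sin.
  have dF (t : R) : is_derive t 1 (fun t => t + (k.+1%:R)^-1 * cos (k.+1%:R * t))
      (1 - sin (k.+1%:R * t)).
    have -> : 1 - sin (k.+1%:R * t) = 1 + (k.+1%:R)^-1 * (- sin (k.+1%:R * t) * k.+1%:R).
      by field.
    apply: is_deriveD; apply: is_deriveZ.
  rewrite (integral_antiderivative pi_lt cf dF); congr EFin;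
  rewrite mulrN cosN; ring.
Qed.

Lemma arc_length_setT : (\int[@arc_length R]_u (1%R)%:E = (2 * pi : R)%:E)%E.
Proof.
rewrite (@ge0_integral_arc_length (cst 1)) //=.
have pi_lt : - pi < pi :> R by have := pi_gt0 R; lra.
rewrite (@integral_antiderivative _ (cst 1) id _ _ pi_lt).
- by congr EFin; ring.
- by move=> t; exact: cvg_cst.
Qed.

Lemma circle_moments k :
  \int[@arc_length R]_u (complex.Re ((circle_val u)^*%C ^+ k.+1) * 1) = 0 /\
  \int[@arc_length R]_u (complex.Im ((circle_val u)^*%C ^+ k.+1) * 1) = 0.
Proof.
have [mr mi] := cmeasurableX k.+1 (cmeasurable_conj cmeasurable_circle_val).
have a1 (u : T) : complex.Re ((circle_val u)^*%C ^+ k.+1) ^+ 2 +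
    complex.Im ((circle_val u)^*%C ^+ k.+1) ^+ 2 = 1.
  by have := abs2X (circle_val u)^*%C k.+1; rewrite abs2_conj abs2_circle_val expr1n.
have sqr_le1 (x : R) : x ^+ 2 <= 1 -> `|x| <= 1.
  by move=> h; rewrite ler_norml; apply/andP; split; nra.
have r1 (u : T) : `|complex.Re ((circle_val u)^*%C ^+ k.+1)| <= 1.
  by apply: sqr_le1; rewrite -(a1 u) lerDl sqr_ge0.
have i1 (u : T) : `|complex.Im ((circle_val u)^*%C ^+ k.+1)| <= 1.
  by apply: sqr_le1; rewrite -(a1 u) lerDr sqr_ge0.
have vE (t : R) : (circle_val (circle_expi t))^*%C ^+ k.+1 = expi (- (k.+1%:R * t)).
  rewrite (_ : circle_val _ = expi t)//.
  by rewrite conj_expi expiX mulrN.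
split; apply: (weighted_mean_eq0 (measurable_cst _) (fun=> ler01) arc_length_setT) => //;
  under eq_integral do rewrite mulr1.
- rewrite (@ge0_integral_arc_length (fun u => 1 + complex.Re ((circle_val u)^*%C ^+ k.+1))).
  + under eq_integral do rewrite vE /= cosN.
    exact: (integral_pi_trig k).1.
  + exact: measurable_funD.
  + by move=> u; have := r1 u; rewrite ler_norml => /andP[? _]; lra.
- rewrite (@ge0_integral_arc_length (fun u => 1 + complex.Im ((circle_val u)^*%C ^+ k.+1))).
  + under eq_integral do rewrite vE /= sinN.
    exact: (integral_pi_trig k).2.
  + exact: measurable_funD.
  + by move=> u; have := i1 u; rewrite ler_norml => /andP[? _]; lra.
Qed.

(** On the circle e is w itself, the transform of the Dirac mass at -1. Its squared modulus is 1,
    and the factor is kept to give the form expected by [L2_closure_full]. *)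
Lemma circle_szego (mu : {measure set T -> \bar R}) (s : T -> R) :
  (\int[mu]_u (circle_weight u)%:E < +oo)%E ->
  ac_density (@arc_length R) mu s ->
  log_integral (@arc_length R) circle_weight s = -oo%E ->
  forall h : R, 0 < h -> exists q : {poly R[i]},
  (\int[mu]_u (abs2 (1 + (circle_val u)^*%C * q.[(circle_val u)^*%C]) *
     abs2 (circle_val u)^*%C)%:E < h%:E)%E.
Proof.
move=> imu dens hlog h h0.
have [ms s0 _] := dens.
have w1 (u : T) : abs2 (circle_val u)^*%C = 1 by rewrite abs2_conj abs2_circle_val.
have iarc : (\int[@arc_length R]_u (1%R)%:E < +oo)%E by rewrite arc_length_setT ltry.
have logs := log_integral_neg_log_clamp (ka := circle_weight) (om := fun=> 1) (fun x => ltr01)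
  (fun x => lexx _) (measurable_cst _) (measurable_cst _) ms s0 hlog.
have [q hq] := szego (cmeasurable_conj cmeasurable_circle_val) w1 (fun x => ler01)
  (measurable_cst _) iarc imu circle_moments dens logs circle_generated h0.
exists q; under eq_integral do rewrite [X in _ * X]w1.
exact: hq.
Qed.

End circle_facts.

(** * Interpolation on the lattice *)

Section complex_integral.
Context {R : realType} {d : measure_display} {T : measurableType d}.
Variable mu : {measure set T -> \bar R}.
Implicit Types f g : T -> R[i].

Definition cintegrable f : Prop :=
  mu.-integrable setT (fun x => (complex.Re (f x))%:E) /\
  mu.-integrable setT (fun x => (complex.Im (f x))%:E).

Lemma cintegrableZ c f : cintegrable f -> cintegrable (fun x => c * f x).
Proof.
move=> [ir ii]; split.
- under eq_fun do rewrite cReM EFinB !EFinM.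
  by apply: integrableB => //; exact: integrableZl.
- under eq_fun do rewrite cImM EFinD !EFinM.
  by apply: integrableD => //; exact: integrableZl.
Qed.

Lemma cintegrableD f g : cintegrable f -> cintegrable g ->
  cintegrable (fun x => f x + g x).
Proof.
move=> [fr fi] [gr gi]; split.
- by under eq_fun do rewrite cReD EFinD; exact: integrableD.
- by under eq_fun do rewrite cImD EFinD; exact: integrableD.
Qed.

Lemma cintegralZ c f : cintegrable f -> cintegral mu (fun x => c * f x) = c * cintegral mu f.
Proof.
move=> [ir ii]; apply/eqP; rewrite eq_complex cReM cImM /=.
have zl a h : mu.-integrable setT (fun x => (h x)%:E) ->
    mu.-integrable setT (EFin \o (fun x => a * h x)).
  by move=> /(integrableZl measurableT a).
apply/andP; split; apply/eqP.
- under eq_Rintegral do rewrite cReM.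
  by rewrite RintegralB// ?RintegralZl//; exact: zl.
- under eq_Rintegral do rewrite cImM.
  by rewrite RintegralD// ?RintegralZl//; exact: zl.
Qed.

Lemma cintegralD f g : cintegrable f -> cintegrable g ->
  cintegral mu (fun x => f x + g x) = cintegral mu f + cintegral mu g.
Proof.
move=> [fr fi] [gr gi]; apply/eqP; rewrite eq_complex cReD cImD /=.
apply/andP; split; apply/eqP.
- by under eq_Rintegral do rewrite cReD; rewrite RintegralD.
- by under eq_Rintegral do rewrite cImD; rewrite RintegralD.
Qed.

End complex_integral.

Section second_order_facts.
Context {R : realType} {dO : measure_display} {Omega : measurableType dO}.
Variable P : probability Omega R.
Implicit Type X : Omega -> R[i].

Lemma square_integrable_cintegrable X : square_integrable P X -> cintegrable P X.
Proof.
move=> [mX iX]; have [mr mi] := mX.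
have i1 : (\int[P]_w (1 + abs2 (X w))%:E < +oo)%E.
  under eq_integral do rewrite EFinD.
  rewrite ge0_integralD//=; last 2 first.
  - by move=> x _; rewrite lee_fin abs2_ge0.
  - exact: measurable_abs2E.
  rewrite integral_cst// mul1e lte_add_pinfty//.
  by rewrite (le_lt_trans (probability_le1 _ _))// ltry.
have m1 : measurable_fun setT (fun w => (1 + abs2 (X w))%:E).
  by apply/measurable_EFinP; apply: measurable_funD => //; exact: measurable_abs2.
have le (g : Omega -> R) : measurable_fun setT g -> (forall w, `|g w| <= 1 + abs2 (X w)) ->
    P.-integrable setT (fun w => (g w)%:E).
  move=> mg hg; apply/integrableP; split; first exact/measurable_EFinP.
  apply: le_lt_trans i1; apply: ge0_le_integral => //=.
  - by apply/measurable_EFinP; exact: measurableT_comp.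
  - by move=> w _; rewrite lee_fin.
split; apply: le => // w; [exact: Re_le_abs2|exact: Im_le_abs2].
Qed.

Lemma perfectly_interpolable_of_close (V : Type)
    (test : set V -> (V -> R[i]) -> Prop) (M : (V -> R[i]) -> Omega -> R[i]) (A : set V) :
  (forall f, test (~` A) f -> forall e : R, 0 < e -> exists h, test A h /\
    (\int[P]_w (abs2 (M h w - M f w))%:E < e%:E)%E) ->
  perfectly_interpolable P test M A.
Proof.
move=> H f tf.
have /choice[h hh] : forall n : nat, exists h, test A h /\
    (\int[P]_w (abs2 (M h w - M f w))%:E < (n.+1%:R^-1)%:E)%E.
  by move=> n; apply: H => //; rewrite invr_gt0.
exists h; split; first by move=> n; have [] := hh n.
apply: (@squeeze_cvge _ _ _ _ (cst 0%E) _ (fun n => (n.+1%:R^-1)%:E)).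
- apply: nearW => n; apply/andP; split; last by apply: ltW; have [] := hh n.
  by apply: integral_ge0 => w _; rewrite lee_fin abs2_ge0.
- exact: cvg_cst.
- by apply: cvg_EFin; [exact: nearW|exact: cvg_harmonic].
Qed.

End second_order_facts.

Section finite_support.
Context {R : realType} {V : choiceType}.
Implicit Types c h : V -> R[i].

(** Sums over the support of h are not visibly linear in h, as the index set moves with h. A common
    finite index set repairs this. *)
Lemma fsum_mul_widen c h (D : set V) : finite_set D -> (forall k, h k != 0 -> D k) ->
  \sum_(k \in [set k | h k != 0]) c k * h k = \sum_(k <- fset_set D) c k * h k.
Proof.
move=> fD hD; rewrite (@fsbig_widen _ _ _ _ _ D)//; first exact: fsbig_finite.
move=> k [_ /= /negP]; rewrite negbK => /eqP ->; by rewrite mulr0.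
Qed.

Lemma fsum_mul_linear c a h1 h2 :
  finite_set [set k | h1 k != 0] -> finite_set [set k | h2 k != 0] ->
  \sum_(k \in [set k | a * h1 k + h2 k != 0]) c k * (a * h1 k + h2 k) =
  a * (\sum_(k \in [set k | h1 k != 0]) c k * h1 k) +
  \sum_(k \in [set k | h2 k != 0]) c k * h2 k.
Proof.
move=> f1 f2; set D := [set k | h1 k != 0] `|` [set k | h2 k != 0].
have fD : finite_set D by rewrite finite_setU.
rewrite (@fsum_mul_widen c (fun k => a * h1 k + h2 k) D)//; last first.
  move=> k; apply: contraNP => /not_orP[/= /negP]; rewrite negbK => /eqP ->.
  by move=> /negP; rewrite negbK => /eqP ->; rewrite mulr0 addr0.
rewrite (@fsum_mul_widen c h1 D)//; last by move=> k; left.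
rewrite (@fsum_mul_widen c h2 D)//; last by move=> k; right.
by rewrite mulr_sumr -big_split/=; apply: eq_bigr => k _; ring.
Qed.

End finite_support.

(** * Transforms of finitely supported functions *)

Section lattice_facts.
Context {R : realType} {n : nat}.
Local Notation Zd := (n.-tuple int).
Local Notation Td := (n.-tuple (circle R)).
Implicit Types (h : Zd -> R[i]) (A : set Zd).

Lemma lattice_test_linear A c h1 h2 : lattice_test_function A h1 ->
  lattice_test_function A h2 -> lattice_test_function A (fun k => c * h1 k + h2 k).
Proof.
move=> [f1 s1] [f2 s2].
have sub : [set k | c * h1 k + h2 k != 0] `<=` [set k | h1 k != 0] `|` [set k | h2 k != 0].
  move=> k /=; apply: contraNP => /not_orP[/= /negP]; rewrite negbK => /eqP ->.
  by move=> /negP; rewrite negbK => /eqP ->; rewrite mulr0 addr0.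
split; first by apply: sub_finite_set sub _; rewrite finite_setU.
by move=> k /sub[/s1|/s2].
Qed.

Lemma lattice_test_sub A B h : A `<=` B ->
  lattice_test_function A h -> lattice_test_function B h.
Proof. by move=> AB [fh sh]; split => // k /sh/AB. Qed.

Lemma lattice_fourier_linear c h1 h2 u :
  lattice_test_function setT h1 -> lattice_test_function setT h2 ->
  lattice_fourier (fun k => c * h1 k + h2 k) u =
  c * lattice_fourier h1 u + @lattice_fourier R n h2 u.
Proof. by move=> [f1 _] [f2 _]; exact: fsum_mul_linear. Qed.

Definition lattice_character (k : Zd) (u : Td) : R[i] :=
  \prod_(i < n) circle_val (tnth u i) ^ tnth k i.

Lemma cmeasurable_lattice_character k : cmeasurable (lattice_character k).
Proof.
apply: cmeasurable_prod => i.
have mi : cmeasurable (fun u : Td => circle_val (tnth u i)).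
  exact: (cmeasurable_comp cmeasurable_circle_val (@measurable_tnth _ _ _ i)).
case: (tnth k i) => m; first exact: cmeasurableX.
by apply: cmeasurableV; exact: cmeasurableX.
Qed.

Lemma abs2_lattice_character k u : abs2 (lattice_character k u) = 1.
Proof.
rewrite /lattice_character abs2_prod big1// => i _.
case: (tnth k i) => m; first by rewrite abs2X abs2_circle_val expr1n.
by rewrite NegzE -exprnN abs2V abs2X abs2_circle_val expr1n invr1.
Qed.

Lemma lattice_fourierE h u : finite_set [set k | h k != 0] ->
  lattice_fourier h u = \sum_(k <- fset_set [set k | h k != 0]) lattice_character k u * h k.
Proof. by move=> fh; rewrite /lattice_fourier fsbig_finite. Qed.

Lemma cmeasurable_lattice_fourier h : finite_set [set k | h k != 0] ->
  cmeasurable (lattice_fourier h : Td -> R[i]).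
Proof.
move=> fh; rewrite (_ : lattice_fourier h = fun u : Td =>
    \sum_(k <- fset_set [set k | h k != 0]) lattice_character k u * h k); last first.
  by apply/funext => u; exact: lattice_fourierE.
apply: cmeasurable_sum => k; apply: cmeasurableM; last exact: cmeasurable_cst.
exact: cmeasurable_lattice_character.
Qed.

Lemma sq_norm_lattice_fourier (S : {measure set Td -> \bar R}) h :
  (S setT < +oo)%E -> finite_set [set k | h k != 0] ->
  (sq_norm S (lattice_fourier h) < +oo)%E.
Proof.
move=> ST fh; rewrite (eq_sq_norm S (fun u => lattice_fourierE u fh)).
elim: (fset_set _ : seq _) => [|k s IHs].
  rewrite (eq_sq_norm _ (g := fun=> 0)); last by move=> u; rewrite big_nil.
  by rewrite /sq_norm; under eq_integral do rewrite abs2_0; rewrite integral0.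
rewrite (eq_sq_norm _ (g := fun u => h k * lattice_character k u +
  \sum_(k <- s) lattice_character k u * h k)); last first.
  by move=> u; rewrite big_cons mulrC.
have m1 : cmeasurable (fun u => h k * lattice_character k u).
  by apply: cmeasurableM; [exact: cmeasurable_cst|exact: cmeasurable_lattice_character].
have m2 : cmeasurable (fun u => \sum_(k <- s) lattice_character k u * h k).
  apply: cmeasurable_sum => j; apply: cmeasurableM; last exact: cmeasurable_cst.
  exact: cmeasurable_lattice_character.
apply: (le_lt_trans (sq_normD S m1 m2)).
rewrite lte_add_pinfty//; last by rewrite lte_mul_pinfty// lee_fin.
rewrite lte_mul_pinfty ?lee_fin// sq_normZ; last exact: cmeasurable_lattice_character.
rewrite lte_mul_pinfty ?lee_fin ?abs2_ge0//.
rewrite /sq_norm; under eq_integral do rewrite abs2_lattice_character.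
by rewrite integral_cst// mul1e.
Qed.

Lemma lattice_fourier_delta (m : Zd) (u : Td) :
  lattice_fourier (fun k => (k == m)%:R) u = lattice_character m u.
Proof.
rewrite /lattice_fourier (_ : [set k | _] = [set m]); last first.
  by apply/seteqP; split => k /=; rewrite pnatr_eq0 eqb0 negbK => /eqP.
by rewrite fsbig_set1 eqxx mulr1.
Qed.

Definition shift_coord (i : 'I_n) (z : int) (k : Zd) : Zd :=
  [tuple tnth k j + (if j == i then z else 0) | j < n].

Lemma shift_coordK i z : cancel (shift_coord i z) (shift_coord i (- z)).
Proof.
move=> k; apply: eq_from_tnth => j; rewrite !tnth_mktuple.
by case: eqP => _; rewrite ?addrK ?addr0.
Qed.

Lemma lattice_character_shift i k u :
  (circle_val (tnth u i))^*%C * lattice_character (shift_coord i 1 k) u =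
  lattice_character k u.
Proof.
rewrite /lattice_character (bigD1 i)//= [RHS](bigD1 i)//= mulrA; congr (_ * _).
  rewrite tnth_mktuple eqxx.
  have z0 := unimodular_neq0 (abs2_circle_val (tnth u i)).
  rewrite expfzDr// expr1z mulrCA [_^*%C * _]mulrC.
  by rewrite mul_conj_unimodular ?mulr1 ?abs2_circle_val.
by apply: eq_bigr => j ji; rewrite tnth_mktuple (negbTE ji) addr0.
Qed.

(** Multiplying by the conjugate of u_i lowers the exponent of u_i by one: the support moves by -1
    along coordinate i and so stays in the orthant. This is why w is the conjugate coordinate. *)
Lemma lattice_fourier_shift i h u :
  lattice_fourier (fun k => h (shift_coord i 1 k)) u =
  (circle_val (tnth u i))^*%C * @lattice_fourier R n h u.
Proof.
rewrite /lattice_fourier mulr_fsumr.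
rewrite [RHS](reindex_fsbig (shift_coord i 1) [set k | h (shift_coord i 1 k) != 0]).
  apply: eq_fsbigr => k _; rewrite mulrA; congr (_ * _).
  by rewrite -[LHS](lattice_character_shift i).
split => //=.
- by move=> k k' _ _; exact: (can_inj (shift_coordK i 1)).
- move=> k /= hk; exists (shift_coord i (-1) k) => /=.
    by have := shift_coordK i (-1) k; rewrite opprK => ->.
  by have := shift_coordK i (-1) k; rewrite opprK.
Qed.

End lattice_facts.

Section discrete_case.
Context {R : realType} {n : nat} {dO : measure_display} {Omega : measurableType dO}.
Variable P : probability Omega R.
Local Notation Zd := (n.-tuple int).
Local Notation Td := (n.-tuple (circle R)).
Variable M : Zd -> Omega -> R[i].
Hypothesis wsM : weakly_stationary_field P M.

Lemma field_integral_linear c (h1 h2 : Zd -> R[i]) w :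
  lattice_test_function setT h1 -> lattice_test_function setT h2 ->
  field_integral M (fun k => c * h1 k + h2 k) w =
  c * field_integral M h1 w + field_integral M h2 w.
Proof. by move=> [f1 _] [f2 _]; exact: fsum_mul_linear. Qed.

(** Second moments are then variances, which the spectral measure gives directly. *)
Lemma field_integral_centred (h : Zd -> R[i]) : lattice_test_function setT h ->
  cexpectation P (field_integral M h) = 0.
Proof.
move=> [fh _].
rewrite /cexpectation (_ : field_integral M h =
    fun w => \sum_(k <- fset_set [set k | h k != 0]) h k * M k w); last first.
  apply/funext => w; rewrite /field_integral fsbig_finite//.
  by apply: eq_bigr => k _; rewrite mulrC.
suff : cintegrable P (fun w => \sum_(k <- fset_set [set k | h k != 0]) h k * M k w) /\
    cintegral P (fun w => \sum_(k <- fset_set [set k | h k != 0]) h k * M k w) = 0 by case.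
elim: (fset_set _ : seq _) => [|k s [IHi IH0]].
  split.
    split; under eq_fun do rewrite big_nil; exact: integrable0.
  rewrite /cintegral; under eq_Rintegral do rewrite big_nil.
  under [X in _ +i* X]eq_Rintegral do rewrite big_nil.
  by rewrite Rintegral_cst//= mul0r.
have iM := square_integrable_cintegrable (wsf_square_integrable wsM k).
have ihM := cintegrableZ (h k) iM.
rewrite (_ : (fun w => _) = (fun w => h k * M k w + \sum_(k <- s) h k * M k w)); last first.
  by apply/funext => w; rewrite big_cons.
split; first exact: cintegrableD.
rewrite cintegralD// IH0 addr0 cintegralZ//.
by rewrite [X in _ * X](wsf_centred wsM) mulr0.
Qed.

End discrete_case.

Lemma lattice_interpolation (R : realType) (n : nat)
    (dO : measure_display) (Omega : measurableType dO) (P : probability Omega R)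
    (M : n.-tuple int -> Omega -> R[i])
    (S : {measure set (n.-tuple (circle R)) -> \bar R})
    (S_ : 'I_n -> {sigma_finite_measure set (circle R) -> \bar R})
    (s_ : 'I_n -> circle R -> R) :
  weakly_stationary_field P M ->
  is_lattice_spectral_measure P M S ->
  (forall i, [/\ symmetric_measure circle_conj (S_ i),
                 (\int[S_ i]_u (circle_weight u)%:E < +oo)%E,
                 ac_density (@arc_length R) (S_ i) (s_ i)
               & log_integral (@arc_length R) circle_weight (s_ i) = -oo%E]) ->
  (forall A, measurable A -> (S A <= product_measure S_ A)%E) ->
  perfectly_interpolable P lattice_test_function (field_integral M)
    (@negative_orthant int n).
Proof.
move=> wsM [_ spec] hS leS; apply: perfectly_interpolable_of_close => f tf e e0.
set A := @negative_orthant int n.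
have tfT : lattice_test_function setT f := lattice_test_sub (@subsetT _ _) tf.
pose w (u : circle R) := (circle_val u)^*%C.
have w1 u : abs2 (w u) = 1 by rewrite abs2_conj abs2_circle_val.
have mw : cmeasurable w := cmeasurable_conj cmeasurable_circle_val.
have iS i : (sq_norm (S_ i) w < +oo)%E.
  have [_ h _ _] := hS i; rewrite /sq_norm; under eq_integral do rewrite w1.
  exact: h.
have szegoS i (h : R) : 0 < h -> exists q : {poly R[i]},
    (\int[S_ i]_u (abs2 (1 + w u * q.[w u]) * abs2 (w u))%:E < h%:E)%E.
  by move=> h0; have [_ hi dens hlog] := hS i; exact: (circle_szego hi dens hlog).
pose DD (D : n.-tuple (circle R) -> R[i]) := exists h, lattice_test_function A h /\
  D = lattice_fourier h.
have toT h : lattice_test_function A h -> lattice_test_function setT h.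
  exact: lattice_test_sub (@subsetT _ _).
have DDm D : DD D -> cmeasurable D.
  by move=> [h [[fh _] ->]]; exact: cmeasurable_lattice_fourier.
have DDl c D1 D2 : DD D1 -> DD D2 -> DD (fun u => c * D1 u + D2 u).
  move=> [h1 [t1 ->]] [h2 [t2 ->]]; exists (fun k => c * h1 k + h2 k); split.
    exact: lattice_test_linear.
  by apply/funext => u; rewrite lattice_fourier_linear//; exact: toT.
have DDE : DD (tensor_power w).
  exists (fun k => (k == [tuple (-1 : int) | _ < n])%:R); split.
    split.
      rewrite (_ : [set k | _] = [set [tuple (-1 : int) | _ < n]]); first exact: finite_set1.
      by apply/seteqP; split => k /=; rewrite pnatr_eq0 eqb0 negbK => /eqP.
    by move=> k; rewrite pnatr_eq0 eqb0 negbK => /eqP -> i; rewrite tnth_mktuple.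
  apply/funext => u; rewrite lattice_fourier_delta; apply: eq_bigr => i _.
  rewrite tnth_mktuple; have h := abs2_circle_val (tnth u i).
  have z0 := unimodular_neq0 h; apply: (mulfI z0).
  by rewrite mul_conj_unimodular// mulfV.
have DDw D i (h : R) : DD D -> 0 < h -> exists D', DD D' /\
    (sq_norm S (fun u => w (tnth u i) * D u - D' u)%R < h%:E)%E.
  move=> [k [[fk sk] ->]] h0; exists (fun u => w (tnth u i) * lattice_fourier k u); split.
    exists (fun m => k (shift_coord i 1 m)); split.
      split.
        have := finite_image (shift_coord i (-1)) fk; apply: sub_finite_set.
        by move=> m /= km; exists (shift_coord i 1 m) => //; exact: shift_coordK.
      move=> m /sk hm j; have := hm j; rewrite tnth_mktuple.
      by apply: le_lt_trans; rewrite lerDl; case: ifP.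
    by apply/funext => u; rewrite lattice_fourier_shift.
  rewrite (eq_sq_norm _ (g := fun=> 0)); last by move=> u; rewrite subrr.
  by rewrite /sq_norm; under eq_integral do rewrite abs2_0; rewrite integral0 lte_fin.
(* The weight is 1 on the circle, so every [S_ i] is finite, and with them [S]. *)
have ST : (S setT < +oo)%E.
  rewrite (le_lt_trans (leS _ measurableT))//.
  have := ge0_integral_product_measure S_ (f := fun i x => 1)
    (fun i => measurable_cst _) (fun i x => ler01).
  under eq_integral do rewrite big1//.
  rewrite integral_cst// mul1e => ->.
  have fS j : (\int[S_ j]_u (1%R)%:E)%E \is a fin_num.
    rewrite ge0_fin_numE; first by have [_ h _ _] := hS j; exact: h.
    by apply: integral_ge0.
  rewrite (eq_bigr (fun j => (fine (\int[S_ j]_u (1%R)%:E))%:E)); last first.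
    by move=> j _; rewrite (fineK (fS j)).
  by rewrite prodEFin ltry.
have mf : cmeasurable (lattice_fourier f : n.-tuple (circle R) -> R[i]).
  by apply: cmeasurable_lattice_fourier; case: tfT.
have i_f : (sq_norm S (lattice_fourier f) < +oo)%E.
  by apply: sq_norm_lattice_fourier => //; case: tfT.
have wn0 u : w u != 0 by exact: unimodular_neq0.
have pin : 0 < (2 * pi) ^+ n :> R by rewrite exprn_gt0// mulr_gt0// pi_gt0.
(* The factor (2 pi)^n in the precision compensates the normalization of the spectral formula. *)
have [_ [[h [th ->]] hlt]] := L2_closure_full mw w1 mw wn0 (@circle_generated R) iS szegoS
  leS DDm DDl DDE DDw mf i_f (mulr_gt0 pin e0).
exists h; split => //.
have tg : lattice_test_function setT (fun k => -1 * h k + f k).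
  by apply: lattice_test_linear => //; exact: toT.
have gE w' : field_integral M h w' - field_integral M f w' =
    - (field_integral M (fun k => -1 * h k + f k) w').
  by rewrite (field_integral_linear M)//; [ring|exact: toT].
under eq_integral do rewrite gE abs2N.
have -> : (\int[P]_x (abs2 (field_integral M (fun k => -1 * h k + f k)%R x))%:E)%E =
    cvariance P (field_integral M (fun k => -1 * h k + f k)).
  apply: eq_integral => x _; rewrite (field_integral_centred wsM tg).
  by congr (abs2 _)%:E; rewrite subr0.
rewrite (spec _ tg).
have fE : (\int[S]_u (abs2 (lattice_fourier (fun k => -1 * h k + f k)%R u))%:E)%E =
    sq_norm S (fun u => lattice_fourier f u - lattice_fourier h u)%R.
  apply: eq_integral => u _; rewrite lattice_fourier_linear//; last exact: toT.
  by rewrite mulN1r addrC.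
rewrite fE.
have -> : e%:E = (((2 * pi) ^- n)%:E * ((2 * pi) ^+ n * e)%:E)%E.
  by rewrite -EFinM mulrA mulVf ?mul1r// gt_eqF.
by rewrite lte_pmul2l ?lte_fin ?invr_gt0.
Qed.

(** * The line *)

Section cayley.
Context {R : realType}.
Local Notation T := (measurableTypeR R).

(* The Fourier transform of [exp] restricted to the negative half-line. *)
Definition resolvent (u : T) : R[i] := (1 -i* u)^-1.

(** This is (1 + i u) / (1 - i u), from the line to the circle without -1. It is written as an
    affine function of the resolvent because multiplication by the resolvent is what translations
    approximate. *)
Definition cayley (u : T) : R[i] := 2 * resolvent u - 1.

(** Half the arc length pulled back by [cayley]. It is comparable to [real_weight], and the positive
    powers of [cayley] integrate to 0 against it. *)
Definition cauchy_weight (u : T) : R := (1 + u ^+ 2)^-1.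

Lemma sqr1D_gt0 (u : R) : 0 < 1 + u ^+ 2.
Proof. by rewrite ltr_wpDr// sqr_ge0. Qed.

Lemma abs2_1Bi (u : R) : abs2 (1 -i* u) = 1 + u ^+ 2.
Proof. by rewrite /abs2 /= expr1n sqrrN. Qed.

Lemma abs2_resolvent u : abs2 (resolvent u) = cauchy_weight u.
Proof. by rewrite /resolvent abs2V abs2_1Bi. Qed.

Lemma resolventE u : resolvent u = cauchy_weight u +i* (u * cauchy_weight u).
Proof.
have h := gt_eqF (sqr1D_gt0 u).
have z0 : (1 -i* u : R[i]) != 0 by rewrite -abs2_eq0 abs2_1Bi h.
apply: (mulfI z0); rewrite mulfV//; apply/esym/eqP; rewrite eq_complex cReM cImM /=.
by rewrite /cauchy_weight; apply/andP; split; apply/eqP; field; rewrite h.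
Qed.

Lemma cayleyE u : cayley u = expi (2 * atan u).
Proof.
have h := gt_eqF (sqr1D_gt0 u).
have c2 : cos (atan u) ^+ 2 = cauchy_weight u.
  by rewrite cos_atan exprVn sqr_sqrtr// ltW// sqr1D_gt0.
have cn0 : cos (atan u) != 0.
  by rewrite -sqrf_eq0 c2 invr_eq0 h.
have sE : sin (atan u) = u * cos (atan u).
  by rewrite -{2}(atanK u) /tan divfK.
rewrite /cayley resolventE; apply/eqP; rewrite eq_complex cReD cImD cReM cImM /=.
have -> : cos (2 * atan u) = 2 * cauchy_weight u - 1.
  by rewrite mulr_natl cos_mulr2n c2 mulr_natl.
have -> : sin (2 * atan u) = 2 * (u * cauchy_weight u).
  by rewrite mulr_natl sin_mulr2n sE -c2; ring.
by apply/andP; split; apply/eqP; ring.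
Qed.

Lemma abs2_cayley u : abs2 (cayley u) = 1.
Proof. by rewrite cayleyE abs2_expi. Qed.

Lemma continuous_cauchy_weight : continuous (cauchy_weight : R -> R).
Proof. exact: continuous_oneDsqrV. Qed.

Lemma measurable_cauchy_weight : measurable_fun setT cauchy_weight.
Proof. exact: (measurable_realfun.continuous_measurable_fun continuous_cauchy_weight). Qed.

Lemma cauchy_weight_gt0 u : 0 < cauchy_weight u.
Proof. by rewrite invr_gt0 sqr1D_gt0. Qed.

Lemma cmeasurable_resolvent : cmeasurable resolvent.
Proof.
apply: cmeasurableV; split => /=; first exact: measurable_cst.
by apply: measurableT_comp => //; exact: measurable_id.
Qed.

Lemma cmeasurable_cayley : cmeasurable cayley.
Proof.
apply: cmeasurableB; last exact: cmeasurable_cst.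
by apply: cmeasurableM; [exact: cmeasurable_cst|exact: cmeasurable_resolvent].
Qed.

(** The chord from -1 to [cayley u] has slope u, so u < c reads Im < c (1 + Re). *)
Lemma cayley_generated (G : set (set T)) : sigma_algebra setT G ->
  (forall a b c : R, G [set u | a * complex.Re (cayley u) + b * complex.Im (cayley u) < c]) ->
  measurable `<=` G.
Proof.
move=> sG hG; apply: measurable_sub_rays => // c.
rewrite (_ : [set _ | _] = [set u : T | - c * complex.Re (cayley u) +
  1 * complex.Im (cayley u) < c])//.
apply/seteqP.
have E (u : T) : (- c * complex.Re (cayley u) + 1 * complex.Im (cayley u) < c) = ((u : R) < c).
  rewrite /cayley resolventE cReD cImD cReM cImM /=.
  rewrite -subr_lt0 (_ : _ - c = 2 * (u - c) * cauchy_weight u); last by ring.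
  by rewrite pmulr_llt0 ?cauchy_weight_gt0// pmulr_rlt0// subr_lt0.
by split => u /=; rewrite E.
Qed.

Lemma ge0_integral_line (f F : R -> R) (l : R) : continuous f -> (forall x, 0 <= f x) ->
  (forall x : R, is_derive x 1 F (f x)) ->
  (fun n => F n.+1%:R - F (- n.+1%:R)) @ \oo --> l ->
  (\int[@lebesgue_measure R]_x (f x)%:E = l%:E)%E.
Proof.
move=> cf f0 dF Fl.
pose I (n : nat) : set R := `[(- n.+1%:R), n.+1%:R]%classic.
have IT : \bigcup_n I n = setT.
  apply/seteqP; split => // x _; exists (Num.truncn `|x|) => //.
  rewrite /I /= in_itv /= -ler_norml ltW//.
  exact: truncnS_gt.
have mf : measurable_fun setT (EFin \o f).
  by apply/measurable_EFinP; exact: (measurable_realfun.continuous_measurable_fun cf).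
have := @ge0_nondecreasing_set_cvg_integral _ T R I (EFin \o f) lebesgue_measure.
rewrite IT => h.
have {}h : (\int[@lebesgue_measure R]_(x in I n) (f x)%:E)%E @[n --> \oo] -->
    (\int[@lebesgue_measure R]_x (f x)%:E)%E.
  apply: h => //.
  - apply/nondecreasing_seqP => n; rewrite subsetEset => x.
    rewrite /I /= !in_itv /= => /andP[h1 h2]; apply/andP; split.
      by rewrite (le_trans _ h1)// lerN2 ler_nat.
    by rewrite (le_trans h2)// ler_nat.
  - by move=> n; exact: measurable_itv.
  - by move=> n; exact: measurable_funTS.
  - by move=> n x _; rewrite /= lee_fin.
have E n : (\int[@lebesgue_measure R]_(x in I n) (f x)%:E = (F n.+1%:R - F (- n.+1%:R))%:E)%E.
  apply: integral_antiderivative => //.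
  have : 0 < n.+1%:R :> R by rewrite ltr0n.
  by move: (n.+1%:R) => y y0; lra.
rewrite (funext E) in h.
by apply: (cvg_unique _ h) => //; apply: cvg_EFin => //; exact: nearW.
Qed.

Let atan_cvg : (fun n => atan n.+1%:R : R) @ \oo --> (pi / 2 : R).
Proof.
have nS : (fun n => n.+1%:R : R) @ \oo --> +oo.
  by rewrite (cvg_shiftS (fun n => n%:R : R)); exact: cvgr_idn.
exact: (cvg_comp _ _ nS (@cvgy_atan R)).
Qed.

Let atan_diff : (fun n => atan n.+1%:R - atan (- n.+1%:R) : R) @ \oo --> (pi : R).
Proof.
have h := atan_cvg.
rewrite (_ : (fun n => _) = (fun n => atan n.+1%:R + atan n.+1%:R)); last first.
  by apply/funext => n; rewrite atanN opprK.
by rewrite [X in _ --> X](_ : _ = pi / 2 + pi / 2); [exact: cvgD|lra].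
Qed.

Lemma integral_cauchy_weight :
  (\int[@lebesgue_measure R]_u (cauchy_weight u)%:E = (pi : R)%:E)%E.
Proof.
apply: (@ge0_integral_line _ (@atan R)) => //.
- exact: continuous_cauchy_weight.
- by move=> x; rewrite ltW// cauchy_weight_gt0.
Qed.

Let cA (m : R) : continuous (fun u : R => m * atan u).
Proof.
move=> u; apply: cvgM; first exact: cvg_cst.
exact: continuous_atan.
Qed.

Let dA (m u : R) : is_derive u 1 (fun u : R => m * atan u) (m * cauchy_weight u).
Proof. exact: (@is_deriveZ _ _ _ (@atan R) m u 1 _ (is_derive1_atan u)). Qed.

(** The substitution t = atan u turns this into a trigonometric integral. The boundary terms sin((k
    + 1) pi) vanish. *)
Let moment_re k : (\int[@lebesgue_measure R]_u
  ((1 + cos (2 * k.+1%:R * atan u)) * cauchy_weight u)%:E = (pi : R)%:E)%E.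
Proof.
set m : R := 2 * k.+1%:R.
have m0 : m != 0 by rewrite mulf_neq0// pnatr_eq0.
apply: (@ge0_integral_line _ (fun u => atan u + m^-1 * sin (m * atan u))).
- move=> u; apply: cvgM; last exact: continuous_cauchy_weight.
  apply: cvgD; first exact: cvg_cst.
  apply: (@continuous_comp _ _ _ (fun u : R => m * atan u) cos); first exact: cA.
  exact: continuous_cos.
- by move=> u; rewrite mulr_ge0 ?(ltW (cauchy_weight_gt0 u)).
- move=> u; have dm := dA m u.
  have -> : (1 + cos (m * atan u)) * cauchy_weight u =
      (1 + u ^+ 2)^-1 + m^-1 * (cos (m * atan u) * (m * cauchy_weight u)).
    by rewrite -/(cauchy_weight u); field.
  by apply: is_deriveD; apply: is_deriveZ.
- rewrite (_ : (fun n => _) = (fun n => (atan n.+1%:R - atan (- n.+1%:R)) +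
      2 * m^-1 * sin (m * atan n.+1%:R))); last first.
    by apply/funext => n; rewrite atanN mulrN sinN; ring.
  rewrite [X in _ --> X](_ : _ = pi + 2 * m^-1 * sin (m * (pi / 2))); last first.
    have -> : m * (pi / 2) = k.+1%:R * pi by rewrite /m; field.
    by rewrite sin_natmul_pi mulr0 addr0.
  apply: cvgD; first exact: atan_diff.
  have cG : {for pi / 2, continuous (fun y : R => 2 * m^-1 * sin (m * y))}.
    apply: cvgM; first exact: cvg_cst.
    apply: (@continuous_comp _ _ _ (fun y : R => m * y) sin); last exact: continuous_sin.
    by apply: cvgM; first exact: cvg_cst.
  exact: (continuous_cvg _ cG atan_cvg).
Qed.

Let moment_im k : (\int[@lebesgue_measure R]_u
  ((1 + sin (2 * k.+1%:R * atan u)) * cauchy_weight u)%:E = (pi : R)%:E)%E.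
Proof.
set m : R := 2 * k.+1%:R.
have m0 : m != 0 by rewrite mulf_neq0// pnatr_eq0.
apply: (@ge0_integral_line _ (fun u => atan u + (- m^-1) * cos (m * atan u))).
- move=> u; apply: cvgM; last exact: continuous_cauchy_weight.
  apply: cvgD; first exact: cvg_cst.
  apply: (@continuous_comp _ _ _ (fun u : R => m * atan u) sin); first exact: cA.
  exact: continuous_sin.
- by move=> u; rewrite mulr_ge0 ?(ltW (cauchy_weight_gt0 u)).
- move=> u; have dm := dA m u.
  have -> : (1 + sin (m * atan u)) * cauchy_weight u =
      (1 + u ^+ 2)^-1 + (- m^-1) * (- sin (m * atan u) * (m * cauchy_weight u)).
    by rewrite -/(cauchy_weight u); field.
  by apply: is_deriveD; apply: is_deriveZ.
- rewrite (_ : (fun n => _) = (fun n => atan n.+1%:R - atan (- n.+1%:R))); last first.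
    by apply/funext => n; rewrite atanN mulrN cosN; ring.
  exact: atan_diff.
Qed.

Lemma cayley_moments k :
  \int[@lebesgue_measure R]_u (complex.Re (cayley u ^+ k.+1) * cauchy_weight u) = 0 /\
  \int[@lebesgue_measure R]_u (complex.Im (cayley u ^+ k.+1) * cauchy_weight u) = 0.
Proof.
have [mr mi] := cmeasurableX k.+1 cmeasurable_cayley.
have vE u : cayley u ^+ k.+1 = expi (2 * k.+1%:R * atan u).
  by rewrite cayleyE expiX; congr expi; ring.
have w0 u := ltW (cauchy_weight_gt0 u).
split; apply: (weighted_mean_eq0 measurable_cauchy_weight w0 integral_cauchy_weight) => //.
- move=> u; rewrite vE /=; have := cos_le1 (2 * k.+1%:R * atan u).
  by have := cos_geN1 (2 * k.+1%:R * atan u); rewrite ler_norml => -> ->.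
- by under eq_integral do rewrite vE; exact: moment_re.
- move=> u; rewrite vE /=; have := sin_le1 (2 * k.+1%:R * atan u).
  by have := sin_geN1 (2 * k.+1%:R * atan u); rewrite ler_norml => -> ->.
- by under eq_integral do rewrite vE; exact: moment_im.
Qed.

Lemma real_weight_le_cauchy u : real_weight u <= cauchy_weight u <= 2 * real_weight u.
Proof.
have h1 := sqr1D_gt0 u; have h2 : 0 < (1 + `|u|) ^+ 2 by rewrite exprn_gt0// ltr_wpDr.
have un := normr_ge0 u; have u2 := real_normK (num_real u).
rewrite /real_weight /cauchy_weight; apply/andP; split.
  by rewrite lef_pV2 ?posrE// -u2 sqrrD expr1n mul1r; nra.
rewrite ler_pdivlMr// mulrC ler_pdivrMr// -u2.
by have := sqr_ge0 (1 - `|u|); nra.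
Qed.

Lemma measurable_real_weight : measurable_fun setT (@real_weight R).
Proof.
rewrite (_ : @real_weight R = fun u => abs2 ((1 + `|u|)%:C)^-1).
  apply: measurable_abs2; apply: cmeasurableV; apply: cmeasurable_real.
  by apply: measurable_funD => //; exact: measurableT_comp.
by apply/funext => u; rewrite abs2V abs2_real.
Qed.

(* The Fourier transform of [exp] restricted to [-1, 0[. *)
Definition cut_resolvent (u : T) : R[i] := (1 - (expR (-1))%:C * expi u) * resolvent u.

Lemma cmeasurable_cut_resolvent : cmeasurable cut_resolvent.
Proof.
apply: cmeasurableM; last exact: cmeasurable_resolvent.
apply: cmeasurableB; first exact: cmeasurable_cst.
by apply: cmeasurableM; [exact: cmeasurable_cst|exact: cmeasurable_expi].
Qed.

Let expRN1 : expR (-1) < 1 :> R.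
Proof. by rewrite expR_lt1; lra. Qed.

(** The modulus of exp(-1 + i u) is below 1, so the truncation introduces no zero and division by
    the transform remains possible. *)
Lemma cut_resolvent_neq0 u : cut_resolvent u != 0.
Proof.
rewrite mulf_neq0//; last by rewrite -abs2_eq0 abs2_resolvent gt_eqF// cauchy_weight_gt0.
rewrite subr_eq0; apply/eqP => /(congr1 abs2).
rewrite abs2_1 abs2M abs2_real abs2_expi mulr1 => h.
have := expR_gt0 (-1 : R); have := expRN1; move: h; set x := expR _; nra.
Qed.

Lemma abs2_cut_resolvent u : abs2 (cut_resolvent u) <= 4 * cauchy_weight u.
Proof.
rewrite abs2M abs2_resolvent ler_wpM2r ?(ltW (cauchy_weight_gt0 u))//.
rewrite (le_trans (abs2B _ _))// abs2_1 abs2M abs2_real abs2_expi mulr1.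
have := expR_gt0 (-1 : R); have := expRN1; set x := expR _; nra.
Qed.

Lemma cut_resolvent_integrable (mu : {measure set T -> \bar R}) :
  (\int[mu]_u (real_weight u)%:E < +oo)%E -> (sq_norm mu cut_resolvent < +oo)%E.
Proof.
move=> imu; apply: (@le_lt_trans _ _ (\int[mu]_u (8%:E * (real_weight u)%:E))%E).
  apply: ge0_le_integral => //.
  - by move=> u _; rewrite lee_fin abs2_ge0.
  - exact: measurable_abs2E cmeasurable_cut_resolvent.
  - by apply/measurable_EFinP; apply: measurable_funM => //; exact: measurable_real_weight.
  - move=> u _; rewrite lee_fin (le_trans (abs2_cut_resolvent u))//.
    by have /andP[_] := real_weight_le_cauchy u; lra.
rewrite ge0_integralZl//.
- by rewrite lte_mul_pinfty// lee_fin.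
- by apply/measurable_EFinP; exact: measurable_real_weight.
- by move=> u _; rewrite lee_fin /real_weight invr_ge0 exprn_ge0.
Qed.

(** [szego] is applied with [cauchy_weight], for which the moments vanish. The hypotheses, stated
    for [real_weight], transfer because each weight is at most a constant times the other. The
    quarter of h pays for [abs2_cut_resolvent]. *)
Lemma line_szego (mu : {measure set T -> \bar R}) (s : T -> R) :
  (\int[mu]_u (real_weight u)%:E < +oo)%E ->
  ac_density (@lebesgue_measure R) mu s ->
  log_integral (@lebesgue_measure R) (@real_weight R) s = -oo%E ->
  forall h : R, 0 < h -> exists q : {poly R[i]},
  (\int[mu]_u (abs2 (1 + cayley u * q.[cayley u]) * abs2 (cut_resolvent u))%:E < h%:E)%E.
Proof.
move=> imu dens hlog h h0.
have [ms s0 _] := dens.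
have cw0 u : 0 <= cauchy_weight u by rewrite ltW// cauchy_weight_gt0.
have icw : (\int[@lebesgue_measure R]_u (cauchy_weight u)%:E < +oo)%E.
  by rewrite integral_cauchy_weight ltry.
have imu' : (\int[mu]_u (cauchy_weight u)%:E < +oo)%E.
  apply: (@le_lt_trans _ _ (\int[mu]_u (2%:E * (real_weight u)%:E))%E).
    apply: ge0_le_integral => //.
    - by move=> u _; rewrite lee_fin.
    - by apply/measurable_EFinP; exact: measurable_cauchy_weight.
    - by apply/measurable_EFinP; apply: measurable_funM => //; exact: measurable_real_weight.
    - by move=> u _; rewrite lee_fin; have /andP[] := real_weight_le_cauchy u.
  rewrite ge0_integralZl//.
  - by rewrite lte_mul_pinfty// lee_fin.
  - by apply/measurable_EFinP; exact: measurable_real_weight.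
  - by move=> u _; rewrite lee_fin /real_weight invr_ge0 exprn_ge0.
have rw0 (u : T) : 0 < real_weight u by rewrite invr_gt0 exprn_gt0// ltr_wpDr.
have rwc u : real_weight u <= cauchy_weight u by have /andP[] := real_weight_le_cauchy u.
have logs := log_integral_neg_log_clamp rw0 rwc measurable_real_weight
  measurable_cauchy_weight ms s0 hlog.
have h40 : 0 < h / 4 by rewrite divr_gt0.
have [q hq] := szego cmeasurable_cayley abs2_cayley cw0
  measurable_cauchy_weight icw imu' cayley_moments dens logs cayley_generated h40.
exists q.
have mq : measurable_fun setT (fun u => abs2 (1 + cayley u * q.[cayley u])).
  apply: measurable_abs2; apply: cmeasurableD; first exact: cmeasurable_cst.
  apply: cmeasurableM; first exact: cmeasurable_cayley.
  exact: cmeasurable_horner cmeasurable_cayley.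
apply: (@le_lt_trans _ _ (\int[mu]_u (4%:E *
    (abs2 (1 + cayley u * q.[cayley u]) * cauchy_weight u)%:E))%E).
  apply: ge0_le_integral => //.
  - by move=> u _; rewrite lee_fin mulr_ge0// abs2_ge0.
  - apply/measurable_EFinP; apply: measurable_funM => //.
    exact: measurable_abs2 cmeasurable_cut_resolvent.
  - apply/measurable_EFinP; apply: measurable_funM => //; apply: measurable_funM => //.
    exact: measurable_cauchy_weight.
  - move=> u _; rewrite lee_fin mulrCA ler_wpM2l ?abs2_ge0//.
    exact: abs2_cut_resolvent.
rewrite ge0_integralZl//.
- have -> : h%:E = (4%:E * (h / 4)%:E)%E by rewrite -EFinM; congr EFin; lra.
  by rewrite lte_pmul2l ?lte_fin.
- apply/measurable_EFinP; apply: measurable_funM => //; exact: measurable_cauchy_weight.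
- by move=> u _; rewrite lee_fin mulr_ge0// abs2_ge0.
Qed.

End cayley.

(** * Product measures and translations *)

Section product_complex_integral.
Context {R : realType} {d1 d2 : measure_display} {T1 : measurableType d1}
  {T2 : measurableType d2}.
Variables (m1 : {sigma_finite_measure set T1 -> \bar R})
  (m2 : {sigma_finite_measure set T2 -> \bar R}).

Lemma integrable_product (f : T1 -> R) (g : T2 -> R) :
  m1.-integrable setT (EFin \o f) -> m2.-integrable setT (EFin \o g) ->
  (m1 \x m2)%E.-integrable setT (fun p => (f p.1 * g p.2)%:E).
Proof.
move=> /integrableP[mf ifoo] /integrableP[mg igoo].
have mf' : measurable_fun setT f by exact/measurable_EFinP.
have mg' : measurable_fun setT g by exact/measurable_EFinP.
apply/integrable12ltyP.
  by apply/measurable_EFinP; apply: measurable_funM; exact: measurableT_comp.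
have nn : (0 <= \int[m2]_y `|(g y)%:E|)%E by exact: integral_ge0.
rewrite (@eq_integral _ _ _ m1 _ (fun x => `|(f x)%:E| * \int[m2]_y `|(g y)%:E|)%E).
  rewrite ge0_integralZr//; last by apply: measurableT_comp.
  by rewrite lte_mul_pinfty// ?integral_ge0// ge0_fin_numE// integral_ge0.
move=> x _; rewrite -ge0_integralZl//; last by apply: measurableT_comp.
by apply: eq_integral => y _; rewrite /= normrM EFinM.
Qed.

Lemma Rintegral_product (f : T1 -> R) (g : T2 -> R) :
  m1.-integrable setT (EFin \o f) -> m2.-integrable setT (EFin \o g) ->
  \int[(m1 \x m2)%E]_p (f p.1 * g p.2) = (\int[m1]_x f x) * (\int[m2]_y g y).
Proof.
move=> if_ ig; have ifg := integrable_product if_ ig.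
rewrite /Rintegral -(integral12_prod_meas1 ifg).
have gfin := integrable_fin_num measurableT ig.
have -> : (\int[m1]_x fubini_F m2 (fun p => (f p.1 * g p.2)%:E) x =
    \int[m1]_x ((f x)%:E * \int[m2]_y (g y)%:E))%E.
  apply: eq_integral => x _; rewrite /fubini_F /=; under eq_integral do rewrite EFinM.
  by rewrite integralZl.
rewrite -(fineK gfin) integralZr// fineM//.
exact: (integrable_fin_num measurableT if_).
Qed.

Lemma cintegrable_product (f : T1 -> R[i]) (g : T2 -> R[i]) :
  cintegrable m1 f -> cintegrable m2 g ->
  cintegrable (m1 \x m2)%E (fun p => f p.1 * g p.2).
Proof.
move=> [fr fi] [gr gi]; split.
- under eq_fun do rewrite cReM EFinB.
  by apply: integrableB => //; [exact: (integrable_product fr gr)|exact: (integrable_product fi gi)].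
- under eq_fun do rewrite cImM EFinD.
  by apply: integrableD => //; [exact: (integrable_product fr gi)|exact: (integrable_product fi gr)].
Qed.

Lemma cintegral_product (f : T1 -> R[i]) (g : T2 -> R[i]) :
  cintegrable m1 f -> cintegrable m2 g ->
  cintegral (m1 \x m2)%E (fun p => f p.1 * g p.2) = cintegral m1 f * cintegral m2 g.
Proof.
move=> [fr fi] [gr gi]; apply/eqP; rewrite eq_complex cReM cImM /=.
apply/andP; split; apply/eqP.
- rewrite (@eq_Rintegral _ _ _ _ _ (fun p => complex.Re (f p.1) * complex.Re (g p.2) -
    complex.Im (f p.1) * complex.Im (g p.2))); last by move=> p _; rewrite cReM.
  rewrite RintegralB//; [|exact: (integrable_product fr gr)|exact: (integrable_product fi gi)].
  by rewrite (Rintegral_product fr gr) (Rintegral_product fi gi).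
- rewrite (@eq_Rintegral _ _ _ _ _ (fun p => complex.Re (f p.1) * complex.Im (g p.2) +
    complex.Im (f p.1) * complex.Re (g p.2))); last by move=> p _; rewrite cImM.
  rewrite RintegralD//; [|exact: (integrable_product fr gi)|exact: (integrable_product fi gr)].
  by rewrite (Rintegral_product fr gi) (Rintegral_product fi gr).
Qed.

End product_complex_integral.

Section tuple_integral.
Context {R : realType} {dT : measure_display} {T : measurableType dT}.

Lemma cons_measure_pushforward n (m1 : {sigma_finite_measure set T -> \bar R})
    (m2 : {sigma_finite_measure set (n.-tuple T) -> \bar R}) (f : n.+1.-tuple T -> \bar R) :
  (m1 \x m2)%E.-integrable setT (f \o @tuple_cons _ T n) -> measurable_fun setT f ->
  (cons_measure m1 m2).-integrable setT f /\
  (\int[cons_measure m1 m2]_x f x = \int[(m1 \x m2)%E]_p f (tuple_cons p))%E.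
Proof.
move=> ifc mf; have mc := @measurable_tuple_cons _ T n.
split.
  have := @integrable_pushforward _ _ _ _ _ _ mc _ setT f mf ifc measurableT.
  by move=> /integrableP[_ h]; apply/integrableP; split.
exact: (@integral_pushforward _ _ _ _ _ _ mc _ setT f mf ifc measurableT).
Qed.

Lemma cintegral_tensor n (m : 'I_n -> {sigma_finite_measure set T -> \bar R})
    (f : 'I_n -> T -> R[i]) :
  (forall i, cmeasurable (f i)) -> (forall i, cintegrable (m i) (f i)) ->
  cintegrable (product_measure m) (fun x => \prod_(i < n) f i (tnth x i)) /\
  cintegral (product_measure m) (fun x => \prod_(i < n) f i (tnth x i)) =
    \prod_(i < n) cintegral (m i) (f i).
Proof.
elim: n m f => [|n IHn] m f mf fi.
  rewrite big_ord0.
  have E : (fun x : 0.-tuple T => \prod_(i < 0) f i (tnth x i)) = fun=> 1.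
    by apply/funext => x; rewrite big_ord0.
  rewrite E /=; split.
    split => /=; apply/integrableP; split => //=.
      under eq_integral do rewrite normr1.
      by rewrite integral_dirac//= diracT mul1e ltry.
    under eq_integral do rewrite normr0.
    by rewrite integral0.
  by rewrite /cintegral /= !Rintegral_cst//= indicT mul0r mul1r.
have [IH1 IH2] := IHn (fun i => m (lift ord0 i)) (fun i => f (lift ord0 i))
  (fun i => mf _) (fun i => fi _).
rewrite big_ord_recl -IH2.
set G := (fun x : n.-tuple T => \prod_(i < n) f (lift ord0 i) (tnth x i)).
have FE p : \prod_(i < n.+1) f i (tnth (@tuple_cons _ T n p) i) = f ord0 p.1 * G p.2.
  case: p => a t; rewrite big_ord_recl; congr (_ * _).
  by apply: eq_bigr => i _; rewrite /tuple_cons/= (tnth_nth a)/= -tnth_nth.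
have [pr pi] := cintegrable_product (fi ord0) IH1.
have [mr mi] : cmeasurable (fun x : n.+1.-tuple T => \prod_(i < n.+1) f i (tnth x i)).
  by apply: cmeasurable_prod => i; exact: (cmeasurable_comp (mf i) (@measurable_tnth _ _ _ i)).
pose m' := product_measure (fun i => m (lift ord0 i)).
have pr' : (m ord0 \x m')%E.-integrable setT
    ((fun x => (complex.Re (\prod_(i < n.+1) f i (tnth x i)))%:E) \o @tuple_cons _ T n).
  rewrite (_ : _ \o _ = fun p => (complex.Re (f ord0 p.1 * G p.2))%:E)//.
  by apply/funext => p /=; rewrite FE.
have pi' : (m ord0 \x m')%E.-integrable setT
    ((fun x => (complex.Im (\prod_(i < n.+1) f i (tnth x i)))%:E) \o @tuple_cons _ T n).
  rewrite (_ : _ \o _ = fun p => (complex.Im (f ord0 p.1 * G p.2))%:E)//.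
  by apply/funext => p /=; rewrite FE.
have [ir er] := cons_measure_pushforward pr' ((measurable_EFinP _ _).2 mr).
have [ii ei] := cons_measure_pushforward pi' ((measurable_EFinP _ _).2 mi).
split; first by split.
rewrite -(cintegral_product (fi ord0) IH1) /cintegral /Rintegral er ei.
by congr (fine _ +i* fine _); apply: eq_integral => p _; rewrite FE.
Qed.

End tuple_integral.

Section euclidean_tuples.
Context {R : realType}.
Local Notation T := (measurableTypeR R).

Lemma ge0_integral_lebesgue_translate (a : T) (f : T -> \bar R) :
  measurable_fun setT f -> (forall y, 0 <= f y)%E ->
  (\int[@lebesgue_measure R]_y f (y - a)%R = \int[@lebesgue_measure R]_y f y)%E.
Proof.
move=> mf f0.
have mt : measurable_fun [set: T] (fun y : T => (y - a)%R : T) by exact: measurable_funB.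
have := @ge0_integral_pushforward _ _ _ _ _ _ mt (@lebesgue_measure R) setT f measurableT mf.
rewrite preimage_setT => <-//.
apply: eq_measure_integral => //= A mA _; apply/esym/lebesgue_measure_unique => //= _ [[b c]] _ <-.
rewrite /pushforward (_ : _ @^-1` _ = `]b + a, c + a]%classic); last first.
  by apply/seteqP; split => y /=; rewrite !in_itv/= ltrBrDr lerBlDr.
rewrite !lebesgue_measure_itv/= !lte_fin ltrD2r -!EFinB.
by congr (if _ then _%:E else _); ring.
Qed.

Context {n : nat}.
Local Notation Rd := (n.-tuple T).

Definition shift_tuple (x y : Rd) : Rd := [tuple tnth y i - tnth x i | i < n].

Lemma measurable_shift_tuple x : measurable_fun setT (shift_tuple x).
Proof.
apply/measurable_fun_tnthP => i.
rewrite (_ : _ \o _ = fun y => tnth y i - tnth x i); last first.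
  by apply/funext => y /=; rewrite tnth_mktuple.
by apply: measurable_funB => //; exact: measurable_tnth.
Qed.

End euclidean_tuples.

Lemma tnth_tuple_cons_lift d (V : measurableType d) n (p : V * n.-tuple V) (j : 'I_n) :
  tnth (tuple_cons p) (lift ord0 j) = tnth p.2 j.
Proof. by rewrite (tnth_nth p.1)/= -tnth_nth. Qed.

Section translation.
Context {R : realType}.
Local Notation T := (measurableTypeR R).

Lemma ge0_integral_translate n (x : n.-tuple T) (f : n.-tuple T -> \bar R) :
  measurable_fun setT f -> (forall y, 0 <= f y)%E ->
  (\int[product_measure (fun=> @lebesgue_measure R)]_y f (shift_tuple x y) =
   \int[product_measure (fun=> @lebesgue_measure R)]_y f y)%E.
Proof.
elim: n x f => [|n IHn] x f mf f0.
  by apply: eq_integral => y _; congr f; apply: eq_from_tnth; case.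
have mc := @measurable_tuple_cons _ T n.
have mfs : measurable_fun setT (fun y => f (shift_tuple x y)).
  by apply: (measurableT_comp mf); exact: measurable_shift_tuple.
rewrite (ge0_integral_product_measure_cons _ mf f0).
rewrite (ge0_integral_product_measure_cons _ mfs (fun y => f0 _)).
pose lam := product_measure (fun _ : 'I_n => @lebesgue_measure R).
have mfc : measurable_fun setT (f \o @tuple_cons _ T n) by exact: measurableT_comp.
pose G a := (\int[lam]_t f (tuple_cons (a, t)))%E.
have mG : measurable_fun setT G.
  have f0c p : (0 <= (f \o @tuple_cons _ T n) p)%E by exact: f0.
  exact: (measurable_fun_fubini_tonelli_F (m2 := lam) _ mfc f0c).
have G0 a : (0 <= G a)%E by exact: integral_ge0.
rewrite -[RHS]/(\int[@lebesgue_measure R]_a G a)%E.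
rewrite -(ge0_integral_lebesgue_translate (tnth x ord0) mG G0).
apply: eq_integral => a _; rewrite /G.
rewrite -[RHS](IHn [tuple tnth x (lift ord0 i) | i < n])//; last first.
  by apply: (measurableT_comp mfc); exact: pair1_measurable.
apply: eq_integral => t _; congr f; apply: eq_from_tnth => i; rewrite tnth_mktuple.
by case: (unliftP ord0 i) => [j|] ->; rewrite ?tnth_tuple_cons_lift ?tnth_mktuple// !tnth0.
Qed.

Context {n : nat}.
Local Notation Rd := (n.-tuple T).
Local Notation lam := (product_measure (fun _ : 'I_n => @lebesgue_measure R)).

Lemma Rintegral_translate (x : Rd) (f : Rd -> R) : measurable_fun setT f ->
  \int[lam]_y f (shift_tuple x y) = \int[lam]_y f y.
Proof.
move=> mf; rewrite /Rintegral; congr fine; rewrite integralE [RHS]integralE.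
have mf' : measurable_fun setT (EFin \o f) by exact/measurable_EFinP.
congr (_ - _)%E.
- have := ge0_integral_translate x (measurable_funepos mf').
  rewrite -[X in _ -> X = _]/(\int[lam]_y ((EFin \o f) \o shift_tuple x)^\+%E y)%E
    (funepos_comp (EFin \o f) (shift_tuple x)).
  by apply => y; exact: funepos_ge0.
- have := ge0_integral_translate x (measurable_funeneg mf').
  rewrite -[X in _ -> X = _]/(\int[lam]_y ((EFin \o f) \o shift_tuple x)^\-%E y)%E
    (funeneg_comp (EFin \o f) (shift_tuple x)).
  by apply => y; exact: funeneg_ge0.
Qed.

Lemma cintegral_translate (x : Rd) (f : Rd -> R[i]) : cmeasurable f ->
  cintegral lam (fun y => f (shift_tuple x y)) = cintegral lam f.
Proof.
by move=> [mr mi]; rewrite /cintegral (Rintegral_translate x mr) (Rintegral_translate x mi).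
Qed.

(** [g] is dominated by C times the indicator of a cube, written as a product so that its integral
    factorizes. *)
Lemma box_integrable (r : R) (C : R) (g : Rd -> R) : measurable_fun setT g ->
  (forall x, `|g x| <= C) -> (forall x, g x != 0 -> forall i, `|tnth x i| <= r) ->
  lam.-integrable setT (EFin \o g).
Proof.
move=> mg gC gr.
have mB : measurable (`[- r, r]%classic : set T) by exact: measurable_itv.
pose b (x : T) : R := \1_(`[- r, r]%classic) x.
have mb : measurable_fun setT b by exact: measurable_indic.
have mP : measurable_fun setT (fun x : Rd => \prod_(i < n) b (tnth x i)).
  apply: measurable_prod => i _; apply: (measurableT_comp mb); exact: measurable_tnth.
have b0 x : 0 <= b x by [].
have bE : (\int[@lebesgue_measure R]_x (b x)%:E)%E = lebesgue_measure (`[- r, r]%classic : set R).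
  by rewrite /b integral_indic// setIT.
have iP : (\int[lam]_x (\prod_(i < n) b (tnth x i))%:E < +oo)%E.
  rewrite (ge0_integral_product_measure _ (fun=> mb) (fun=> b0)).
  rewrite (eq_bigr (fun=> (fine (\int[@lebesgue_measure R]_x (b x)%:E))%:E)).
    by rewrite prodEFin ltry.
  move=> i _; rewrite fineK// bE lebesgue_measure_itv/=.
  by case: ifP.
have C0 : 0 <= C by rewrite (le_trans _ (gC [tuple 0 | _ < n])).
apply/integrableP; split; first exact/measurable_EFinP.
apply: (@le_lt_trans _ _ (\int[lam]_x (C%:E * (\prod_(i < n) b (tnth x i))%:E))%E).
  apply: ge0_le_integral => //.
  - by apply/measurable_EFinP; exact: measurableT_comp.
  - by apply/measurable_EFinP; apply: measurable_funM.
  - move=> x _ /=; rewrite lee_fin; have [->|gx] := eqVneq (g x) 0.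
      by rewrite normr0 mulr_ge0// prodr_ge0.
    rewrite big1 ?mulr1// => i _; rewrite /b indicE mem_set//= in_itv/= -ler_norml.
    exact: gr.
rewrite ge0_integralZl//.
- by rewrite lte_mul_pinfty// lee_fin.
- exact/measurable_EFinP.
- by move=> x _; rewrite lee_fin prodr_ge0.
Qed.

End translation.

(** * Fourier transforms of test functions *)

Section test_functions.
Context {R : realType} {n : nat}.
Local Notation T := (measurableTypeR R).
Local Notation Rd := (n.-tuple T).
Local Notation lam := (product_measure (fun _ : 'I_n => @lebesgue_measure R)).
Implicit Types (f g : Rd -> R[i]) (u x : Rd) (A B : set Rd).

Lemma test_function_sub A B f : A `<=` B -> test_function A f -> test_function B f.
Proof. by move=> AB [mf Cf rf sf]; split => // x /sf/AB. Qed.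

Lemma test_function_linear A c f g : test_function A f -> test_function A g ->
  test_function A (fun x => c * f x + g x).
Proof.
move=> [mf [Cf Cfle] [rf rfle] sf] [mg [Cg Cgle] [rg rgle] sg].
have supp x : c * f x + g x != 0 -> f x != 0 \/ g x != 0.
  apply: contraPP => /not_orP[/negP]; rewrite negbK => /eqP ->.
  by move=> /negP; rewrite negbK => /eqP ->; rewrite mulr0 addr0 eqxx.
split.
- by apply: cmeasurableD => //; apply: cmeasurableM => //; exact: cmeasurable_cst.
- exists (2 * (abs2 c * Cf) + 2 * Cg) => x.
  rewrite (le_trans (abs2D _ _))// abs2M lerD// ler_pM2l//.
  by rewrite ler_wpM2l// abs2_ge0.
- exists (Num.max rf rg) => x /supp[/rfle h|/rgle h] i; rewrite le_max h//.
  by rewrite orbT.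
- by move=> x /supp[/sf|/sg].
Qed.

Lemma test_functionM A c f : cmeasurable c -> (forall x, abs2 (c x) <= 1) ->
  test_function A f -> test_function A (fun x => c x * f x).
Proof.
move=> mc c1 [mf [C Cf] [r rf] sf].
have supp x : c x * f x != 0 -> f x != 0.
  by apply: contra => /eqP ->; rewrite mulr0.
split.
- exact: cmeasurableM.
- by exists C => x; rewrite abs2M (le_trans _ (Cf x))// ler_piMl// abs2_ge0.
- by exists r => x /supp/rf.
- by move=> x /supp/sf.
Qed.

Lemma test_function_cintegrable f : test_function setT f -> cintegrable lam f.
Proof.
move=> [[mr mi] [C Cf] [r rf] _]; split.
- apply: (@box_integrable _ _ r (1 + C)) => // x.
    by rewrite (le_trans (Re_le_abs2 _))// lerD2l.
  by move=> h; apply: rf; apply: contra h => /eqP ->.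
- apply: (@box_integrable _ _ r (1 + C)) => // x.
    by rewrite (le_trans (Im_le_abs2 _))// lerD2l.
  by move=> h; apply: rf; apply: contra h => /eqP ->.
Qed.

Lemma translateE x f y : translate x f y = f (shift_tuple x y).
Proof. by []. Qed.

Lemma test_function_translate x A f : test_function A f ->
  test_function (shift_tuple x @^-1` A) (translate x f).
Proof.
move=> [mf [C Cf] [r rf] sf]; split.
- exact: (cmeasurable_comp mf (measurable_shift_tuple x)).
- by exists C => y; exact: Cf.
- exists (r + \sum_(i < n) `|tnth x i|) => y /rf h i.
  rewrite -(subrK (tnth x i) (tnth y i)) (le_trans (ler_normD _ _))// lerD//.
    by have := h i; rewrite tnth_mktuple.
  by rewrite (bigD1 i)//= lerDl sumr_ge0.
- by move=> y /sf.
Qed.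

Lemma test_function_translate_orthant x f : (forall i, tnth x i <= 0) ->
  test_function (@negative_orthant T n) f -> test_function (@negative_orthant T n) (translate x f).
Proof.
move=> x0 /(test_function_translate x); apply: test_function_sub => y yx i.
by have := yx i; rewrite tnth_mktuple => h; have := x0 i; lra.
Qed.

(** Stationarity makes this harmless for mean and variance: functions that correct the mean may be
    sought without regard to their support. *)
Lemma test_function_translate_into_orthant f : test_function setT f ->
  exists x : Rd, test_function (@negative_orthant T n) (translate x f).
Proof.
move=> tf; have [_ _ [r rf] _] := tf.
exists [tuple - r - 1 | _ < n].
have [m b s _] := test_function_translate [tuple - r - 1 | _ < n] tf.
split => // y /rf h i; have := h i; rewrite tnth_mktuple tnth_mktuple.
by rewrite ler_norml => /andP[_]; lra.
Qed.

Lemma dotDr u x y : dot u [tuple tnth x i + tnth y i | i < n] = dot u x + dot u y.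
Proof.
rewrite /dot -big_split/=; apply: eq_bigr => i _; by rewrite tnth_mktuple mulrDr.
Qed.

Lemma measurable_dot : measurable_fun [set: Rd * Rd] (fun p => dot p.1 p.2).
Proof.
apply: measurable_sum => i; apply: measurable_funM.
  exact: (measurableT_comp (measurable_tnth i) measurable_fst).
exact: (measurableT_comp (measurable_tnth i) measurable_snd).
Qed.

Lemma cmeasurable_expi_dot u : cmeasurable (fun x : Rd => expi (- dot u x)).
Proof.
apply: cmeasurable_expi; apply: measurableT_comp => //.
exact: (measurableT_comp measurable_dot (pair1_measurable u)).
Qed.

Lemma fourier_linear c f g u : test_function setT f -> test_function setT g ->
  fourier (fun x => c * f x + g x) u = c * fourier f u + fourier g u.
Proof.
move=> tf tg; have me := cmeasurable_expi_dot u.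
have e1 x : abs2 (expi (- dot u x)) <= 1 by rewrite abs2_expi.
have jf := test_function_cintegrable (test_functionM me e1 tf).
have jg := test_function_cintegrable (test_functionM me e1 tg).
rewrite /fourier -cintegralZ// -cintegralD//; last exact: cintegrableZ.
by congr cintegral; apply/funext => x; ring.
Qed.

Lemma fourier_translate x f u : test_function setT f ->
  fourier (translate x f) u = expi (- dot u x) * fourier f u.
Proof.
move=> tf; have me := cmeasurable_expi_dot u.
have e1 y : abs2 (expi (- dot u y)) <= 1 by rewrite abs2_expi.
have tef := test_functionM me e1 tf.
rewrite /fourier -cintegralZ; last exact: test_function_cintegrable.
have [mef _ _ _] := tef.
rewrite -[RHS](cintegral_translate x); last first.
  by apply: cmeasurableM => //; exact: cmeasurable_cst.
congr cintegral; apply/funext => y; rewrite mulrA -expiD -opprD -dotDr translateE.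
congr (expi (- dot u _) * _); apply: eq_from_tnth => i.
by rewrite !tnth_mktuple addrC subrK.
Qed.

Lemma cmeasurable_fourier f : test_function setT f -> cmeasurable (fourier f : Rd -> R[i]).
Proof.
move=> tf.
have mE : cmeasurable (fun p : Rd * Rd => expi (- dot p.1 p.2) * f p.2).
  have [mf _ _ _] := tf.
  apply: cmeasurableM.
    by apply: cmeasurable_expi; apply: measurableT_comp => //; exact: measurable_dot.
  by apply: (cmeasurable_comp mf); exact: measurable_snd.
have e1 u x : abs2 (expi (- dot u x)) <= 1 by rewrite abs2_expi.
pose o : Rd := [tuple 0 | _ < n].
(* With a Dirac mass as first factor the integrand is in L^1 of a product measure,
   and [measurable_fubini_F] applies. *)
have ij (h : Rd * Rd -> R) : measurable_fun setT h ->
    (forall u, lam.-integrable setT (fun x => (h (u, x))%:E)) ->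
    measurable_fun setT (fun u => \int[lam]_x h (u, x)).
  move=> mh ih; apply: (measurableT_comp (f := fine)) => //.
  have /integrableP[_ hoo] := ih o.
  apply: (@measurable_fubini_F _ _ _ _ _ (\d_o) lam (EFin \o h)).
  apply/integrable12ltyP; first exact/measurable_EFinP.
  have mabs : measurable_fun setT (fun p => `|(h p)%:E|%E).
    by apply: measurableT_comp => //; exact/measurable_EFinP.
  rewrite integral_dirac//; first by rewrite diracT mul1e.
  exact: (measurable_fun_fubini_tonelli_F (m2 := lam) _ mabs (fun p => abse_ge0 _)).
have jf u := test_function_cintegrable (test_functionM (cmeasurable_expi_dot u) (e1 u) tf).
have [mr mi] := mE; split.
- by apply: (ij _ mr) => u; have [] := jf u.
- by apply: (ij _ mi) => u; have [] := jf u.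
Qed.

End test_functions.

(** * The truncated exponential and its transform *)

Section cut_exponential.
Context {R : realType}.
Local Notation T := (measurableTypeR R).
Local Notation mu := (@lebesgue_measure R).

(** Bounded support forces a truncation, and the exponential factor keeps the transform from
    vanishing: that of a plain indicator of [-1, 0[ has zeros. *)
Definition cut_exp (y : T) : R[i] := (expR y * \1_(`[- 1, 0[%classic : set T) y)%:C.

Let mI : measurable (`[- 1, 0[%classic : set T). Proof. exact: measurable_itv. Qed.

Lemma cmeasurable_cut_exp : cmeasurable cut_exp.
Proof.
apply: cmeasurable_real; apply: measurable_funM; first exact: measurable_expR.
exact: measurable_indic.
Qed.

Lemma cut_exp_neq0 y : cut_exp y != 0 -> -1 <= y < 0.
Proof.
apply: contraR => yI; rewrite /cut_exp indicE memNset ?mulr0//.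
by move=> /=; rewrite in_itv/=; exact/negP.
Qed.

Lemma abs2_cut_exp y : abs2 (cut_exp y) <= 1.
Proof.
have [->|/cut_exp_neq0 /andP[_ y0]] := eqVneq (cut_exp y) 0; first by rewrite abs2_0.
rewrite abs2_real exprMn mulr_ile1 ?sqr_ge0//.
  by rewrite expr_le1// ?expR_ge0// -expR0 ler_expR ltW.
Qed.

Lemma integral_cut_antiderivative (f F : R -> R) : continuous f ->
  (forall x : R, is_derive x 1 F (f x)) -> (forall y, y < 0 -> `|f y| <= 1) ->
  mu.-integrable setT (fun y => (f y * \1_(`[- 1, 0[%classic : set T) y)%:E) /\
  \int[mu]_y (f y * \1_(`[- 1, 0[%classic : set T) y) = F 0 - F (-1).
Proof.
move=> cf dF f1.
have mf : measurable_fun [set: T] f by exact: measurable_realfun.continuous_measurable_fun.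
split.
  apply: (le_integrable _ _ _ (integrable_indic_itv (-1 : R) 0 true true)) => //.
    by apply/measurable_EFinP; apply: measurable_funM => //; exact: measurable_indic.
  move=> y _ /=; rewrite lee_fin normrM indicE.
  have [|_] := boolP (y \in _); last by rewrite normr0 mulr0.
  by rewrite inE/= in_itv/= normr1 mulr1 => /andP[_ /f1].
have /integral_antiderivative/(_ cf dF) h : -1 < 0 :> R by lra.
rewrite /Rintegral -[RHS]/(fine (F 0 - F (-1))%:E) -h; congr fine.
rewrite -(@integral_itv_bndo_bndc R); last first.
  by apply/measurable_EFinP; exact: (measurable_funS measurableT).
rewrite [RHS]integral_mkcond; apply: eq_integral => t _ /=.
by rewrite epatch_indic.
Qed.

Let is_derive_mulrl (u y : R) : is_derive y 1 (fun y : R => u * y) u.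
Proof.
rewrite -[X in is_derive _ _ _ X]mulr1.
exact: (@is_deriveZ _ _ _ id u y 1 1 (is_derive_id _ _)).
Qed.

Let abs_le1_expR (a y : R) : `|a| <= 1 -> y < 0 -> `|expR y * a| <= 1.
Proof.
move=> a1 y0; rewrite normrM mulr_ile1// ger0_norm ?expR_ge0//.
by rewrite -expR0 ler_expR ltW.
Qed.

Let cM (u : R) : continuous (fun y : R => u * y).
Proof. by move=> t; apply: cvgM; first exact: cvg_cst. Qed.

Lemma cintegral_cut_exp (u : T) :
  cintegrable mu (fun y => expi (- (u * y)) * cut_exp y) /\
  cintegral mu (fun y => expi (- (u * y)) * cut_exp y) = cut_resolvent u.
Proof.
have h := gt_eqF (sqr1D_gt0 u).
have reE y : complex.Re (expi (- (u * y)) * cut_exp y) =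
    expR y * cos (u * y) * \1_(`[- 1, 0[%classic : set T) y.
  by rewrite cReM /= cosN mulr0 subr0; ring.
have imE y : complex.Im (expi (- (u * y)) * cut_exp y) =
    expR y * (- sin (u * y)) * \1_(`[- 1, 0[%classic : set T) y.
  by rewrite cImM /= sinN mulr0 add0r; ring.
have cE : continuous (fun y : R => expR y) by exact: continuous_expR.
have ccos : continuous (fun y : R => cos (u * y)).
  by move=> t; apply: continuous_comp; [exact: cM|exact: continuous_cos].
have csin : continuous (fun y : R => sin (u * y)).
  by move=> t; apply: continuous_comp; [exact: cM|exact: continuous_sin].
have du (y : R) := is_derive_mulrl u y.
have [ir er] : mu.-integrable setT
      (fun y => (expR y * cos (u * y) * \1_(`[- 1, 0[%classic : set T) y)%:E) /\
    \int[mu]_y (expR y * cos (u * y) * \1_(`[- 1, 0[%classic : set T) y) =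
      (1 + u ^+ 2)^-1 * (1 - expR (-1) * (cos u - u * sin u)).
  (* The two antiderivatives, here and below, are the real and imaginary parts of exp((1 - i u) y) /
     (1 - i u). *)
  have [] := @integral_cut_antiderivative (fun y => expR y * cos (u * y))
    (fun y => (1 + u ^+ 2)^-1 * (expR y * (cos (u * y) + u * sin (u * y)))).
  - by move=> y; apply: cvgM; [exact: cE|exact: ccos].
  - move=> y; apply: is_derive_eq; rewrite /GRing.scale/=; field; exact/negbT.
  - by move=> y; apply: abs_le1_expR; exact: cos_max.
  move=> ir ->; split=> //; rewrite !mulr0 !mulrN1 cosN sinN cos0 sin0 expR0; ring.
have [ii ei] : mu.-integrable setT
      (fun y => (expR y * (- sin (u * y)) * \1_(`[- 1, 0[%classic : set T) y)%:E) /\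
    \int[mu]_y (expR y * (- sin (u * y)) * \1_(`[- 1, 0[%classic : set T) y) =
      (1 + u ^+ 2)^-1 * (u - expR (-1) * (u * cos u + sin u)).
  have [] := @integral_cut_antiderivative (fun y => expR y * (- sin (u * y)))
    (fun y => (1 + u ^+ 2)^-1 * (expR y * (u * cos (u * y) - sin (u * y)))).
  - by move=> y; apply: cvgM; [exact: cE|apply: cvgN; exact: csin].
  - move=> y; apply: is_derive_eq; rewrite /GRing.scale/=; field; exact/negbT.
  - by move=> y; apply: abs_le1_expR; rewrite normrN; exact: sin_max.
  move=> ii ->; split=> //; rewrite !mulr0 !mulrN1 cosN sinN cos0 sin0 expR0; ring.
split.
  by split; [under eq_fun do rewrite reE|under eq_fun do rewrite imE].
rewrite /cintegral; under eq_Rintegral do rewrite reE.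
under [X in _ +i* X]eq_Rintegral do rewrite imE.
rewrite er ei /cut_resolvent resolventE; apply/eqP; rewrite eq_complex cReM cImM /=.
by rewrite /cauchy_weight; apply/andP; split; apply/eqP; ring.
Qed.

End cut_exponential.

Section orthant_spectrum.
Context {R : realType} {n : nat}.
Local Notation T := (measurableTypeR R).
Local Notation Rd := (n.-tuple T).
Local Notation orthant := (@negative_orthant T n).

Definition orthant_exp (x : Rd) : R[i] := \prod_(i < n) cut_exp (tnth x i).

Lemma test_function_orthant_exp : test_function orthant orthant_exp.
Proof.
have supp x : orthant_exp x != 0 -> forall i, -1 <= (tnth x i : R) < 0.
  by move=> /prodf_neq0 h i; exact: cut_exp_neq0 (h i isT).
split.
- by apply: cmeasurable_prod => i; exact: (cmeasurable_comp cmeasurable_cut_exp (@measurable_tnth _ _ _ i)).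
- exists 1 => x; rewrite abs2_prod prodr_ile1// => i _.
  by rewrite abs2_ge0 abs2_cut_exp.
- by exists 1 => x /supp h i; have /andP[? ?] := h i; rewrite ler_norml; apply/andP; split; lra.
- by move=> x /supp h i; have /andP[] := h i.
Qed.

Lemma expi_sum (I : Type) (r : seq I) (F : I -> R) :
  expi (\sum_(i <- r) F i) = \prod_(i <- r) expi (F i).
Proof.
elim: r => [|i r IHr]; first by rewrite !big_nil expi0.
by rewrite !big_cons expiD IHr.
Qed.

Lemma fourier_orthant_exp u : fourier orthant_exp u = tensor_power cut_resolvent u.
Proof.
have mf (i : 'I_n) : cmeasurable (fun y : T => expi (- (tnth u i * y)) * cut_exp y).
  apply: cmeasurableM cmeasurable_cut_exp; apply: cmeasurable_expi.
  by apply: measurableT_comp => //; exact: measurable_funM.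
have [_ h] := cintegral_tensor mf (fun i => (cintegral_cut_exp (tnth u i)).1).
rewrite /fourier /tensor_power -(eq_bigr _ (fun i _ => (cintegral_cut_exp (tnth u i)).2)) -h.
congr cintegral; apply/funext => x.
by rewrite big_split/= -expi_sum /dot sumrN.
Qed.

Definition orthant_spectrum (D : Rd -> R[i]) : Prop :=
  exists h, test_function orthant h /\ D = fourier h.

Let orthant_sub h : test_function orthant h -> test_function setT h.
Proof. exact: test_function_sub (@subsetT _ _). Qed.

Lemma orthant_spectrum_linear c D1 D2 : orthant_spectrum D1 -> orthant_spectrum D2 ->
  orthant_spectrum (fun u => c * D1 u + D2 u).
Proof.
move=> [h1 [t1 ->]] [h2 [t2 ->]]; exists (fun x => c * h1 x + h2 x).
split; first exact: test_function_linear.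
by apply/funext => u; rewrite fourier_linear//; exact: orthant_sub.
Qed.

(** Multiplication by exp(i s u_i) is translation by -s along coordinate i, which preserves the
    orthant exactly because s >= 0. *)
Lemma orthant_spectrum_expi i (s : R) D : 0 <= s -> orthant_spectrum D ->
  orthant_spectrum (fun u => expi (s * tnth u i) * D u).
Proof.
move=> s0 [h [th ->]]; pose x : Rd := [tuple if j == i then - s else 0 | j < n].
exists (translate x h); split.
  apply: test_function_translate_orthant th => j; rewrite tnth_mktuple.
  by case: ifP => _; rewrite ?oppr_le0.
apply/funext => u; rewrite fourier_translate; last exact: orthant_sub.
congr (expi _ * _); rewrite /dot (bigD1 i)//= big1 ?addr0; last first.
  by move=> j ji; rewrite tnth_mktuple (negbTE ji) mulr0.
by rewrite tnth_mktuple eqxx; ring.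
Qed.

Lemma cmeasurable_orthant_spectrum D : orthant_spectrum D -> cmeasurable D.
Proof.
by move=> [h [th ->]]; apply: cmeasurable_fourier; exact: orthant_sub.
Qed.

End orthant_spectrum.

(** * The resolvent as a limit of combinations of translations *)

Section damped_translations.
Context {R : realType}.
Local Notation T := (measurableTypeR R).
Local Notation m_ n := (n.+1%:R : R).

Lemma cvg_difference_quotient (f : R -> R) (df : R) : is_derive (0 : R) (1 : R) f df ->
  m_ n * (f (m_ n)^-1 - f 0) @[n --> \oo] --> df.
Proof.
move=> [dv <-]; move: dv => /cvgr_dnbhsP/(_ harmonic).
rewrite /harmonic /=.
have -> : (fun n => m_ n * (f (m_ n)^-1 - f 0)) =
    (fun n => (m_ n)^-1^-1 *: ((f \o shift 0) ((m_ n)^-1 *: 1) - f 0)).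
  by apply/funext => n; rewrite invrK /= addr0 /GRing.scale/= mulr1.
apply; split; last exact: cvg_harmonic.
by move=> n; rewrite invr_eq0 pnatr_eq0.
Qed.

(* [pole n u] is [n.+1^-1] times the sum of the powers of [ratio n u], hence a Riemann
   sum of [\int_0^oo exp(- x + i u x) dx = resolvent u]. *)
Definition ratio n (u : T) : R[i] := (m_ n / (m_ n + 1))%:C * expi ((m_ n)^-1 * u).

Definition pole n (u : T) : R[i] := ((m_ n + 1)%:C * expi (- ((m_ n)^-1 * u)) - (m_ n)%:C)^-1.

Let den n (u : T) : R[i] := (m_ n + 1)%:C * expi (- ((m_ n)^-1 * u)) - (m_ n)%:C.

(** The reverse triangle inequality: the two terms have moduli m + 1 and m. *)
Let abs2_den_ge1 n u : 1 <= abs2 (den n u).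
Proof.
rewrite /den; set t := (m_ n)^-1 * u; set m := m_ n.
have m0 : 0 <= m by [].
rewrite /abs2 cReD cImD cReN cImN cReM cImM /= cosN sinN.
have := cos_le1 t; have := cos2Dsin2 t; set c := cos t; set s := sin t => cs c1.
have : 0 <= m * (m + 1) * (1 - c) by apply: mulr_ge0; [apply: mulr_ge0 => //; exact: addr_ge0|rewrite subr_ge0].
have -> : ((m + 1) * c - 0 * - s - m) ^+ 2 + ((m + 1) * - s + 0 * c - 0) ^+ 2 =
  (m + 1) ^+ 2 * (c ^+ 2 + s ^+ 2) + m ^+ 2 - 2 * (m * (m + 1)) * c by ring.
rewrite cs; nra.
Qed.

Lemma abs2_pole n u : abs2 (pole n u) <= 1.
Proof.
rewrite /pole abs2V invf_le1 ?abs2_den_ge1//.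
exact: lt_le_trans (abs2_den_ge1 n u).
Qed.

Lemma cmeasurable_pole n : cmeasurable (pole n).
Proof.
apply: cmeasurableV; apply: cmeasurableB; last exact: cmeasurable_cst.
apply: cmeasurableM; first exact: cmeasurable_cst.
by apply: cmeasurable_expi; apply: measurableT_comp => //; exact: measurable_funM.
Qed.

Lemma cmeasurable_ratio n : cmeasurable (ratio n).
Proof.
apply: cmeasurableM; first exact: cmeasurable_cst.
by apply: cmeasurable_expi; exact: measurable_funM.
Qed.

(** [pole n u] and [resolvent u] are inverses of numbers of modulus at least 1, so their distance is
    at most that of the denominators. These converge by the derivatives of cosine and sine at 0. *)
Lemma cvg_pole u : abs2 (pole n u - resolvent u) @[n --> \oo] --> (0 : R).
Proof.
have bound n : abs2 (pole n u - resolvent u) <= abs2 (den n u - (1 -i* u)).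
  have d0 : den n u != 0 by rewrite -abs2_gt0 (lt_le_trans _ (abs2_den_ge1 n u)).
  have r0 : (1 -i* u : R[i]) != 0 by rewrite -abs2_gt0 abs2_1Bi sqr1D_gt0.
  rewrite (_ : pole n u - resolvent u = - (den n u - (1 -i* u)) * (pole n u * resolvent u)).
    rewrite abs2M abs2N ler_piMr ?abs2_ge0// abs2M mulr_ile1 ?abs2_ge0 ?abs2_pole//.
    by rewrite abs2_resolvent invf_le1 ?sqr1D_gt0// lerDl sqr_ge0.
  have subV (a b : R[i]) : a != 0 -> b != 0 -> a^-1 - b^-1 = - (a - b) * (a^-1 * b^-1).
    by move=> a0 b0; field; rewrite a0 b0.
  exact: subV.
have dM (c s : R) : is_derive s 1 (fun s : R => c * s) c.
  rewrite -[X in is_derive _ _ _ X]mulr1.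
  exact: (@is_deriveZ _ _ _ id c s 1 1 (is_derive_id _ _)).
have hc : m_ n * (cos (u * (m_ n)^-1) - 1) @[n --> \oo] --> (0 : R).
  have := cvg_difference_quotient (f := fun s => cos (u * s)) (df := 0).
  rewrite mulr0 cos0; apply.
  by have du := dM u 0; apply: is_derive_eq; rewrite mulr0 sin0 /GRing.scale/=; ring.
have hs : m_ n * sin (u * (m_ n)^-1) @[n --> \oo] --> (u : R).
  have := cvg_difference_quotient (f := fun s => sin (u * s)) (df := u).
  rewrite mulr0 sin0 => h; under eq_fun do rewrite -[sin _]subr0; apply: h.
  by have du := dM u 0; apply: is_derive_eq; rewrite mulr0 cos0 /GRing.scale/=; ring.
have hh : (m_ n)^-1 @[n --> \oo] --> (0 : R) by exact: cvg_harmonic.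
apply: (@squeeze_cvgr _ _ _ _ (fun=> 0) (fun n => abs2 (den n u - (1 -i* u)))).
- by apply: nearW => n; rewrite abs2_ge0 bound.
- exact: cvg_cst.
rewrite (_ : (fun n => _) = (fun n =>
   ((1 + (m_ n)^-1) * (m_ n * (cos (u * (m_ n)^-1) - 1))) ^+ 2 +
   ((1 + (m_ n)^-1) * (m_ n * sin (u * (m_ n)^-1)) - u) ^+ 2)); last first.
  apply/funext => n; have m0 : m_ n != 0 by rewrite pnatr_eq0.
  rewrite /den /abs2 !(cReD, cImD, cReN, cImN, cReM, cImM) /= cosN sinN [u * _]mulrC.
  move: (cos _) (sin _) => c s.
  move: (m_ n) m0 => m m0; field; exact: m0.
have h1 : 1 + (m_ n)^-1 @[n --> \oo] --> (1 : R).
  by rewrite -[X in _ --> X]addr0; apply: cvgD hh; exact: cvg_cst.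
have h2 : (1 + (m_ n)^-1) * (m_ n * (cos (u * (m_ n)^-1) - 1)) @[n --> \oo] --> (0 : R).
  by rewrite -[X in _ --> X](mulr0 (1 : R)); exact: (cvgM h1 hc).
have h3 : (1 + (m_ n)^-1) * (m_ n * sin (u * (m_ n)^-1)) - u @[n --> \oo] --> (0 : R).
  rewrite -[X in _ --> X](subrr (u : R)) -[X in _ --> X - _]mul1r.
  by apply: cvgB; [exact: (cvgM h1 hs)|exact: cvg_cst].
rewrite -[X in _ --> X]addr0 -[X in _ --> X + _](mulr0 (0 : R)) -[X in _ --> _ + X](mulr0 (0 : R)).
under eq_fun do rewrite !expr2.
by apply: cvgD; [exact: (cvgM h2 h2)|exact: (cvgM h3 h3)].
Qed.

(** A geometric sum, with the denominator rewritten through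
    [den n u * ratio n u = m (1 - ratio n u)]. *)
Lemma ratio_sum n u K :
  (m_ n)^-1%:C * \sum_(k < K) ratio n u ^+ k.+1 = pole n u * (1 - ratio n u ^+ K).
Proof.
have m0 : m_ n != 0 by rewrite pnatr_eq0.
have m10 : m_ n + 1 != 0 by rewrite natr1 pnatr_eq0.
have mC0 (a : R) : a != 0 -> a%:C != 0 :> R[i] by move=> a0; rewrite -abs2_gt0 abs2_real exprn_even_gt0.
have d0 : den n u != 0 by rewrite -abs2_gt0 (lt_le_trans _ (abs2_den_ge1 n u)).
set z := ratio n u.
have z0 : z != 0.
  by rewrite mulf_neq0 ?mC0 ?mulf_neq0 ?invr_eq0// -abs2_gt0 abs2_expi.
have dz : den n u * z = (m_ n)%:C * (1 - z).
  rewrite /z /ratio /den mulrBl mulrBr mulr1; congr (_ - _).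
  rewrite mulrACA -expiD addNr expi0 mulr1 -rmorphM/=; congr (_%:C); by rewrite mulrCA mulfV// mulr1.
apply: (mulfI (mulf_neq0 d0 z0)); rewrite [LHS]mulrA [RHS]mulrA {1}dz.
under eq_bigr do rewrite exprS; rewrite -mulr_sumr.
have -> : (m_ n)^-1%:C = (m_ n)%:C^-1 by rewrite fmorphV.
have -> : den n u * z * pole n u = z by rewrite mulrAC /pole mulfV// mul1r.
have gs : (1 - z) * \sum_(i < K) z ^+ i = 1 - z ^+ K.
  by rewrite -[LHS]opprK -mulNr opprB -subrX1 opprB.
by rewrite -gs; move: (mC0 _ m0); move: (m_ n)%:C => c c0; field.
Qed.

Lemma abs2_ratio n u : abs2 (ratio n u) = (m_ n / (m_ n + 1)) ^+ 2.
Proof. by rewrite abs2M abs2_real abs2_expi mulr1. Qed.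

Lemma cvg_ratioX n u : abs2 (ratio n u ^+ K) @[K --> \oo] --> (0 : R).
Proof.
under eq_fun do rewrite abs2X abs2_ratio.
have m10 : 0 < m_ n + 1 by rewrite ltr_wpDl.
apply: cvg_expr; rewrite ger0_norm ?sqr_ge0// expr_lt1//.
by rewrite ltr_pdivrMr// mul1r ltrDl.
Qed.

Lemma abs2_ratioX_le1 n u K : abs2 (ratio n u ^+ K) <= 1.
Proof.
have m10 : 0 < m_ n + 1 by rewrite ltr_wpDl.
rewrite abs2X abs2_ratio -exprM exprn_ile1//.
by rewrite ler_pdivrMr// mul1r lerDl.
Qed.

End damped_translations.

Section cayley_approximation.
Context {R : realType} {n : nat}.
Local Notation T := (measurableTypeR R).
Local Notation Rd := (n.-tuple T).
Variable S : {measure set Rd -> \bar R}.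

(** Each power of [ratio] is a constant times exp(i s u_i) with s >= 0, that is, an admissible
    translation. *)
Lemma orthant_spectrum_geometric i k K D : @orthant_spectrum R n D ->
  @orthant_spectrum R n (fun u =>
    2 * ((k.+1%:R : R)^-1%:C * \sum_(j < K) ratio k (tnth u i) ^+ j.+1) * D u - D u).
Proof.
move=> hD; elim: K => [|K IHK].
  rewrite (_ : (fun u => _) = fun u => (- 2%:R) * D u + D u); last first.
    by apply/funext => u; rewrite big_ord0; ring.
  exact: orthant_spectrum_linear.
set r : R := k.+1%:R / (k.+1%:R + 1).
have sK : 0 <= K.+1%:R * (k.+1%:R)^-1 :> R by rewrite mulr_ge0 ?invr_ge0.
rewrite (_ : (fun u => _) = fun u =>
    (2 * (k.+1%:R : R)^-1%:C * r%:C ^+ K.+1) * (expi (K.+1%:R * (k.+1%:R)^-1 * tnth u i) * D u) +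
    (2 * ((k.+1%:R : R)^-1%:C * \sum_(j < K) ratio k (tnth u i) ^+ j.+1) * D u - D u)).
  by apply: orthant_spectrum_linear => //; exact: orthant_spectrum_expi.
have E (u : Rd) : ratio k (tnth u i) ^+ K.+1 =
    r%:C ^+ K.+1 * expi (K.+1%:R * (k.+1%:R)^-1 * tnth u i).
  by rewrite /ratio exprMn expiX mulrA.
by apply/funext => u; rewrite big_ord_recr/= E; ring.
Qed.

(** The two limits are taken in turn: k first, for [pole] to be close to the resolvent, then K for
    that k, to cut the geometric series. All factors are bounded uniformly in u, so a multiple of D
    dominates both errors. *)
Lemma cayley_orthant_spectrum D i (h : R) : @orthant_spectrum R n D ->
  (sq_norm S D < +oo)%E -> 0 < h -> exists D', @orthant_spectrum R n D' /\
  (sq_norm S (fun u => cayley (tnth u i) * D u - D' u)%R < h%:E)%E.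
Proof.
move=> hD fD h0; have mD := cmeasurable_orthant_spectrum hD.
have mt (f : T -> R[i]) : cmeasurable f -> cmeasurable (fun u : Rd => f (tnth u i)).
  by move=> mf; exact: (cmeasurable_comp mf (@measurable_tnth _ _ _ i)).
have h40 : 0 < h / 4 by rewrite divr_gt0.
have f2D : (sq_norm S (fun u => 2 * D u)%R < +oo)%E.
  by rewrite sq_normZ// lte_mul_pinfty ?lee_fin ?abs2_ge0.
have m2D : cmeasurable (fun u => 2 * D u) by apply: cmeasurableM => //; exact: cmeasurable_cst.
have f4D : (sq_norm S (fun u => 4 * D u)%R < +oo)%E.
  by rewrite sq_normZ// lte_mul_pinfty ?lee_fin ?abs2_ge0.
have m4D : cmeasurable (fun u => 4 * D u) by apply: cmeasurableM => //; exact: cmeasurable_cst.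
have abs2_2 : abs2 (2 : R[i]) = 4 by rewrite /abs2 /=; ring.
have abs2_4 : abs2 (4 : R[i]) = 16 by rewrite /abs2 /=; ring.
have mk k : cmeasurable (fun u : Rd => (resolvent (tnth u i) - pole k (tnth u i)) * (2 * D u)).
  apply: cmeasurableM m2D; apply: cmeasurableB.
    exact: mt cmeasurable_resolvent.
  exact: mt (cmeasurable_pole k).
have [k hk] : exists k, (sq_norm S
    (fun u => (resolvent (tnth u i) - pole k (tnth u i)) * (2 * D u))%R < (h / 4)%:E)%E.
  apply: (sq_norm_dominated mk m4D) => //.
  - move=> k u; rewrite !abs2M abs2_2 abs2_4.
    have := abs2B (resolvent (tnth u i)) (pole k (tnth u i)).
    have := abs2_pole k (tnth u i).
    have : abs2 (resolvent (tnth u i)) <= 1.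
      by rewrite abs2_resolvent invf_le1 ?sqr1D_gt0// lerDl sqr_ge0.
    by have := abs2_ge0 (D u); nra.
  - move=> u; under eq_fun do rewrite abs2M abs2BC.
    have := cvgM (cvg_pole (tnth u i)) (cvg_cst (abs2 (2 * D u))).
    by rewrite mul0r; apply.
have mK K : cmeasurable (fun u : Rd => ratio k (tnth u i) ^+ K * (pole k (tnth u i) * (2 * D u))).
  apply: cmeasurableM; first exact: mt (cmeasurableX K (cmeasurable_ratio k)).
  by apply: cmeasurableM m2D; exact: mt (cmeasurable_pole k).
have [K hK] : exists K, (sq_norm S
    (fun u => ratio k (tnth u i) ^+ K * (pole k (tnth u i) * (2 * D u)))%R < (h / 4)%:E)%E.
  apply: (sq_norm_dominated mK m2D) => //.
  - move=> K u; rewrite abs2M abs2M mulrA ler_piMl ?abs2_ge0// mulr_ile1 ?abs2_ge0//.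
      exact: abs2_ratioX_le1.
    exact: abs2_pole.
  - move=> u; under eq_fun do rewrite abs2M.
    have := cvgM (cvg_ratioX k (tnth u i)) (cvg_cst (abs2 (pole k (tnth u i) * (2 * D u)))).
    by rewrite mul0r; apply.
exists (fun u => 2 * ((k.+1%:R : R)^-1%:C * \sum_(j < K) ratio k (tnth u i) ^+ j.+1) * D u - D u).
split; first exact: orthant_spectrum_geometric.
rewrite (eq_sq_norm S (g := fun u => (resolvent (tnth u i) - pole k (tnth u i)) * (2 * D u) +
    ratio k (tnth u i) ^+ K * (pole k (tnth u i) * (2 * D u)))); last first.
  by move=> u; rewrite ratio_sum /cayley; ring.
apply: le_lt_trans (sq_normD S (mk k) (mK K)) _.
have -> : h%:E = (2%:E * (h / 4)%:E + 2%:E * (h / 4)%:E)%E.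
  by rewrite -!EFinM -EFinD; congr EFin; lra.
by apply: lteD; rewrite lte_pmul2l.
Qed.

End cayley_approximation.

(** * Interpolation in the continuous case *)

Section charge_integral_linear.
Context {R : realType} {d : measure_display} {T : measurableType d}.
Variable nu : {charge set T -> \bar R}.
Implicit Types f g : T -> R.

Definition bounded_measurable f := measurable_fun setT f /\ exists C : R, forall x, `|f x| <= C.

Lemma bounded_measurable_integrable (mu : {finite_measure set T -> \bar R}) f :
  bounded_measurable f -> mu.-integrable setT (EFin \o f).
Proof.
move=> [mf [C fC]]; apply: measurable_bounded_integrable => //.
  by rewrite fin_num_fun_lty//; exact: fin_num_measure.
exists C; split; first exact: num_real.
by move=> M CM x _ /=; rewrite (le_trans (fC x))// ltW.
Qed.

(** The Hahn decomposition is chosen from [nu] alone, so the three integrals involve the same Jordan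
    parts. *)
Lemma charge_integralD f g : bounded_measurable f -> bounded_measurable g ->
  charge_integral nu (fun x => f x + g x) = charge_integral nu f + charge_integral nu g.
Proof.
move=> bf bg; rewrite /charge_integral !RintegralD//; try exact: bounded_measurable_integrable.
by ring.
Qed.

Lemma charge_integralZ a f : bounded_measurable f ->
  charge_integral nu (fun x => a * f x) = a * charge_integral nu f.
Proof.
move=> bf; rewrite /charge_integral !RintegralZl//; try exact: bounded_measurable_integrable.
by ring.
Qed.

Lemma bounded_measurableD f g : bounded_measurable f -> bounded_measurable g ->
  bounded_measurable (fun x => f x + g x).
Proof.
move=> [mf [C hC]] [mg [D hD]]; split; first exact: measurable_funD.
by exists (C + D) => x; rewrite (le_trans (ler_normD _ _))// lerD.
Qed.

Lemma bounded_measurableZ a f : bounded_measurable f -> bounded_measurable (fun x => a * f x).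
Proof.
move=> [mf [C hC]]; split; first exact: measurable_funM.
by exists (`|a| * C) => x; rewrite normrM ler_wpM2l.
Qed.

End charge_integral_linear.

Lemma complex_measure_integral_linear (R : realType) d (T : measurableType d)
    (nu : {charge set T -> \bar R} * {charge set T -> \bar R}) (c : R[i]) (f g : T -> R[i]) :
  cmeasurable f -> cmeasurable g ->
  (exists C, forall x, abs2 (f x) <= C) -> (exists C, forall x, abs2 (g x) <= C) ->
  complex_measure_integral nu (fun x => c * f x + g x) =
  c * complex_measure_integral nu f + complex_measure_integral nu g.
Proof.
move=> [mfr mfi] [mgr mgi] [Cf hf] [Cg hg].
have bfr : bounded_measurable (fun x => complex.Re (f x)).
  by split=> //; exists (1 + Cf) => x; rewrite (le_trans (Re_le_abs2 _))// lerD2l.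
have bfi : bounded_measurable (fun x => complex.Im (f x)).
  by split=> //; exists (1 + Cf) => x; rewrite (le_trans (Im_le_abs2 _))// lerD2l.
have bgr : bounded_measurable (fun x => complex.Re (g x)).
  by split=> //; exists (1 + Cg) => x; rewrite (le_trans (Re_le_abs2 _))// lerD2l.
have bgi : bounded_measurable (fun x => complex.Im (g x)).
  by split=> //; exists (1 + Cg) => x; rewrite (le_trans (Im_le_abs2 _))// lerD2l.
set a := complex.Re c; set b := complex.Im c.
have reE (m : {charge set T -> \bar R}) : charge_integral m (fun x => complex.Re (c * f x + g x)) =
    a * charge_integral m (fun x => complex.Re (f x)) +
    - b * charge_integral m (fun x => complex.Im (f x)) +
    charge_integral m (fun x => complex.Re (g x)).
  rewrite -!charge_integralZ// -!charge_integralD//; try by do ?apply: bounded_measurableD;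
    do ?apply: bounded_measurableZ.
  by congr charge_integral; apply/funext => x; rewrite cReD cReM mulNr.
have imE (m : {charge set T -> \bar R}) : charge_integral m (fun x => complex.Im (c * f x + g x)) =
    a * charge_integral m (fun x => complex.Im (f x)) +
    b * charge_integral m (fun x => complex.Re (f x)) +
    charge_integral m (fun x => complex.Im (g x)).
  rewrite -!charge_integralZ// -!charge_integralD//; try by do ?apply: bounded_measurableD;
    do ?apply: bounded_measurableZ.
  by congr charge_integral; apply/funext => x; rewrite cImD cImM.
rewrite /complex_measure_integral !reE !imE.
apply/eqP; rewrite eq_complex cReD cImD cReM cImM /= -/a -/b.
move: (charge_integral _ _) (charge_integral _ _) (charge_integral _ _) (charge_integral _ _).
move=> x1 x2 x3 x4; move: (charge_integral _ _) (charge_integral _ _) => x5 x6.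
move: (charge_integral _ _) (charge_integral _ _) => x7 x8.
by apply/andP; split; apply/eqP; ring.
Qed.

Section continuous_case.
Context {R : realType} {n : nat} {dO : measure_display} {Omega : measurableType dO}.
Variable P : probability Omega R.
Local Notation T := (measurableTypeR R).
Local Notation Rd := (n.-tuple T).
Local Notation lam := (product_measure (fun _ : 'I_n => @lebesgue_measure R)).
Local Notation test := (@test_function R n setT).
Implicit Types f g : Rd -> R[i].
Variable M : (Rd -> R[i]) -> Omega -> R[i].
Hypothesis wsM : weakly_stationary_measure P M.

Lemma compact_tuples_box (r : R) : compact_tuples [set x : Rd | forall i, `|tnth x i| <= r].
Proof.
rewrite /compact_tuples (_ : [set _ | _ in _] =
    [set v : 'rV[R]_n | forall i, `[- r, r]%classic (v ord0 i)]).
  by apply: (@rV_compact R n (fun=> `[- r, r]%classic)) => _; exact: segment_compact.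
apply/seteqP; split => [_ [x hx <-] i|v hv] /=.
  by rewrite mxE in_itv/= -ler_norml; exact: hx.
exists [tuple (v ord0 i : T) | i < n].
  by move=> i; rewrite tnth_mktuple ler_norml; have := hv i; rewrite /= in_itv.
by apply/rowP => i; rewrite mxE tnth_mktuple.
Qed.

(** Linearity of [M] is derived: for almost every w, on a box containing the three supports, M is
    integration against a single complex measure. *)
Lemma ae_linear c f g : test f -> test g ->
  {ae P, forall w, M (fun x => c * f x + g x) w = c * M f w + M g w}.
Proof.
move=> tf tg; apply: filterS (wsm_complex_measure wsM) => w hw.
have [mf bf [rf hrf] _] := tf; have [mg bg [rg hrg] _] := tg.
have [ml bl [r hr] _] := test_function_linear c tf tg.
pose s := Num.max r (Num.max rf rg).
have [nu hnu] := hw _ (@compact_tuples_box s).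
rewrite !hnu; first exact: complex_measure_integral_linear.
- split => //; first by exists rg.
  by move=> x /hrg h i; rewrite /s !le_max h !orbT.
- split => //; first by exists rf.
  by move=> x /hrf h i; rewrite /s !le_max h !orbT.
- split => //; first by exists r.
  by move=> x /hr h i; rewrite /s !le_max h.
Qed.

Lemma cexpectation_linear c f g : test f -> test g ->
  cexpectation P (M (fun x => c * f x + g x)) =
  c * cexpectation P (M f) + cexpectation P (M g).
Proof.
move=> tf tg.
have si := wsm_square_integrable wsM.
have jf := square_integrable_cintegrable (si _ tf).
have jg := square_integrable_cintegrable (si _ tg).
have jl := square_integrable_cintegrable (si _ (test_function_linear c tf tg)).
rewrite /cexpectation -cintegralZ// -cintegralD//; last exact: cintegrableZ.
have [ir ii] := cintegrableD (cintegrableZ c jf) jg; have [lr li] := jl.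
rewrite /cintegral /Rintegral; congr (fine _ +i* fine _); apply: ae_eq_integral => //.
- by case/integrableP: lr.
- by case/integrableP: ir.
- by apply: filterS (ae_linear c tf tg) => w h _; rewrite h.
- by case/integrableP: li.
- by case/integrableP: ii.
- by apply: filterS (ae_linear c tf tg) => w h _; rewrite h.
Qed.

Lemma sq_norm_cst (z : R[i]) : sq_norm P (fun=> z) = (abs2 z)%:E.
Proof. by rewrite /sq_norm integral_cst//= -[RHS]mule1 -(@probability_setT _ _ _ P). Qed.

Lemma sq_norm_le_variance f : test f ->
  (sq_norm P (M f) <= 2%:E * cvariance P (M f) + (2 * abs2 (cexpectation P (M f)))%:E)%E.
Proof.
move=> tf; have [mM _] := wsm_square_integrable wsM tf.
have mc : cmeasurable (fun _ : Omega => cexpectation P (M f)) by exact: cmeasurable_cst.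
rewrite (eq_sq_norm P (g := fun w => (M f w - cexpectation P (M f)) + cexpectation P (M f))).
  apply: le_trans (sq_normD P (cmeasurableB mM mc) mc) _.
  by rewrite sq_norm_cst -EFinM.
by move=> w; rewrite subrK.
Qed.

Variable S : {measure set Rd -> \bar R}.
Hypothesis spec : is_spectral_measure P M S.

Lemma spectral_variance f : test f ->
  cvariance P (M f) = (((2 * pi) ^- n)%:E * sq_norm S (fourier f))%E.
Proof. by have [_ h] := spec => /h. Qed.

Let pin : 0 < (2 * pi) ^+ n :> R.
Proof. by rewrite exprn_gt0// mulr_gt0// pi_gt0. Qed.

Lemma cvariance_lty f : test f -> (cvariance P (M f) < +oo)%E.
Proof.
move=> tf; have [mM iM] := wsm_square_integrable wsM tf.
have mc : cmeasurable (fun _ : Omega => - cexpectation P (M f)) by exact: cmeasurable_cst.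
apply: le_lt_trans (sq_normD P mM mc) _.
by rewrite sq_norm_cst lte_add_pinfty ?ltry// lte_mul_pinfty ?lee_fin.
Qed.

(** [S] may have infinite mass; finiteness comes from that of the variance, through the spectral
    formula. *)
Lemma sq_norm_fourier_lty f : test f -> (sq_norm S (fourier f) < +oo)%E.
Proof.
move=> tf; have := cvariance_lty tf; rewrite spectral_variance//.
apply: contraTT; rewrite -!leNgt !leye_eq => /eqP ->.
by rewrite gt0_muley// lte_fin invr_gt0.
Qed.

Lemma cvariance_linear_le c f g : test f -> test g ->
  (cvariance P (M (fun x => c * f x + g x)%R) <=
   (2 * abs2 c)%R%:E * cvariance P (M f) + 2%:E * cvariance P (M g))%E.
Proof.
move=> tf tg.
have mf := cmeasurable_fourier tf; have mg := cmeasurable_fourier tg.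
have mcf : cmeasurable (fun u => c * fourier f u) by apply: cmeasurableM => //; exact: cmeasurable_cst.
rewrite !spectral_variance//; last exact: test_function_linear.
rewrite (eq_sq_norm S (fun u => fourier_linear c u tf tg)).
rewrite [(_%:E * (_%:E * _))%E in leRHS]muleCA [(2%:E * _)%E in leRHS]muleCA -ge0_muleDr; last 2 first.
- by rewrite mule_ge0 ?sq_norm_ge0// lee_fin mulr_ge0// abs2_ge0.
- by rewrite mule_ge0 ?sq_norm_ge0.
apply: lee_wpmul2l; first by rewrite lee_fin invr_ge0 ltW.
by rewrite EFinM -muleA -sq_normZ//; exact: sq_normD.
Qed.

End continuous_case.

Lemma ge0_lty_EFin (R : realType) (x : \bar R) : (0 <= x)%E -> (x < +oo)%E ->
  exists2 v : R, 0 <= v & x = v%:E.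
Proof. by case: x => // v; rewrite lee_fin; exists v. Qed.

(** With d = e / (8 (1 + a)), the hypothesis says v < d b, hence a v / b <= a d <= e / 8. The two
    terms then add up to less than 2 (2 e / 8 + 2 e / 8) = e. *)
Lemma correction_bound (R : realFieldType) (a b v w e : R) : 0 <= a -> 0 < b -> 0 < e ->
  (e / (8 * (1 + a)))^-1 * v < b -> w < e / 8 -> 2 * (2 * (a / b) * v + 2 * w) < e.
Proof.
move=> a0 b0 e0; have a1 : 0 < 8 * (1 + a) by rewrite mulr_gt0// ltr_wpDr.
rewrite ltr_pdivrMl ?divr_gt0// => hv hw.
have k1 : a / b * v <= a * (e / (8 * (1 + a))).
  by rewrite mulrAC ler_pdivrMr// -mulrA ler_wpM2l// ltW.
have k2 : a * (e / (8 * (1 + a))) <= e / 8.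
  by rewrite mulrA ler_pdivrMr//; nra.
by rewrite -[2 * (_ / _) * v]mulrA; move: k1; set k := _ / _ * v => k1; lra.
Qed.

(** * Correction of the mean *)

Section negligible_mean.
Context {R : realType} {n : nat} {dO : measure_display} {Omega : measurableType dO}.
Variable P : probability Omega R.
Local Notation T := (measurableTypeR R).
Local Notation Rd := (n.-tuple T).
Local Notation orthant := (@negative_orthant T n).
Local Notation test := (@test_function R n setT).
Variable M : (Rd -> R[i]) -> Omega -> R[i].
Hypothesis wsM : weakly_stationary_measure P M.
Variable S : {measure set Rd -> \bar R}.
Hypothesis spec : is_spectral_measure P M S.
Implicit Types f h : Rd -> R[i].

Local Notation V f := (cvariance P (M f)).
Local Notation E f := (cexpectation P (M f)).

Let toT h : test_function orthant h -> test h.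
Proof. exact: test_function_sub (@subsetT _ _). Qed.

(* Either the mean is controlled by the variance, or there are test functions of
   mean 1 and arbitrarily small variance; stationarity moves them into the orthant,
   where they correct the mean. *)
Lemma interpolation_of_variance f : test f ->
  (forall e : R, 0 < e -> exists h, test_function orthant h /\
    (V (fun x => -1 * h x + f x)%R < e%:E)%E) ->
  forall e : R, 0 < e -> exists h, test_function orthant h /\
    (sq_norm P (M (fun x => -1 * h x + f x)%R) < e%:E)%E.
Proof.
move=> tf approx e e0.
have tlin c h g : test h -> test g -> test (fun x => c * h x + g x).
  exact: test_function_linear.
have [[C [C0 hC]]|nC] := pselect (exists C : R, 0 <= C /\
    forall h, test h -> ((abs2 (E h))%:E <= C%:E * V h)%E).
(* Here the second moment is at most 2 V + 2 |E|^2 <= 2 (1 + C) V. *)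
- have C10 : 0 < 2 * (1 + C) by rewrite mulr_gt0// ltr_wpDr.
  have [h [th hlt]] := approx (e / (2 * (1 + C))) (divr_gt0 e0 C10).
  exists h; split => //.
  have tg := tlin (-1) _ _ (toT th) tf.
  apply: le_lt_trans (sq_norm_le_variance wsM tg) _.
  have := cvariance_lty wsM tg; have := hC _ tg; move: hlt.
  have : (0 <= V (fun x => -1 * h x + f x)%R)%E.
    by apply: integral_ge0 => w _; rewrite lee_fin abs2_ge0.
  case: (V _) => // v; rewrite lee_fin lte_fin -EFinM lee_fin => v0 hv hE _.
  rewrite -EFinM -EFinD lte_fin; move: hv; rewrite ltr_pdivlMr// => hv.
  nra.
have e8 : 0 < e / 8 by rewrite divr_gt0.
have [h [th hlt]] := approx (e / 8) e8.
have tg := tlin (-1) _ _ (toT th) tf.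
set g := (fun x => -1 * h x + f x)%R in tg hlt.
(* The failure of control with constant 1 / d yields p with V p < d |E p|^2. The correction c p,
   with c = - E g / E p, cancels the mean of g, and its variance |c|^2 V p is at most |E g|^2 d <= e
   / 8. *)
pose d := e / (8 * (1 + abs2 (E g))).
have a0 := abs2_ge0 (E g).
have d0 : 0 < d by rewrite divr_gt0// mulr_gt0// ltr_wpDr.
have [p [tp hp]] : exists p, test p /\ (d^-1%:E * V p < (abs2 (E p))%:E)%E.
  apply: contrapT => np; apply: nC; exists d^-1; split; first by rewrite invr_ge0 ltW.
  by move=> p tp; rewrite leNgt; apply/negP => hp; apply: np; exists p.
have [x tq] := test_function_translate_into_orthant tp.
set q := translate x p in tq.
have Eq : E q = E p := wsm_mean wsM x tp.
have Vq : V q = V p := wsm_variance wsM x tp.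
have Vp0 : (0 <= V p)%E by apply: integral_ge0 => w _; rewrite lee_fin abs2_ge0.
have Ep0 : E p != 0.
  have di0 : (0 <= d^-1%:E)%E by rewrite lee_fin invr_ge0 ltW.
  by rewrite -abs2_gt0 -lte_fin; exact: le_lt_trans (mule_ge0 di0 Vp0) hp.
pose c := - (E g / E q).
have tg' := tlin c _ _ (toT tq) tg.
exists (fun y => - c * q y + h y); split; first exact: test_function_linear.
have -> : (fun y => -1 * (- c * q y + h y) + f y) = (fun y => c * q y + g y).
  by apply/funext => y; rewrite /g; ring.
apply: le_lt_trans (sq_norm_le_variance wsM tg') _.
rewrite (cexpectation_linear wsM c (toT tq) tg).
have -> : c * E q + E g = 0 by rewrite /c mulNr divfK; [exact: addNr|rewrite Eq; exact: Ep0].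
rewrite abs2_0 mulr0 adde0.
have := cvariance_linear_le spec c (toT tq) tg.
have Vg0 : (0 <= V g)%E by apply: integral_ge0 => w _; rewrite lee_fin abs2_ge0.
have [vg vg0 vgE] := ge0_lty_EFin Vg0 (cvariance_lty wsM tg).
have [v v0 vE] := ge0_lty_EFin Vp0 (cvariance_lty wsM tp).
rewrite Vq vgE vE; move: hlt hp; rewrite vgE vE lte_fin -EFinM lte_fin => hvg hv.
move=> hW; apply: (@le_lt_trans _ _ (2 * (2 * abs2 c * v + 2 * vg))%:E).
  have /(lee_wpmul2l _) := hW; apply.
  by rewrite lee_fin.
rewrite lte_fin.
have -> : abs2 c = abs2 (E g) / abs2 (E p) by rewrite /c abs2N abs2M abs2V Eq.
have b0 : 0 < abs2 (E p) by rewrite abs2_gt0.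
exact: (correction_bound a0 b0 e0 hv hvg).
Qed.

End negligible_mean.

Lemma continuous_interpolation (R : realType) (n : nat)
    (dO : measure_display) (Omega : measurableType dO) (P : probability Omega R)
    (M : (n.-tuple (measurableTypeR R) -> R[i]) -> Omega -> R[i])
    (S : {measure set (n.-tuple (measurableTypeR R)) -> \bar R})
    (S_ : 'I_n -> {sigma_finite_measure set (measurableTypeR R) -> \bar R})
    (s_ : 'I_n -> measurableTypeR R -> R) :
  weakly_stationary_measure P M ->
  is_spectral_measure P M S ->
  (forall i, [/\ symmetric_measure real_opp (S_ i),
                 (\int[S_ i]_u (real_weight u)%:E < +oo)%E,
                 ac_density lebesgue_measure (S_ i) (s_ i)
               & log_integral lebesgue_measure real_weight (s_ i) = -oo%E]) ->
  (forall A, measurable A -> (S A <= product_measure S_ A)%E) ->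
  perfectly_interpolable P test_function M
    (@negative_orthant (measurableTypeR R) n).
Proof.
move=> wsM spec hS leS; apply: perfectly_interpolable_of_close => f tf e e0.
have toT A h : test_function A h -> @test_function R n setT h.
  exact: test_function_sub (@subsetT _ _).
have tfT := toT _ _ tf.
have lin g : @test_function R n setT g ->
    @test_function R n setT (fun x => -1 * g x + f x).
  by move=> tg; exact: test_function_linear.
have [h [th hlt]] : exists h, test_function (@negative_orthant (measurableTypeR R) n) h /\
    (sq_norm P (M (fun x => -1 * h x + f x)%R) < e%:E)%E.
  apply: (interpolation_of_variance wsM spec tfT) e0 => {}e e0.
  have iS i : (sq_norm (S_ i) cut_resolvent < +oo)%E.
    by have [_ hi _ _] := hS i; exact: cut_resolvent_integrable.
  have szegoS i (c : R) : 0 < c -> exists q : {poly R[i]},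
      (\int[S_ i]_u (abs2 (1 + cayley u * q.[cayley u]) * abs2 (cut_resolvent u))%:E < c%:E)%E.
    by have [_ hi dens hlog] := hS i; exact: (line_szego hi dens hlog).
  have DDE : @orthant_spectrum R n (tensor_power cut_resolvent).
    exists (@orthant_exp R n); split; first exact: test_function_orthant_exp.
    by apply/funext => u; rewrite fourier_orthant_exp.
  have DDw D i (c : R) : @orthant_spectrum R n D -> 0 < c -> exists D', orthant_spectrum D' /\
      (sq_norm S (fun u => cayley (tnth u i) * D u - D' u)%R < c%:E)%E.
    move=> hD c0; apply: cayley_orthant_spectrum => //.
    by have [g [tg ->]] := hD; exact: (sq_norm_fourier_lty wsM spec (toT _ _ tg)).
  have pin : 0 < (2 * pi) ^+ n :> R by rewrite exprn_gt0// mulr_gt0// pi_gt0.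
  have [_ [[h [th ->]] hlt]] := L2_closure_full cmeasurable_cayley abs2_cayley
    cmeasurable_cut_resolvent cut_resolvent_neq0 (@cayley_generated R) iS szegoS leS
    (@cmeasurable_orthant_spectrum R n) (@orthant_spectrum_linear R n) DDE DDw
    (cmeasurable_fourier tfT) (sq_norm_fourier_lty wsM spec tfT) (mulr_gt0 pin e0).
  exists h; split => //.
  rewrite (spectral_variance spec (lin _ (toT _ _ th))).
  rewrite (eq_sq_norm S (g := fun u => fourier f u - fourier h u)); last first.
    by move=> u; rewrite fourier_linear//; [rewrite mulN1r addrC|exact: toT th].
  have -> : e%:E = (((2 * pi) ^- n)%:E * ((2 * pi) ^+ n * e)%:E)%E.
    by rewrite -EFinM mulrA mulVf ?mul1r// gt_eqF.
  by rewrite lte_pmul2l ?lte_fin ?invr_gt0.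
(* M h - M f and - M (f - h) agree only almost surely, which is enough for the integrals. *)
exists h; split => //; apply: le_lt_trans hlt.
have [mh _] := wsm_square_integrable wsM (toT _ _ th).
have [mf _] := wsm_square_integrable wsM tfT.
have [mg _] := wsm_square_integrable wsM (lin _ (toT _ _ th)).
rewrite /sq_norm le_eqVlt; apply/orP; left; apply/eqP.
apply: ae_eq_integral => //.
- by apply: measurable_abs2E; exact: cmeasurableB.
- exact: measurable_abs2E.
- apply: filterS (ae_linear wsM (-1) (toT _ _ th) tfT) => w hw _.
  by rewrite hw -abs2N; congr (abs2 _)%:E; ring.
Qed.

Theorem proposition1 (R : realType) (d : nat)
    (dO : measure_display) (Omega : measurableType dO) (P : probability Omega R) :
  (* E = R *)
  (forall (M : (d.-tuple (measurableTypeR R) -> R[i]) -> Omega -> R[i])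
      (S : {measure set (d.-tuple (measurableTypeR R)) -> \bar R})
      (S_ : 'I_d -> {sigma_finite_measure set (measurableTypeR R) -> \bar R})
      (s_ : 'I_d -> measurableTypeR R -> R),
    weakly_stationary_measure P M ->
    is_spectral_measure P M S ->
    (forall i, [/\ symmetric_measure real_opp (S_ i),
                   (\int[S_ i]_u (real_weight u)%:E < +oo)%E,
                   ac_density lebesgue_measure (S_ i) (s_ i)
                 & log_integral lebesgue_measure real_weight (s_ i) = -oo%E]) ->
    (forall A, measurable A -> (S A <= product_measure S_ A)%E) ->
    perfectly_interpolable P test_function M
      (@negative_orthant (measurableTypeR R) d))
  /\
  (* E = Z *)
  (forall (M : d.-tuple int -> Omega -> R[i])
      (S : {measure set (d.-tuple (circle R)) -> \bar R})
      (S_ : 'I_d -> {sigma_finite_measure set (circle R) -> \bar R})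
      (s_ : 'I_d -> circle R -> R),
    weakly_stationary_field P M ->
    is_lattice_spectral_measure P M S ->
    (forall i, [/\ symmetric_measure circle_conj (S_ i),
                   (\int[S_ i]_u (circle_weight u)%:E < +oo)%E,
                   ac_density arc_length (S_ i) (s_ i)
                 & log_integral arc_length circle_weight (s_ i) = -oo%E]) ->
    (forall A, measurable A -> (S A <= product_measure S_ A)%E) ->
    perfectly_interpolable P lattice_test_function (field_integral M)
      (@negative_orthant int d)).

Proof.
split.
- by move=> M S S_ s_ *; exact: (@continuous_interpolation R d dO Omega P M S S_ s_).
- by move=> M S S_ s_ *; exact: (@lattice_interpolation R d dO Omega P M S S_ s_).
Qed.
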